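(* Let $\mathfrak g$ be one of $\mathfrak{sl}_n$, $\mathfrak{so}_{2n+1}$, $\mathfrak{so}_{2n}$, $\mathfrak{sp}_{2n}$, let $U_{r,s}(\mathfrak g)$ be the two-parameter quantum group with index set $I$ and structure constants $p_{ij}$ defined in the context, and let $\mathcal B$ (resp. $\mathcal B'$) be its Hopf subalgebra generated by $e_j,\omega_j^{\pm1}$ (resp. $f_j,\omega_j'^{\pm1}$), $j\in I$. There exists a unique skew-dual pairing $\langle\,,\rangle:\mathcal B'\times\mathcal B\to\mathbb K$ of the Hopf algebras $\mathcal B$ and $\mathcal B'$ such that for all $i,j\in I$ $$\langle f_i,e_j\rangle=\delta_{ij}\frac1{s_i-r_i},\qquad \langle\omega_i',\omega_j\rangle=p_{ij},\qquad \langle\omega_i'^{\pm1},\omega_j^{-1}\rangle=\langle\omega_i'^{\pm1},\omega_j\rangle^{-1}=\langle\omega_i',\omega_j\rangle^{\mp1},$$ and all other pairs of generators are $0$ (that is, $\langle f_i,\omega_j^{\pm1}\rangle=0=\langle\omega_i'^{\pm1},e_j\rangle$). Moreover, $\langle S(a),S(b)\rangle=\langle a,b\rangle$ for all $a\in\mathcal B'$, $b\in\mathcal B$.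
   Context: Base field: $\mathbb K=\mathbb Q(r,s)$, where $r,s$ are either two indeterminates, or nonzero parameters in $\mathbb C$ with $r^2\ne s^2$. Skew-dual pairing: a bilinear form $\langle\,,\rangle:\mathcal U\times\mathcal A\to\mathbb K$ of Hopf algebras $\mathcal A,\mathcal U$ is a dual pairing if $\langle f,1\rangle=\varepsilon(f)$, $\langle1,a\rangle=\varepsilon(a)$, $\langle f,a_1a_2\rangle=\langle\Delta(f),a_1\otimes a_2\rangle$ and $\langle f_1f_2,a\rangle=\langle f_1\otimes f_2,\Delta(a)\rangle$ for all $f,f_1,f_2\in\mathcal U$, $a,a_1,a_2\in\mathcal A$. It is a skew-dual pairing of $\mathcal A$ and $\mathcal U$ if it is a dual pairing of $\mathcal A$ and $\mathcal U^{\mathrm{cop}}$, the Hopf algebra $\mathcal U$ with opposite comultiplication (i.e. $\Delta(f)$ is replaced by $\Delta^{\mathrm{op}}(f)$ above). Roots: $\epsilon_1,\dots,\epsilon_n$ is an orthonormal basis of $\mathbb R^n$ with inner product $(\,,)$; $\alpha_i=\epsilon_i-\epsilon_{i+1}$ for $1\le i<n$, and $\alpha_n=\epsilon_n$ for $\mathfrak{so}_{2n+1}$ (type $B_n$, $n\ge2$), $\alpha_n=2\epsilon_n$ for $\mathfrak{sp}_{2n}$ (type $C_n$, $n\ge2$), $\alpha_n=\epsilon_{n-1}+\epsilon_n$ for $\mathfrak{so}_{2n}$ (type $D_n$, $n\ge4$). Index set $I=\{1,\dots,n-1\}$ for $\mathfrak{sl}_n$ (type $A_{n-1}$), $I=\{1,\dots,n\}$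 otherwise. $a_{ij}=2(\alpha_i,\alpha_j)/(\alpha_i,\alpha_i)$. Put $r_i=r^{(\alpha_i,\alpha_i)}$, $s_i=s^{(\alpha_i,\alpha_i)}$ in type $B$ and $r_i=r^{(\alpha_i,\alpha_i)/2}$, $s_i=s^{(\alpha_i,\alpha_i)/2}$ in types $A,C,D$. Structure constants $p_{ij}$, $i,j\in I$: Type $A$: $p_{ij}=r^{(\epsilon_j,\alpha_i)}s^{(\epsilon_{j+1},\alpha_i)}$. Type $B$: $p_{ij}=r^{2(\epsilon_j,\alpha_i)}s^{2(\epsilon_{j+1},\alpha_i)}$ if $j<n$; $p_{in}=r^{2(\epsilon_n,\alpha_i)}$ if $i<n$; $p_{nn}=r^{(\epsilon_n,\alpha_n)}s^{-(\epsilon_n,\alpha_n)}=rs^{-1}$. Type $C$: $p_{ij}=r^{(\epsilon_j,\alpha_i)}s^{(\epsilon_{j+1},\alpha_i)}$ if $j<n$; $p_{in}=r^{2(\epsilon_n,\alpha_i)}$ if $i<n$; $p_{nn}=r^{(\epsilon_n,\alpha_n)}s^{-(\epsilon_n,\alpha_n)}=r^2s^{-2}$. Type $D$: $p_{ij}=r^{(\epsilon_j,\alpha_i)}s^{(\epsilon_{j+1},\alpha_i)}$ if $j<n$; $p_{in}=r^{(\epsilon_{n-1},\alpha_i)}s^{-(\epsilon_n,\alpha_i)}$ if $i\ne n-1$; $p_{n-1,n}=r^{(\epsilon_n,\alpha_{n-1})}s^{-(\epsilon_{n-1},\alpha_{n-1})}=r^{-1}s^{-1}$. $U_{r,s}(\mathfrak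 g)$ is the unital associative $\mathbb K$-algebra generated by $e_i,f_i,\omega_i^{\pm1},\omega_i'^{\pm1}$ ($i\in I$) subject to: (1) the $\omega_i^{\pm1},\omega_j'^{\pm1}$ all commute and $\omega_i\omega_i^{-1}=\omega_j'\omega_j'^{-1}=1$; (2) $\omega_je_i\omega_j^{-1}=p_{ij}e_i$, $\ \omega_jf_i\omega_j^{-1}=p_{ij}^{-1}f_i$; (3) $\omega_j'e_i\omega_j'^{-1}=p_{ji}^{-1}e_i$, $\ \omega_j'f_i\omega_j'^{-1}=p_{ji}f_i$; (4) $[e_i,f_j]=\delta_{ij}\dfrac{\omega_i-\omega_i'}{r_i-s_i}$; (5) ($e$-Serre relations) Types $A,B,C$: $[e_i,e_j]=0$ for $|i-j|>1$. Type $D$: $[e_i,e_j]=0$ for $i\neq j$ with $a_{ij}=0$ and $\{i,j\}\ne\{n-1,n\}$, and $e_{n-1}e_n=rs\,e_ne_{n-1}$. Types $A,D$: for $i<j$ in $I$ with $a_{ij}=-1$, $e_i^2e_j-(r+s)e_ie_je_i+rs\,e_je_i^2=0$ and $e_j^2e_i-(r^{-1}+s^{-1})e_je_ie_j+r^{-1}s^{-1}e_ie_j^2=0$. Type $B$: $e_i^2e_{i+1}-(r_i+s_i)e_ie_{i+1}e_i+r_is_i\,e_{i+1}e_i^2=0$ for $1\le i<n$; $e_{j+1}^2e_j-(r_{j+1}^{-1}+s_{j+1}^{-1})e_{j+1}e_je_{j+1}+r_{j+1}^{-1}s_{j+1}^{-1}e_je_{j+1}^2=0$ for $1\le j<n-1$;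 $e_n^3e_{n-1}-(r^{-2}+r^{-1}s^{-1}+s^{-2})e_n^2e_{n-1}e_n+r^{-1}s^{-1}(r^{-2}+r^{-1}s^{-1}+s^{-2})e_ne_{n-1}e_n^2-r^{-3}s^{-3}e_{n-1}e_n^3=0$. Type $C$: for $1\le i<n-1$, $e_i^2e_{i+1}-(r+s)e_ie_{i+1}e_i+rs\,e_{i+1}e_i^2=0$ and $e_{i+1}^2e_i-(r^{-1}+s^{-1})e_{i+1}e_ie_{i+1}+r^{-1}s^{-1}e_ie_{i+1}^2=0$; $e_{n-1}^3e_n-(r^2+rs+s^2)e_{n-1}^2e_ne_{n-1}+rs(r^2+rs+s^2)e_{n-1}e_ne_{n-1}^2-(rs)^3e_ne_{n-1}^3=0$; $e_n^2e_{n-1}-(r^{-2}+s^{-2})e_ne_{n-1}e_n+r^{-2}s^{-2}e_{n-1}e_n^2=0$. (6) ($f$-Serre relations) each relation in (5) with every word reversed and every $e_k$ replaced by $f_k$. Hopf structure: $\omega_i^{\pm1},\omega_i'^{\pm1}$ are group-like, $\Delta(e_i)=e_i\otimes1+\omega_i\otimes e_i$, $\Delta(f_i)=1\otimes f_i+f_i\otimes\omega_i'$, $\varepsilon(e_i)=\varepsilon(f_i)=0$, $S(e_i)=-\omega_i^{-1}e_i$, $S(f_i)=-f_i\omega_i'^{-1}$. *)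

(* Defs.v *)
From HB Require Import structures.
From mathcomp Require Import all_boot all_order all_algebra.
From mathcomp Require Import generic_quotient ring_quotient fraction.
From mathcomp Require Import boolp reals complex finmap.
From mathcomp.multinomials Require Import monalg.

Set Implicit Arguments.
Unset Strict Implicit.
Unset Printing Implicit Defensive.

Import GRing.Theory.
Local Open Scope ring_scope.
Local Open Scope quotient_scope.

Section Span.
Variables (K : fieldType) (V : lmodType K) (G : V -> Prop).

Definition span_pred : {pred V} := fun v =>
  `[< forall S : {pred V}, submod_closed S ->
      (forall x, G x -> x \in S) -> v \in S >].

Lemma span_predP v : reflect
  (forall S : {pred V}, submod_closed S ->
      (forall x, G x -> x \in S) -> v \in S) (v \in span_pred).
Proof. exact: asboolP. Qed.

Fact span_subsemimod_closed : subsemimod_closed span_pred.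
Proof.
apply: GRing.submod_closed_semi; split.
  by apply/span_predP => S [].
move=> a u v /span_predP uS /span_predP vS; apply/span_predP => S S_sub S_G.
by apply: (proj2 S_sub); [exact: uS | exact: vS].
Qed.
HB.instance Definition _ := GRing.isSubmodClosed.Build K V span_pred
  span_subsemimod_closed.

Lemma span_linear : linear_closed span_pred.
Proof. by move=> a u v uI vI; rewrite rpredD // rpredZ. Qed.

Lemma span_gen x : G x -> x \in span_pred.
Proof. by move=> Gx; apply/span_predP => S _; apply. Qed.

End Span.

Section QuotientModule.
Variables (K : fieldType) (V : lmodType K) (G : V -> Prop).

Definition quotmod := Quotient.quot (span_pred G).
HB.instance Definition _ := Choice.on quotmod.
HB.instance Definition _ := GRing.Zmodule.on quotmod.

Definition qcls (v : V) : quotmod := \pi_(Quotient.quot (span_pred G)) v.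
Definition qrep (x : quotmod) : V := repr x.

Lemma qrepK : cancel qrep qcls.
Proof. exact: reprK. Qed.

Lemma qclsP (v w : V) : (qcls v == qcls w) = (v - w \in span_pred G).
Proof. by rewrite Quotient.idealrBE. Qed.

Lemma qclsD : {morph qcls : v w / v + w}.
Proof. by move=> v w; rewrite /qcls !piE. Qed.

Definition qscale (a : K) (x : quotmod) : quotmod := qcls (a *: qrep x).

Lemma qclsZ a v : qcls (a *: v) = qscale a (qcls v).
Proof.
apply/eqP; rewrite qclsP -scalerBr rpredZ // -qclsP; apply/eqP.
by rewrite qrepK.
Qed.

Fact qscaleA a b x : qscale a (qscale b x) = qscale (a * b) x.
Proof. by rewrite -[x]qrepK -!qclsZ scalerA. Qed.
Fact qscale1 : left_id 1 qscale.
Proof. by move=> x; rewrite -[x]qrepK -!qclsZ scale1r. Qed.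
Fact qscaleDr : right_distributive qscale +%R.
Proof.
by move=> a x y; rewrite -[x]qrepK -[y]qrepK -qclsD -!qclsZ scalerDr qclsD.
Qed.
Fact qscaleDl x : {morph qscale^~ x : a b / a + b}.
Proof. by move=> a b; rewrite -[x]qrepK -!qclsZ scalerDl qclsD. Qed.
HB.instance Definition _ := GRing.Zmodule_isLmodule.Build K quotmod
  qscaleA qscale1 qscaleDr qscaleDl.

Fact qcls_linear : linear qcls.
Proof. by move=> a u v; rewrite qclsD qclsZ. Qed.
HB.instance Definition _ := GRing.isLinear.Build K V quotmod *:%R qcls
  qcls_linear.

End QuotientModule.

Section Tensor.
Variables (K : fieldType) (A B : lmodType K).

Let pt (a : A) (b : B) : {malg K[(A * B)%type]} := << (a, b) >>.

Inductive tensor_relator : {malg K[(A * B)%type]} -> Prop :=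
| tensor_linl k a a' b :
    tensor_relator (pt (k *: a + a') b - (k *: pt a b + pt a' b))
| tensor_linr k a b b' :
    tensor_relator (pt a (k *: b + b') - (k *: pt a b + pt a b')).

Definition tensor := quotmod tensor_relator.
HB.instance Definition _ := GRing.Lmodule.on tensor.

Definition tens (a : A) (b : B) : tensor := qcls tensor_relator (pt a b).

(* The linear map on the tensor product attached to a bilinear map f; the      *)
(* value does not depend on the representative when f is bilinear.             *)
Definition tlift (W : lmodType K) (f : A -> B -> W) (t : tensor) : W :=
  let g := qrep t in \sum_(k <- msupp g) g@_k *: f k.1 k.2.

End Tensor.

Section TensorLift.
Variables (K : fieldType) (A B W : lmodType K) (f : A -> B -> W).
Hypothesis f_linl : forall b, linear (f^~ b).
Hypothesis f_linr : forall a, linear (f a).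

Let ev (g : {malg K[(A * B)%type]}) : W :=
  \sum_(k <- msupp g) g@_k *: f k.1 k.2.

Let evEw (d : {fset A * B}) g : (msupp g `<=` d)%fset ->
  ev g = \sum_(k <- d) g@_k *: f k.1 k.2.
Proof.
move=> le; rewrite /ev (big_fset_incl _ le) //= => x xd.
by move=> /mcoeff_outdom ->; rewrite scale0r.
Qed.

Let ev_linear : linear ev.
Proof.
move=> c g h; pose d := (msupp g `|` msupp h `|` msupp (c *: g + h))%fset.
rewrite (@evEw d (c *: g + h)) ?fsubsetUr // (@evEw d g); last first.
  by rewrite /d -fsetUA fsubsetUl.
rewrite (@evEw d h); last by rewrite /d (fsetUC (msupp g)) -fsetUA fsubsetUl.
rewrite scaler_sumr -big_split; apply: eq_bigr => k _.
by rewrite mcoeffD mcoeffZ scalerDl scalerA.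
Qed.

Let evU a b : ev << (a, b) >> = f a b.
Proof.
by rewrite (evEw (msuppU_le (k := (a, b)))) big_seq_fset1 mcoeffUU scale1r.
Qed.

Let ev_cls g : tlift f (qcls (@tensor_relator K A B) g) = ev g.
Proof.
pose E : {pred {malg K[(A * B)%type]}} := fun g => ev g == 0.
have evB u v : ev (u - v) = ev u - ev v.
  by rewrite -[- v]scaleN1r [u + _]addrC ev_linear scaleN1r addrC.
have ev0 : ev 0 = 0 by rewrite -(subrr 0) evB subrr.
suff /eqP : ev (qrep (qcls (@tensor_relator K A B) g) - g) = 0.
  by rewrite evB subr_eq0 => /eqP.
have /span_predP/(_ E) : qrep (qcls (@tensor_relator K A B) g) - g
    \in span_pred (@tensor_relator K A B).
  by rewrite -qclsP qrepK.
move=> inE; apply/eqP; apply: inE.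
  split=> [|a u v]; first by rewrite unfold_in ev0.
  by rewrite !unfold_in ev_linear => /eqP-> /eqP->; rewrite scaler0 addr0.
move=> _ [k a a' b|k a b b']; rewrite unfold_in evB ev_linear !evU subr_eq0.
  by rewrite f_linl.
by rewrite f_linr.
Qed.

Lemma tlift_tens a b : tlift f (tens a b) = f a b.
Proof. by rewrite ev_cls evU. Qed.

Lemma tlift_linear : linear (tlift f).
Proof.
move=> c t u; rewrite -[t]qrepK -[u]qrepK -linearP !ev_cls.
exact: ev_linear.
Qed.

End TensorLift.

Section HopfAlgebra.
Variable K : fieldType.

Definition tmul (A : algType K) (t u : tensor A A) : tensor A A :=
  tlift (fun a b => tlift (fun c d => tens (a * c) (b * d)) u) t.

Definition tswap (A : lmodType K) : tensor A A -> tensor A A :=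
  tlift (fun a b => tens b a).

Definition tmap (A A' B B' : lmodType K) (f : A -> A') (g : B -> B') :
    tensor A B -> tensor A' B' :=
  tlift (fun a b => tens (f a) (g b)).

Record coalg (A : algType K) := Coalg {
  comul : A -> tensor A A;
  counit : A -> K
}.

Record hopf (A : algType K) := Hopf {
  hopf_coalg :> coalg A;
  antipode : A -> A;
  comul_linear : linear (comul hopf_coalg);
  counit_linear : scalar (counit hopf_coalg);
  antipode_linear : linear antipode;
  comul_coassoc : forall a,
    tlift (fun x y =>
        tlift (fun u v => tens u (tens v y)) (comul hopf_coalg x))
      (comul hopf_coalg a)
    = tlift (fun x y => tens x (comul hopf_coalg y)) (comul hopf_coalg a);
  comul_counitl : forall a,
    tlift (fun x y => counit hopf_coalg x *: y) (comul hopf_coalg a) = a;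
  comul_counitr : forall a,
    tlift (fun x y => counit hopf_coalg y *: x) (comul hopf_coalg a) = a;
  comul_1 : comul hopf_coalg 1 = tens 1 1;
  comul_mul : forall a b,
    comul hopf_coalg (a * b) = tmul (comul hopf_coalg a) (comul hopf_coalg b);
  counit_1 : counit hopf_coalg 1 = 1;
  counit_mul : forall a b,
    counit hopf_coalg (a * b) = counit hopf_coalg a * counit hopf_coalg b;
  antipodel : forall a,
    tlift (fun x y => antipode x * y) (comul hopf_coalg a)
    = (counit hopf_coalg a)%:A;
  antipoder : forall a,
    tlift (fun x y => x * antipode y) (comul hopf_coalg a)
    = (counit hopf_coalg a)%:A
}.

Definition cop (A : algType K) (c : coalg A) : coalg A :=
  Coalg (fun a => tswap (comul c a)) (counit c).

(* <x (x) y, a (x) b> = <x, a> <y, b> *)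
Definition pairing2 (U A : algType K) (p : U -> A -> K)
    (t : tensor U U) (u : tensor A A) : K :=
  tlift (W := K^o) (fun x y =>
    tlift (W := K^o) (fun a b => p x a * p y b) u) t.

Record dual_pairing (U A : algType K) (cU : coalg U) (cA : coalg A)
    (p : U -> A -> K) : Prop := DualPairing {
  pairing_linearl : forall a, scalar (p^~ a);
  pairing_linearr : forall f, scalar (p f);
  pairing_1r : forall f, p f 1 = counit cU f;
  pairing_1l : forall a, p 1 a = counit cA a;
  pairing_mulr : forall f a1 a2,
    p f (a1 * a2) = pairing2 p (comul cU f) (tens a1 a2);
  pairing_mull : forall f1 f2 a,
    p (f1 * f2) a = pairing2 p (tens f1 f2) (comul cA a)
}.

Definition skew_dual_pairing (U A : algType K) (cU : coalg U) (cA : coalg A)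
    (p : U -> A -> K) : Prop :=
  dual_pairing (cop cU) cA p.

End HopfAlgebra.

Section Subalgebra.
Variables (K : fieldType) (A : algType K) (X : A -> Prop).

Definition gen_pred : {pred A} := fun a =>
  `[< forall S : {pred A}, subalg_closed S ->
      (forall x, X x -> x \in S) -> a \in S >].

Lemma gen_predP a : reflect
  (forall S : {pred A}, subalg_closed S ->
      (forall x, X x -> x \in S) -> a \in S) (a \in gen_pred).
Proof. exact: asboolP. Qed.

Fact gen_subsemialg_closed : GRing.subsemialg_closed gen_pred.
Proof.
apply: GRing.subalg_closed_semi; split.
- by apply/gen_predP => S [].
- move=> k u v /gen_predP uS /gen_predP vS; apply/gen_predP => S S_sub S_X.
  by case: (S_sub) => _ S_lin _; apply: S_lin; [exact: uS | exact: vS].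
- move=> u v /gen_predP uS /gen_predP vS; apply/gen_predP => S S_sub S_X.
  by case: (S_sub) => _ _ S_mul; apply: S_mul; [exact: uS | exact: vS].
Qed.
HB.instance Definition _ := GRing.isSubalgClosed.Build K A gen_pred
  gen_subsemialg_closed.

Lemma mem_gen x : X x -> x \in gen_pred.
Proof. by move=> Xx; apply/gen_predP => S _; apply. Qed.

Record subalg := Subalg { subalg_val : A; subalgP : subalg_val \in gen_pred }.
HB.instance Definition _ := [isSub for subalg_val].
HB.instance Definition _ := [Choice of subalg by <:].
HB.instance Definition _ := [SubChoice_isSubAlgebra of subalg by <:].

(* A Hopf subalgebra: the inclusion is a morphism of Hopf algebras.            *)
Definition hopf_sub (HX : hopf subalg) (H : hopf A) : Prop :=
  [/\ forall b, tmap val val (comul HX b) = comul H (val b),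
      forall b, counit HX b = counit H (val b)
    & forall b, val (antipode HX b) = antipode H (val b)].

End Subalgebra.

Fact mulr_regroup (R : pzRingType) (a c y d b : R) :
  a * c * y * (d * b) = a * (c * y * d) * b.
Proof. by rewrite !mulrA. Qed.

Section FreeAlgebra.
Variables (K : fieldType) (X : choiceType).

Definition free_alg : Type := {malg K[{fmonom X}]}.
HB.instance Definition _ := GRing.Lalgebra.on free_alg.

Fact free_scalerAr (k : K) (u v : free_alg) : k *: (u * v) = u * (k *: v).
Proof.
have uC : (u : {malg K[{fmonom X}]}) * malgC k = k *: u.
  rewrite malgZ_def; apply: etrans (fgmulgU _ _ _) _.
  by apply: eq_bigr => m _; rewrite mulm1 mulrC.
have -> : k *: v = malgC k * (v : {malg K[{fmonom X}]}) by rewrite mul_malgC.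
by rewrite scalerAl -uC -mulrA.
Qed.
HB.instance Definition _ := GRing.Lalgebra_isAlgebra.Build K free_alg
  free_scalerAr.

Definition fvar (x : X) : free_alg := << fmu x >>.

End FreeAlgebra.

Section Presentation.
Variables (K : fieldType) (X : choiceType).

Local Notation free_alg := (free_alg K X).

Variable rel : free_alg -> Prop.

Inductive ideal_gen : free_alg -> Prop :=
| IdealGen a x b : rel x -> ideal_gen (a * x * b).

Definition presented := quotmod ideal_gen.
HB.instance Definition _ := GRing.Lmodule.on presented.

Definition pcls (u : free_alg) : presented := qcls ideal_gen u.
Definition prep (x : presented) : free_alg := qrep x.
Notation I := (span_pred ideal_gen).

Fact pcls_linear : linear pcls.
Proof. exact: linearP. Qed.
HB.instance Definition _ := GRing.isLinear.Build K free_alg presented *:%R pcls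
  pcls_linear.

Lemma prepK : cancel prep pcls.
Proof. exact: qrepK. Qed.

Fact ideal_mul (a x b : free_alg) : x \in I -> a * x * b \in I.
Proof.
move=> xI; pose S : {pred free_alg} := fun y => a * y * b \in I.
have SE y : (y \in S) = (a * y * b \in I) by [].
rewrite -SE; move/span_predP: xI; apply.
  split=> [|k u v]; first by rewrite SE mulr0 mul0r rpred0.
  rewrite !SE mulrDr mulrDl -scalerAr -scalerAl => uI vI.
  exact: (span_linear k uI vI).
move=> _ [c y d y_rel]; rewrite SE.
rewrite -mulr_regroup.
exact/span_gen/IdealGen.
Qed.

Fact pmul_key : unit. Proof. exact: tt. Qed.
Definition pmul : presented -> presented -> presented :=
  locked_with pmul_key (fun x y => pcls (prep x * prep y)).

Lemma pclsM (u v : free_alg) : pcls (u * v) = pmul (pcls u) (pcls v).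
Proof.
rewrite /pmul unlock; apply/eqP; rewrite /pcls qclsP.
have -> : u * v - prep (pcls u) * prep (pcls v)
   = 1 * (u - prep (pcls u)) * v + prep (pcls u) * (v - prep (pcls v)) * 1.
  by rewrite mul1r mulr1 mulrBl mulrBr addrA subrK.
by rewrite rpredD // ideal_mul // -qclsP eq_sym; apply/eqP/prepK.
Qed.

Fact presented_mulA : associative pmul.
Proof.
by move=> x y z; rewrite -[x]prepK -[y]prepK -[z]prepK -!pclsM mulrA.
Qed.
Fact presented_mul1l : left_id (pcls 1) pmul.
Proof. by move=> x; rewrite -[x]prepK -pclsM mul1r. Qed.
Fact presented_mul1r : right_id (pcls 1) pmul.
Proof. by move=> x; rewrite -[x]prepK -pclsM mulr1. Qed.
Fact presented_mulDl : left_distributive pmul +%R.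
Proof.
move=> x y z; rewrite -[x]prepK -[y]prepK -[z]prepK.
by rewrite -linearD -!pclsM mulrDl linearD.
Qed.
Fact presented_mulDr : right_distributive pmul +%R.
Proof.
move=> x y z; rewrite -[x]prepK -[y]prepK -[z]prepK.
by rewrite -linearD -!pclsM mulrDr linearD.
Qed.
Lemma pclsZ (k : K) (u : free_alg) : pcls (k *: u) = k *: pcls u.
Proof. exact: linearZ. Qed.

Fact pscalerAl (k : K) (x y : presented) : k *: pmul x y = pmul (k *: x) y.
Proof. by rewrite -[x]prepK -[y]prepK -pclsZ -!pclsM -pclsZ scalerAl. Qed.
Fact pscalerAr (k : K) (x y : presented) : k *: pmul x y = pmul x (k *: y).
Proof. by rewrite -[x]prepK -[y]prepK -pclsZ -!pclsM -pclsZ scalerAr. Qed.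

HB.instance Definition _ := GRing.Zmodule_isPzRing.Build presented
  presented_mulA presented_mul1l presented_mul1r
  presented_mulDl presented_mulDr.

Fact presented_scalerAl (k : K) (x y : presented) : k *: (x * y) = k *: x * y.
Proof. exact: pscalerAl. Qed.
Fact presented_scalerAr (k : K) (x y : presented) : k *: (x * y) = x * (k *: y).
Proof. exact: pscalerAr. Qed.

Fact pcls_monoid_morphism : monoid_morphism pcls.
Proof. by split=> // u v; exact: pclsM. Qed.
HB.instance Definition _ := GRing.isMonoidMorphism.Build free_alg presented pcls
  pcls_monoid_morphism.

Lemma pcls_rel x : rel x -> pcls x = 0.
Proof.
move=> x_rel; apply/eqP; rewrite -(linear0 pcls) /pcls qclsP subr0.
by apply: span_gen; rewrite -[x]mulr1 -[x]mul1r; apply: IdealGen.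
Qed.

End Presentation.

Section Evaluation.
Variables (K : fieldType) (X : choiceType) (h : X -> K).

Definition word_eval (w : {fmonom X}) : K := \prod_(x <- w : seq X) h x.

Fact word_eval_morphism : mmorphism word_eval.
Proof.
split=> [v w|]; rewrite /word_eval; first by rewrite fmM big_cat.
by rewrite fm1 big_nil.
Qed.
HB.instance Definition _ := isMultiplicative.Build {fmonom X} K word_eval
  word_eval_morphism.

Definition free_eval : free_alg K X -> K := mmap idfun word_eval.
HB.instance Definition _ := GRing.RMorphism.on free_eval.
HB.instance Definition _ := GRing.Linear.on free_eval.

Lemma free_eval_var x : free_eval (fvar K x) = h x.
Proof. by rewrite /free_eval /fvar mmapU mul1r /= /word_eval fmU big_seq1. Qed.

Lemma free_evalZ (k : K) (u : free_alg K X) :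
  free_eval (k *: u) = k * free_eval u.
Proof. exact: linearZ. Qed.

Fact presented_neq0 (rel : free_alg K X -> Prop) :
  (forall x, rel x -> free_eval x = 0) -> 1 != 0 :> presented rel.
Proof.
move=> rel0; apply/negP => /eqP/eqP.
have -> : (0 : presented rel) = qcls (ideal_gen rel) 0 by rewrite linear0.
have -> : (1 : presented rel) = qcls (ideal_gen rel) 1 by [].
rewrite qclsP subr0 => /span_predP/(_ (fun x => free_eval x == 0)) one_in.
suff : free_eval 1 == 0 by rewrite rmorph1 oner_eq0.
apply: one_in.
  split=> [|k u v]; first by rewrite -topredE /= rmorph0.
  rewrite -!topredE /= => /eqP u0 /eqP v0; rewrite linearP /=.
  by move: u0 v0 => -> ->; rewrite mulr0 addr0.
move=> _ [a x b /rel0 x0]; rewrite -topredE /=.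
by rewrite !rmorphM /= x0 mulr0 mul0r.
Qed.

End Evaluation.

(* sl_n, so_{2n+1}, sp_{2n}, so_{2n}: types A_{n-1}, B_n, C_n, D_n *)
Inductive lie_family := Sl | SoOdd | Sp | SoEven.

Definition valid_size (T : lie_family) (n : nat) : bool :=
  match T with
  | Sl | SoOdd | Sp => (2 <= n)%N
  | SoEven => (4 <= n)%N
  end.

Definition rank (T : lie_family) (n : nat) : nat :=
  match T with Sl => n.-1 | SoOdd | Sp | SoEven => n end.

(* All vectors involved have integral coordinates in the orthonormal basis     *)
(* epsilon_1, ..., epsilon_n. Indices are 1-based naturals in this section.    *)
Section RootData.
Variables (T : lie_family) (n : nat).

Definition eps (k : nat) : 'rV[int]_n := \row_(j < n) (j.+1 == k)%:R.

Definition inner (u v : 'rV[int]_n) : int := \sum_j u 0 j * v 0 j.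

(* For Sl the index n is not in I and the value there is immaterial.           *)
Definition alpha (i : nat) : 'rV[int]_n :=
  if (i < n)%N then eps i - eps i.+1 else
  match T with
  | Sl => 0
  | SoOdd => eps n
  | Sp => eps n *+ 2
  | SoEven => eps n.-1 + eps n
  end.

(* The quotients by %/ below are exact.                                        *)
Definition cartan (i j : nat) : int :=
  ((2 * inner (alpha i) (alpha j)) %/ inner (alpha i) (alpha i))%Z.

Variables (K : fieldType) (r s : K).

(* r_i is qpar r i and s_i is qpar s i. *)
Definition qpar (q : K) (i : nat) : K :=
  match T with
  | SoOdd => q ^ inner (alpha i) (alpha i)
  | Sl | Sp | SoEven => q ^ (inner (alpha i) (alpha i) %/ 2)%Z
  end.

Definition pmat (i j : nat) : K :=
  let c k := inner (eps k) (alpha i) in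
  match T with
  | Sl => r ^ c j * s ^ c j.+1
  | SoOdd =>
      if (j < n)%N then r ^ (2 * c j) * s ^ (2 * c j.+1)
      else if (i < n)%N then r ^ (2 * c n)
      else r ^ c n * s ^ (- c n)
  | Sp =>
      if (j < n)%N then r ^ c j * s ^ c j.+1
      else if (i < n)%N then r ^ (2 * c n)
      else r ^ c n * s ^ (- c n)
  | SoEven =>
      if (j < n)%N then r ^ c j * s ^ c j.+1
      else if (i != n.-1)%N then r ^ c n.-1 * s ^ (- c n)
      else r ^ c n * s ^ (- c n.-1)
  end.

End RootData.

Section SerreRelations.
Variables (K : fieldType) (r s : K) (T : lie_family) (n : nat).

Local Notation I := 'I_(rank T n).

(* The element i of I stands for the 1-based index nm i. *)
Local Notation nm i := (nat_of_ord i).+1.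
Local Notation a i j := (cartan T n (nm i) (nm j)).
Local Notation rq i := (qpar T n r (nm i)).
Local Notation sq i := (qpar T n s (nm i)).

(* A noncommutative polynomial is encoded as the list of its terms: a          *)
(* coefficient and a word in the letters indexed by I.                         *)
Inductive serre : seq (K * seq I) -> Prop :=
| SerreFar (i j : I) of T <> SoEven & ((i.+1 < j) || (j.+1 < i))%N :
    serre [:: (1, [:: i; j]); (-1, [:: j; i])]
| SerreDfar (i j : I) of T = SoEven & i != j & a i j = 0
    & ~~ ((nm i == n.-1) && (nm j == n) || (nm i == n) && (nm j == n.-1)) :
    serre [:: (1, [:: i; j]); (-1, [:: j; i])]
| SerreDfork (i j : I) of T = SoEven & nm i = n.-1 & nm j = n :
    serre [:: (1, [:: i; j]); (- (r * s), [:: j; i])]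
| SerreAD1 (i j : I) of T = Sl \/ T = SoEven & (i < j)%N & a i j = -1 :
    serre [:: (1, [:: i; i; j]); (- (r + s), [:: i; j; i]);
              (r * s, [:: j; i; i])]
| SerreAD2 (i j : I) of T = Sl \/ T = SoEven & (i < j)%N & a i j = -1 :
    serre [:: (1, [:: j; j; i]); (- (r^-1 + s^-1), [:: j; i; j]);
              (r^-1 * s^-1, [:: i; j; j])]
| SerreB1 (i j : I) of T = SoOdd & nm j = (nm i).+1 :
    serre [:: (1, [:: i; i; j]); (- (rq i + sq i), [:: i; j; i]);
              (rq i * sq i, [:: j; i; i])]
| SerreB2 (i j : I) of T = SoOdd & nm j = (nm i).+1 & (nm i < n.-1)%N :
    serre [:: (1, [:: j; j; i]); (- ((rq j)^-1 + (sq j)^-1), [:: j; i; j]);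
              ((rq j)^-1 * (sq j)^-1, [:: i; j; j])]
| SerreB3 (i j : I) of T = SoOdd & nm i = n.-1 & nm j = n :
    let c := r ^- 2 + r^-1 * s^-1 + s ^- 2 in
    serre [:: (1, [:: j; j; j; i]); (- c, [:: j; j; i; j]);
              (r^-1 * s^-1 * c, [:: j; i; j; j]);
              (- (r ^- 3 * s ^- 3), [:: i; j; j; j])]
| SerreC1 (i j : I) of T = Sp & nm j = (nm i).+1 & (nm i < n.-1)%N :
    serre [:: (1, [:: i; i; j]); (- (r + s), [:: i; j; i]);
              (r * s, [:: j; i; i])]
| SerreC2 (i j : I) of T = Sp & nm j = (nm i).+1 & (nm i < n.-1)%N :
    serre [:: (1, [:: j; j; i]); (- (r^-1 + s^-1), [:: j; i; j]);
              (r^-1 * s^-1, [:: i; j; j])]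
| SerreC3 (i j : I) of T = Sp & nm i = n.-1 & nm j = n :
    let c := r ^+ 2 + r * s + s ^+ 2 in
    serre [:: (1, [:: i; i; i; j]); (- c, [:: i; i; j; i]);
              (r * s * c, [:: i; j; i; i]);
              (- (r * s) ^+ 3, [:: j; i; i; i])]
| SerreC4 (i j : I) of T = Sp & nm i = n.-1 & nm j = n :
    serre [:: (1, [:: j; j; i]); (- (r ^- 2 + s ^- 2), [:: j; i; j]);
              (r ^- 2 * s ^- 2, [:: i; j; j])].

Definition poly_eval (A : algType K) (x : I -> A) (f : seq (K * seq I)) : A :=
  \sum_(m <- f) m.1 *: \prod_(i <- m.2) x i.
End SerreRelations.
Arguments serre {K} r s T n _.

Section QuantumGroup.
Variables (K : fieldType) (r s : K) (T : lie_family) (n : nat).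

Local Notation I := 'I_(rank T n).
Local Notation nm i := (nat_of_ord i).+1.
Local Notation p i j := (pmat T n r s (nm i) (nm j)).

(* omega_i, omega_i^-1, omega'_i, omega'_i^-1 are GW i, GWV i, GW' i, GWV' i   *)
Inductive gen := GE of I | GF of I | GW of I | GWV of I | GW' of I | GWV' of I.
HB.instance Definition _ := gen_eqMixin gen.
HB.instance Definition _ := gen_choiceMixin gen.

Definition is_torus (x : gen) : bool :=
  match x with GE _ | GF _ => false | _ => true end.

Local Notation free_alg := (free_alg K gen).
Local Notation "[ x ]" := (fvar K x) (at level 0, x at level 99).

Inductive relator : free_alg -> Prop :=
| RelTorusC x y of is_torus x & is_torus y :
    relator ([x] * [y] - [y] * [x])
| RelWV i : relator ([GW i] * [GWV i] - 1)
| RelWV' i : relator ([GW' i] * [GWV' i] - 1)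
| RelWE i j : relator ([GW j] * [GE i] * [GWV j] - p i j *: [GE i])
| RelWF i j : relator ([GW j] * [GF i] * [GWV j] - (p i j)^-1 *: [GF i])
| RelWE' i j : relator ([GW' j] * [GE i] * [GWV' j] - (p j i)^-1 *: [GE i])
| RelWF' i j : relator ([GW' j] * [GF i] * [GWV' j] - p j i *: [GF i])
| RelEF i j :
    relator ([GE i] * [GF j] - [GF j] * [GE i]
      - ((i == j)%:R / (qpar T n r (nm i) - qpar T n s (nm i)))
          *: ([GW i] - [GW' i]))
| RelSerreE f of serre r s T n f :
    relator (poly_eval (fun i => [GE i]) f)
| RelSerreF f of serre r s T n f :
    relator (poly_eval (fun i => [GF i]) [seq (m.1, rev m.2) | m <- f]).

Definition Urs := presented relator.
HB.instance Definition _ := GRing.PzRing.on Urs.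
HB.instance Definition _ := GRing.Lmodule.on Urs.

(* algType requires 1 != 0, which is obtained by evaluating e_i, f_i at 0 and  *)
(* omega_i, omega'_i at 1.                                                     *)
Local Notation ev := (free_eval (fun x => (is_torus x)%:R : K)).

Fact serre_words f : serre r s T n f -> all (fun m => size m.2 != 0%N) f.
Proof. by case. Qed.

Fact ev_words (x : I -> free_alg) f : (forall i, ev (x i) = 0) ->
  all (fun m => size m.2 != 0%N) f -> ev (poly_eval x f) = 0.
Proof.
move=> x0 /allP f_words; rewrite raddf_sum big_seq big1 // => m /f_words.
case: m.2 => // i w _.
by rewrite /= free_evalZ big_cons rmorphM /= x0 mul0r mulr0.
Qed.

Fact relator_ev x : relator x -> ev x = 0.
Proof.
have evE y : ev [y] = (is_torus y)%:R by exact: free_eval_var.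
have evB (u v : free_alg) : ev (u - v) = ev u - ev v by exact: rmorphB.
have evM (u v : free_alg) : ev (u * v) = ev u * ev v by exact: rmorphM.
have evM1 (u v : free_alg) : ev (u * v - 1) = ev u * ev v - 1.
  by rewrite evB evM; congr (_ - _); exact: rmorph1.
have evMM (u v u' v' : free_alg) :
  ev (u * v - u' * v') = ev u * ev v - ev u' * ev v'.
  by rewrite evB; congr (_ - _); exact: evM.
have evMMZ (u v w u' : free_alg) k :
  ev (u * v * w - k *: u') = ev u * ev v * ev w - k * ev u'.
  by rewrite evB (evM (u * v)) (evM u v) free_evalZ.
case=> {x}.
- by move=> x y xT yT; rewrite evMM !evE xT yT subrr.
- by move=> i; rewrite evM1 !evE mulr1 subrr.
- by move=> i; rewrite evM1 !evE mulr1 subrr.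
- by move=> i j; rewrite evMMZ !evE !(mulr0, mul0r) subrr.
- by move=> i j; rewrite evMMZ !evE !(mulr0, mul0r) subrr.
- by move=> i j; rewrite evMMZ !evE !(mulr0, mul0r) subrr.
- by move=> i j; rewrite evMMZ !evE !(mulr0, mul0r) subrr.
- move=> i j; rewrite evB evMM free_evalZ evB !evE.
  by rewrite !(mulr0, mul0r) !subrr mulr0 subrr.
- move=> f /serre_words; apply: ev_words => i; exact: evE.
- move=> f /serre_words f_words; apply: ev_words => [i|]; first exact: evE.
  rewrite all_map; apply: sub_all f_words => m /=.
  by rewrite size_rev.
Qed.

Fact Urs_neq0 : 1 != 0 :> Urs.
Proof. exact: presented_neq0 relator_ev. Qed.
HB.instance Definition _ := GRing.PzSemiRing_isNonZero.Build Urs Urs_neq0.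
HB.instance Definition _ := GRing.Lmodule_isLalgebra.Build K Urs
  (@presented_scalerAl K gen relator).
HB.instance Definition _ := GRing.Lalgebra_isAlgebra.Build K Urs
  (@presented_scalerAr K gen relator).

Definition uE i : Urs := pcls relator [GE i].
Definition uF i : Urs := pcls relator [GF i].
Definition uW i : Urs := pcls relator [GW i].
Definition uWV i : Urs := pcls relator [GWV i].
Definition uW' i : Urs := pcls relator [GW' i].
Definition uWV' i : Urs := pcls relator [GWV' i].

Record standard_hopf (H : hopf Urs) : Prop := StandardHopf {
  std_comulW : forall i, comul H (uW i) = tens (uW i) (uW i);
  std_comulWV : forall i, comul H (uWV i) = tens (uWV i) (uWV i);
  std_comulW' : forall i, comul H (uW' i) = tens (uW' i) (uW' i);
  std_comulWV' : forall i, comul H (uWV' i) = tens (uWV' i) (uWV' i);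
  std_comulE : forall i, comul H (uE i) = tens (uE i) 1 + tens (uW i) (uE i);
  std_comulF : forall i, comul H (uF i) = tens 1 (uF i) + tens (uF i) (uW' i);
  std_counitW : forall i, counit H (uW i) = 1;
  std_counitWV : forall i, counit H (uWV i) = 1;
  std_counitW' : forall i, counit H (uW' i) = 1;
  std_counitWV' : forall i, counit H (uWV' i) = 1;
  std_counitE : forall i, counit H (uE i) = 0;
  std_counitF : forall i, counit H (uF i) = 0;
  std_antipodeE : forall i, antipode H (uE i) = - (uWV i * uE i);
  std_antipodeF : forall i, antipode H (uF i) = - (uF i * uWV' i)
}.

Inductive borel_gen : Urs -> Prop :=
| BorelE j : borel_gen (uE j)
| BorelW j : borel_gen (uW j)
| BorelWV j : borel_gen (uWV j).

Inductive borel'_gen : Urs -> Prop :=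
| Borel'F j : borel'_gen (uF j)
| Borel'W j : borel'_gen (uW' j)
| Borel'WV j : borel'_gen (uWV' j).

Definition borel := subalg borel_gen.
Definition borel' := subalg borel'_gen.
HB.instance Definition _ := GRing.Algebra.on borel.
HB.instance Definition _ := GRing.Algebra.on borel'.

Definition bE j : borel := Subalg (mem_gen (BorelE j)).
Definition bW j : borel := Subalg (mem_gen (BorelW j)).
Definition bWV j : borel := Subalg (mem_gen (BorelWV j)).
Definition bF j : borel' := Subalg (mem_gen (Borel'F j)).
Definition bW' j : borel' := Subalg (mem_gen (Borel'W j)).
Definition bWV' j : borel' := Subalg (mem_gen (Borel'WV j)).

Record pairing_values (q : borel' -> borel -> K) : Prop := PairingValues {
  pairing_FE : forall i j, q (bF i) (bE j)
    = (i == j)%:R * (qpar T n s (nm i) - qpar T n r (nm i))^-1;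
  pairing_W'W : forall i j, q (bW' i) (bW j) = p i j;
  pairing_W'WV : forall i j, q (bW' i) (bWV j) = (q (bW' i) (bW j))^-1;
  pairing_WV'WV : forall i j, q (bWV' i) (bWV j) = (q (bWV' i) (bW j))^-1;
  pairing_WV'W : forall i j, (q (bWV' i) (bW j))^-1 = q (bW' i) (bW j);
  pairing_FW : forall i j, q (bF i) (bW j) = 0;
  pairing_FWV : forall i j, q (bF i) (bWV j) = 0;
  pairing_W'E : forall i j, q (bW' i) (bE j) = 0;
  pairing_WV'E : forall i j, q (bWV' i) (bE j) = 0
}.

End QuantumGroup.

(* K = Q(r, s), where r and s are the two indeterminates X and Y, the field    *)
(* being Q(X, Y) up to isomorphism.                                            *)
Definition generic_parameters (K : fieldType) (r s : K) : Prop :=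
  exists phi : {rmorphism K -> {fraction {poly {poly rat}}}},
    [/\ bijective phi, phi r = tofrac 'X & phi s = tofrac 'X%:P].

(* K = Q(r, s) as a subfield of the complex numbers; the last condition says   *)
(* that no proper subfield of K contains r and s.                              *)
Definition complex_parameters (R : realType) (K : fieldType) (r s : K) : Prop :=
  exists2 iota : {rmorphism K -> R[i]}, injective iota &
    [/\ r != 0, s != 0, r ^+ 2 != s ^+ 2
      & forall S : {pred K}, divring_closed S -> r \in S -> s \in S ->
          forall x, x \in S].

(* Main.v *)
Require Import Defs.
From HB Require Import structures.
From mathcomp Require Import all_boot all_order all_algebra.
From mathcomp Require Import fraction boolp reals finmap.
From mathcomp Require classical_sets.
From mathcomp.multinomials Require Import monalg.
From mathcomp Require Import zify ring.

(* Both Borel algebras carry a "matrix coalgebra" of generators (e_j, omega_j,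
   omega_j^-1, 1, respectively f_i, omega'_i, omega'_i^-1, 1), so a skew pairing
   amounts to a functional on each algebra for every generator of the other
   one, with compatible values: convolution products of these functionals
   then represent all elements, and the two resulting evaluations agree.
   The functional attached to omega'_i is a character of B and the one attached
   to f_i is a skew derivation. Since B is given as a subalgebra of U and not by
   a presentation, they are obtained as matrix coefficients of a representation
   of U: the (twisted) vector representation, in which every e_i acts by a
   nonzero strictly triangular matrix and all Serre relations but one hold
   because each word occurring in them acts by zero.
   The invariance under the antipode S comes from uniqueness of convolution
   inverses: <S -, -> is a right inverse of < , > and a left inverse of
   <S -, S ->. *)

Set Implicit Arguments.
Unset Strict Implicit.
Unset Printing Implicit Defensive.

Import GRing.Theory.
Local Open Scope ring_scope.

(** * Linear algebra of tensors and free algebras *)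

(** One module of dimension 2n+1 serves all four types. The weight-0 vector v_n is isolated except
    in type B, and in type A the module splits into the vector representation, a line and the dual
    representation. It need not be faithful: it only has to contain an arrow for every label i. The
    twist multiplies e_j, omega_j and omega'_j by one nonzero scalar c_j. Along an arrow v_b -> v_a
    of label i, the matrix coefficient (a, b) on B is a skew derivation between the diagonal
    characters at a and at b. These differ on omega_j by the right factor p_ij, but are not
    themselves the prescribed ones; choosing c_j so that omega_j acts by 1 on v_b turns the second
    into the counit and the first into the character of omega'_i. The same freedom realises every
    character at v_0. An element has many expressions in the generators, and a priori neither the
    functional built from an expression of u nor the one built from an expression of a depends on
    the element alone. Evaluating each family against the other settles both questions at once. *)

Section Bilinear.
Variables (K : fieldType) (A B : lmodType K).

Definition bilin (W : lmodType K) (f : A -> B -> W) : Prop :=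
  (forall b, linear (f^~ b)) /\ (forall a, linear (f a)).

Lemma linear_sum (V W : lmodType K) (f : V -> W) (fL : linear f)
    (I : Type) (s : seq I) (F : I -> V) :
  f (\sum_(i <- s) F i) = \sum_(i <- s) f (F i).
Proof.
have f0 : f 0 = 0 by rewrite -[0 in LHS](addNr 0) -scaleN1r fL scaleN1r addNr.
elim: s => [|i s IH]; first by rewrite !big_nil.
by rewrite !big_cons -[F i in LHS]scale1r fL scale1r IH.
Qed.

Lemma linear_scale (V W : lmodType K) (f : V -> W) (fL : linear f) k v :
  f (k *: v) = k *: f v.
Proof.
have f0 : f 0 = 0 by rewrite -[0 in LHS](addNr 0) -scaleN1r fL scaleN1r addNr.
by rewrite -[k *: v]addr0 fL f0 addr0.
Qed.

Lemma tens_bilin : bilin (@tens K A B).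
Proof.
split=> [b k a a'|a k b b']; rewrite /tens -linearP; apply/eqP;
  rewrite qclsP; apply: span_gen.
  exact: tensor_linl.
exact: tensor_linr.
Qed.

(** The coefficients of a representative are absorbed into the left factors. The equality is boolean
    so that [xchoose] can extract the list in [sw_exists]. *)
Lemma tensor_sum (t : tensor A B) :
  exists s : seq (A * B), t == \sum_(z <- s) tens z.1 z.2.
Proof.
pose g := qrep t; exists [seq (g@_k *: k.1, k.2) | k <- enum_fset (msupp g)].
rewrite big_map -[t]qrepK -/g {1}[g]monalgE linear_sum; last exact: linearP.
apply/eqP/eq_bigr => k _ /=; rewrite (linear_scale (tens_bilin.1 _)) /tens.
rewrite -linearZ /=; congr qcls; apply/malgP => k'.
by rewrite mcoeffZ !mcoeffU mulrnAr mulr1 -surjective_pairing.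
Qed.

Lemma tlift_sum (W : lmodType K) (f : A -> B -> W) (s : seq (A * B)) :
  bilin f -> tlift f (\sum_(z <- s) tens z.1 z.2) = \sum_(z <- s) f z.1 z.2.
Proof.
case=> fl fr; rewrite (linear_sum (tlift_linear fl fr)).
by apply: eq_bigr => z _; rewrite tlift_tens.
Qed.

Lemma tlift_linear_fun (W : lmodType K) (f g h : A -> B -> W) k t :
  bilin f -> bilin g -> bilin h ->
  (forall a b, f a b = k *: g a b + h a b) ->
  tlift f t = k *: tlift g t + tlift h t.
Proof.
move=> fB gB hB fgh; have [s /eqP->] := tensor_sum t.
rewrite (tlift_sum s fB) (tlift_sum s gB) (tlift_sum s hB).
by rewrite scaler_sumr -big_split; apply: eq_bigr => z _.
Qed.

Lemma tens_inj_bilin (W : lmodType K) (f : A -> B -> W) (s s' : seq (A * B)) :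
  bilin f ->
  \sum_(z <- s) tens z.1 z.2 = \sum_(z <- s') tens z.1 z.2 ->
  \sum_(z <- s) f z.1 z.2 = \sum_(z <- s') f z.1 z.2.
Proof. by move=> fB ss'; rewrite -(tlift_sum s fB) -(tlift_sum s' fB) ss'. Qed.

End Bilinear.

(** * Universal property of a presented algebra *)

Section FreeLift.
Variables (K : fieldType) (X : choiceType) (A : algType K) (h : X -> A).

Definition word_lift (w : {fmonom X}) : A := \prod_(x <- w : seq X) h x.

Fact word_lift_morphism : mmorphism word_lift.
Proof.
split=> [v w|]; rewrite /word_lift; first by rewrite fmM big_cat.
by rewrite fm1 big_nil.
Qed.
HB.instance Definition _ := isMultiplicative.Build {fmonom X} A word_lift
  word_lift_morphism.

Definition free_lift : free_alg K X -> A := mmap (in_alg A) word_lift.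

Fact free_lift_additive : {morph free_lift : u v / u - v}.
Proof. exact: mmapB. Qed.

Fact free_lift_multiplicative : monoid_morphism free_lift.
Proof.
have [|M1 M2] := @commr_mmap_is_multiplicative {fmonom X} K A
  (in_alg A) word_lift.
  by move=> g m m'; rewrite /GRing.comm /= mulr_algl mulr_algr.
by split.
Qed.

Lemma free_lift_var x : free_lift (fvar K x) = h x.
Proof.
by rewrite /free_lift mmapU /= scale1r mul1r /word_lift fmU big_seq1.
Qed.

Lemma free_lift_linear : linear free_lift.
Proof.
move=> k u v; rewrite /free_lift mmapD mmapZ /=; congr (_ + _).
by rewrite mulr_algl.
Qed.

Variable rel : free_alg K X -> Prop.
Hypothesis rel0 : forall x, rel x -> free_lift x = 0.

Definition pres_lift (x : presented rel) : A := free_lift (prep x).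

(** Two representatives differ by an element of the span of the products [a * x * b] with [rel x],
    and a multiplicative lift killing every such [x] kills this span. *)
Lemma pres_lift_pcls u : pres_lift (pcls rel u) = free_lift u.
Proof.
apply/eqP; rewrite -subr_eq0 /pres_lift -free_lift_additive.
have /span_predP : prep (pcls rel u) - u \in span_pred (ideal_gen rel).
  by rewrite -qclsP; apply/eqP/prepK.
have lift0 : free_lift 0 = 0.
  by rewrite -(subrr 0) free_lift_additive subrr.
move=> /(_ (fun v => free_lift v == 0)); apply.
  split=> [|k v w]; first by rewrite unfold_in lift0.
  rewrite !unfold_in free_lift_linear => /eqP-> /eqP->.
  by rewrite scaler0 addr0.
move=> _ [a x b /rel0 x0]; rewrite unfold_in.
by rewrite !free_lift_multiplicative.2 x0 mulr0 mul0r.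
Qed.

Lemma pres_lift_linear : linear pres_lift.
Proof.
move=> k x y; rewrite -[x]prepK -[y]prepK -linearP !pres_lift_pcls.
exact: free_lift_linear.
Qed.

Lemma pres_lift_1 : pres_lift 1 = 1.
Proof.
rewrite [1 in LHS]/(pcls rel 1) pres_lift_pcls.
exact: free_lift_multiplicative.1.
Qed.

Lemma pres_liftM x y : pres_lift (x * y) = pres_lift x * pres_lift y.
Proof.
rewrite -[x]prepK -[y]prepK -(rmorphM (pcls rel)) !pres_lift_pcls.
exact: free_lift_multiplicative.2.
Qed.

End FreeLift.

(** * Skew pairings from functionals on generators *)

Section Sweedler.
Variables (K : fieldType) (A : algType K).

Fact sw_exists (c : coalg A) (a : A) :
  {s : seq (A * A) | comul c a = \sum_(z <- s) tens z.1 z.2}.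
Proof.
exists (xchoose (tensor_sum (comul c a))).
exact/eqP/(xchooseP (tensor_sum _)).
Qed.

(** Sweedler components. The choice is arbitrary and not linear in [a]; only sums of bilinear
    expressions over it are meaningful. *)
Definition sw (c : coalg A) (a : A) : seq (A * A) := sval (sw_exists c a).

Lemma swP (c : coalg A) a : comul c a = \sum_(z <- sw c a) tens z.1 z.2.
Proof. exact: (svalP (sw_exists c a)). Qed.

Lemma sw_sum (c : coalg A) (W : lmodType K) (f : A -> A -> W) a :
  bilin f -> tlift f (comul c a) = \sum_(z <- sw c a) f z.1 z.2.
Proof. by move=> fB; rewrite swP tlift_sum. Qed.

(** A bilinear expression factors through the tensor product, so the arbitrary expansion chosen by
    [sw] may be traded for any explicit one. *)
Lemma sw_eq (c : coalg A) (W : lmodType K) (f : A -> A -> W) a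
    (I : Type) (r : seq I) (x y : I -> A) :
  bilin f -> comul c a = \sum_(i <- r) tens (x i) (y i) ->
  \sum_(z <- sw c a) f z.1 z.2 = \sum_(i <- r) f (x i) (y i).
Proof.
move=> fB; rewrite swP => e; pose s := [seq (x i, y i) | i <- r].
rewrite (@tens_inj_bilin _ _ _ _ f (sw c a) s fB); first by rewrite big_map.
by rewrite e big_map.
Qed.

Variable H : hopf A.

Lemma sw_linear (W : lmodType K) (f : A -> A -> W) :
  bilin f -> linear (fun a => \sum_(z <- sw H a) f z.1 z.2).
Proof.
move=> fB k a b.
rewrite -(sw_sum H a fB) -(sw_sum H b fB) -(sw_sum H (k *: a + b) fB).
rewrite comul_linear.
by apply: tlift_linear; case: fB.
Qed.

Lemma sw_mul (W : lmodType K) (f : A -> A -> W) a b : bilin f ->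
  \sum_(z <- sw H (a * b)) f z.1 z.2 =
  \sum_(z <- sw H a) \sum_(w <- sw H b) f (z.1 * w.1) (z.2 * w.2).
Proof.
case=> fl fr; rewrite -sw_sum // comul_mul /tmul.
have tB x y : bilin (fun c d => tens (x * c) (y * d) : tensor A A).
  split=> [d k c c'|c k d d']; rewrite mulrDr -scalerAr.
    exact: (tens_bilin _ _).1.
  exact: (tens_bilin _ _).2.
rewrite [X in tlift _ X = _]sw_sum; last first.
  split=> [y k x x'|x k y y'];
    apply: (tlift_linear_fun _ (tB _ _) (tB _ _) (tB _ _)) => c d;
    rewrite mulrDl -scalerAl.
    exact: (tens_bilin _ _).1.
  exact: (tens_bilin _ _).2.
rewrite (linear_sum (tlift_linear fl fr)); apply: eq_bigr => z _.
rewrite sw_sum // (linear_sum (tlift_linear fl fr)); apply: eq_bigr => w _.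
by rewrite tlift_tens.
Qed.

Lemma sw_1 (W : lmodType K) (f : A -> A -> W) : bilin f ->
  \sum_(z <- sw H 1) f z.1 z.2 = f 1 1.
Proof.
move=> fB; rewrite (sw_eq (r := [:: tt]) (x := fun=> 1) (y := fun=> 1) fB).
  by rewrite big_seq1.
by rewrite big_seq1 comul_1.
Qed.

Lemma sw_counitl a : \sum_(z <- sw H a) counit H z.1 *: z.2 = a.
Proof.
rewrite -[RHS](comul_counitl H) [RHS]sw_sum //.
split=> [y k x x'|x k y y'].
  by rewrite counit_linear scalerDl scalerA.
by rewrite scalerDr !scalerA mulrC.
Qed.

Lemma sw_counitr a : \sum_(z <- sw H a) counit H z.2 *: z.1 = a.
Proof.
rewrite -[RHS](comul_counitr H) [RHS]sw_sum //.
split=> [y k x x'|x k y y'].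
  by rewrite scalerDr !scalerA mulrC.
by rewrite counit_linear scalerDl scalerA.
Qed.

Lemma sw_antipodel a :
  \sum_(z <- sw H a) antipode H z.1 * z.2 = (counit H a)%:A.
Proof.
rewrite -antipodel sw_sum //; split=> [y k x x'|x k y y'].
  by rewrite antipode_linear mulrDl -scalerAl.
by rewrite mulrDr -scalerAr.
Qed.

Lemma sw_antipoder a :
  \sum_(z <- sw H a) z.1 * antipode H z.2 = (counit H a)%:A.
Proof.
rewrite -antipoder sw_sum //; split=> [y k x x'|x k y y'].
  by rewrite mulrDl -scalerAl.
by rewrite antipode_linear mulrDr -scalerAr.
Qed.

(** A trilinear [F] induces a linear map [G] on the triple tensor product; applying it to the
    coassociativity axiom gives the identity between sums. *)
Lemma sw_coassoc (W : lmodType K) (F : A -> A -> A -> W) a :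
  (forall y z, linear (fun x => F x y z)) ->
  (forall x z, linear (fun y => F x y z)) ->
  (forall x y, linear (fun z => F x y z)) ->
  \sum_(z <- sw H a) \sum_(w <- sw H z.1) F w.1 w.2 z.2 =
  \sum_(z <- sw H a) \sum_(w <- sw H z.2) F z.1 w.1 w.2.
Proof.
move=> F1 F2 F3.
have FB x : bilin (F x) by split.
pose G := tlift (fun x t => tlift (F x) t).
have GB : bilin (fun x t => tlift (F x) t).
  split=> [t k x x'|x]; last by exact: (tlift_linear (FB x).1 (FB x).2).
  have [s /eqP->] := tensor_sum t; rewrite !tlift_sum // scaler_sumr -big_split.
  by apply: eq_bigr => z _; exact: F1.
have GE x y z : G (tens x (tens y z)) = F x y z.
  by rewrite /G (tlift_tens GB.1 GB.2) (tlift_tens (FB x).1 (FB x).2).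
have GL : linear G by exact: (tlift_linear GB.1 GB.2).
have tB y : bilin (fun u v => tens u (tens v y) : tensor A (tensor A A)).
  split=> [v k u u'|u k v v']; first exact: (tens_bilin _ _).1.
  by rewrite (tens_bilin _ _).1 (tens_bilin _ _).2.
have tB1 : bilin (fun x y => tlift (fun u v =>
    tens u (tens v y) : tensor A (tensor A A)) (comul H x)).
  split=> [y|x k y y'].
    move=> k x x'; rewrite comul_linear.
    exact: (tlift_linear (tB y).1 (tB y).2).
  apply: (tlift_linear_fun _ (tB _) (tB _) (tB _)) => u v.
  by rewrite 2!(tens_bilin _ _).2.
have tB2 : bilin (fun x y : A => tens x (comul H y)).
  split=> [y|x k y y']; first exact: (tens_bilin _ _).1.
  by rewrite comul_linear (tens_bilin _ _).2.
have := etrans (esym (sw_sum H a tB1)) (etrans (comul_coassoc H a)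
  (sw_sum H a tB2)).
move/(congr1 G); rewrite !(linear_sum GL).
under eq_bigr => z _.
  rewrite (sw_sum H z.1 (tB z.2)) (linear_sum GL).
  under eq_bigr => w _ do rewrite GE.
  over.
move=> ->; apply: eq_bigr => z _.
by rewrite /G (tlift_tens GB.1 GB.2) (sw_sum H _ (FB _)).
Qed.

End Sweedler.

Section SkewPairing.
Variables (K : fieldType) (A U : algType K) (HA : hopf A) (HU : hopf U).

Lemma mulf_bilin (V V' : lmodType K) (f : V -> K^o) (g : V' -> K^o) :
  linear f -> linear g -> bilin (W := K^o) (fun x y => f x * g y).
Proof.
move=> fL gL; split=> [y k x x'|x k y y'] /=.
  by rewrite fL mulrDl -scalerAl.
by rewrite gL mulrDr -scalerAr.
Qed.

Lemma tlift_swap (W : lmodType K) (f : U -> U -> W) t :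
  bilin f -> tlift f (tswap t) = tlift (fun x y => f y x) t.
Proof.
case=> fl fr; have [s /eqP->] := tensor_sum t.
have sB : bilin (fun x y : U => tens y x).
  split=> [y|x]; first exact: (tens_bilin _ _).2.
  exact: (tens_bilin _ _).1.
rewrite /tswap (tlift_sum s sB) (linear_sum (tlift_linear fl fr)).
rewrite (tlift_sum s (f := fun x y => f y x)); last by split.
by apply: eq_bigr => z _; rewrite tlift_tens.
Qed.

Variable p : U -> A -> K^o.
Hypotheses (pl : forall a, linear (p^~ a)) (pr : forall f, linear (p f)).

Let ppB x y : bilin (W := K^o) (fun a b => p x a * p y b).
Proof. exact: mulf_bilin (pr x) (pr y). Qed.

Lemma pairing2_bilin t :
  bilin (fun x y => tlift (W := K^o) (fun a b => p x a * p y b) t).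
Proof.
split=> [y k x x'|x k y y'];
  apply: (tlift_linear_fun _ (ppB _ _) (ppB _ _) (ppB _ _)) => a b.
  by rewrite pl mulrDl -scalerAl.
by rewrite pl mulrDr -scalerAr.
Qed.

Lemma pairing2_mull f1 f2 a :
  pairing2 p (tens f1 f2) (comul HA a) =
  \sum_(z <- sw HA a) p f1 z.1 * p f2 z.2.
Proof.
have [B1 B2] := pairing2_bilin (comul HA a).
by rewrite /pairing2 (tlift_tens B1 B2) (sw_sum HA a (ppB f1 f2)).
Qed.

Lemma pairing2_mulr f a1 a2 :
  pairing2 p (comul (cop HU) f) (tens a1 a2) =
  \sum_(z <- sw HU f) p z.2 a1 * p z.1 a2.
Proof.
have B := pairing2_bilin (tens a1 a2).
rewrite /pairing2 /= (tlift_swap _ B) (sw_sum HU f); last first.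
  by case: B; split.
by apply: eq_bigr => z _; rewrite (tlift_tens (ppB _ _).1 (ppB _ _).2).
Qed.

End SkewPairing.

(** * Extension of generator functionals to a pairing by convolution *)

Section AbstractPairing.
Variables (K : fieldType) (A U : algType K) (HA : hopf A) (HU : hopf U).
Variables (X Y : Type) (gA : X -> A) (gU : Y -> U).
Variables (DA : X -> seq (X * X)) (DU : Y -> seq (Y * Y)).
(** [psi k] is to become < -, gA k > and [phi l] to become < gU l, - >. Because the pairing is skew,
    the two tensor factors are crossed in [phi_M] but not in [psi_M]. *)
Variables (psi : X -> U -> K^o) (phi : Y -> A -> K^o).

Hypothesis comulA : forall k,
  comul HA (gA k) = \sum_(z <- DA k) tens (gA z.1) (gA z.2).
Hypothesis comulU : forall l,
  comul HU (gU l) = \sum_(z <- DU l) tens (gU z.1) (gU z.2).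
Hypothesis psi_lin : forall k, linear (psi k).
Hypothesis phi_lin : forall l, linear (phi l).
Hypothesis psi_1 : forall k, psi k 1 = counit HA (gA k).
Hypothesis phi_1 : forall l, phi l 1 = counit HU (gU l).
Hypothesis psi_M : forall k u v,
  psi k (u * v) = \sum_(z <- DA k) psi z.1 u * psi z.2 v.
Hypothesis phi_M : forall l a b,
  phi l (a * b) = \sum_(z <- DU l) phi z.2 a * phi z.1 b.
Hypothesis psi_phi : forall k l, psi k (gU l) = phi l (gA k).
Hypothesis genA : forall P : A -> Prop, P 1 ->
  (forall k a b, P a -> P b -> P (k *: a + b)) ->
  (forall a b, P a -> P b -> P (a * b)) -> (forall k, P (gA k)) ->
  forall a, P a.
Hypothesis genU : forall P : U -> Prop, P 1 ->
  (forall k u v, P u -> P v -> P (k *: u + v)) ->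
  (forall u v, P u -> P v -> P (u * v)) -> (forall l, P (gU l)) ->
  forall u, P u.

(* [relU u g] records that g represents < u, - >, and [relA a h] that h
   represents < -, a >; that g is determined by u is a consequence of
   [relA_relU]. *)
Inductive relU : U -> (A -> K^o) -> Prop :=
| RelUgen l : relU (gU l) (phi l)
| RelU1 : relU 1 (counit HA)
| RelUlin k u g v h : relU u g -> relU v h ->
    relU (k *: u + v) (fun a => k *: g a + h a)
| RelUmul u g v h : relU u g -> relU v h ->
    relU (u * v) (fun a => \sum_(z <- sw HA a) g z.1 * h z.2).

Inductive relA : A -> (U -> K^o) -> Prop :=
| RelAgen k : relA (gA k) (psi k)
| RelA1 : relA 1 (counit HU)
| RelAlin k a g b h : relA a g -> relA b h ->
    relA (k *: a + b) (fun u => k *: g u + h u)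
| RelAmul a g b h : relA a g -> relA b h ->
    relA (a * b) (fun u => \sum_(z <- sw HU u) g z.2 * h z.1).

Lemma relU_linear u g : relU u g -> linear g.
Proof.
elim=> {u g} [l||k u g v h _ gL _ hL|u g v h _ gL _ hL].
- exact: phi_lin.
- exact: counit_linear.
- move=> c a b; rewrite gL hL !scalerDr addrACA !scalerA.
  by rewrite [k * c]mulrC.
- exact: (sw_linear HA (mulf_bilin gL hL)).
Qed.

Lemma relA_linear a g : relA a g -> linear g.
Proof.
elim=> {a g} [l||k u g v h _ gL _ hL|u g v h _ gL _ hL].
- exact: psi_lin.
- exact: counit_linear.
- move=> c a b; rewrite gL hL !scalerDr addrACA !scalerA.
  by rewrite [k * c]mulrC.
- have [B1 B2] := mulf_bilin gL hL.
  by apply: (@sw_linear _ _ _ _ (fun x y => g y * h x)); split.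
Qed.

Lemma relU_1 u g : relU u g -> g 1 = counit HU u.
Proof.
elim=> {u g} [l||k u g v h _ g1 _ h1|u g v h rg g1 rh h1].
- exact: phi_1.
- by rewrite !counit_1.
- by rewrite g1 h1 counit_linear.
- rewrite (sw_1 HA (mulf_bilin (relU_linear rg) (relU_linear rh))).
  by rewrite g1 h1 counit_mul.
Qed.

(** The generators span a subcoalgebra, so on [gA k] a convolution product involves only the values
    on generators, and [psi_M] has exactly that shape. *)
Lemma relU_gen u g k : relU u g -> g (gA k) = psi k u.
Proof.
move=> ug; elim: ug k
  => {u g} [l||c u g v h _ IHg _ IHh|u g v h rg IHg rh IHh] k.
- by rewrite psi_phi.
- by rewrite psi_1.
- by rewrite IHg IHh psi_lin.
- rewrite psi_M.
  rewrite (sw_eq (mulf_bilin (relU_linear rg) (relU_linear rh)) (comulA k)).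
  by apply: eq_bigr => z _; rewrite IHg IHh.
Qed.

(** Extends [comulU] and [phi_M] from generators to all expressions, keeping the components of the
    comultiplication inside [relU]; this is what an induction on products in [A] consumes. Sums and
    products of expressions become sums and products of the index types. *)
Lemma relU_split u g : relU u g ->
  exists (J : finType) (x y : J -> U) (gx gy : J -> A -> K^o),
  [/\ comul HU u = \sum_j tens (x j) (y j),
      forall j, relU (x j) (gx j), forall j, relU (y j) (gy j)
    & forall a b, g (a * b) = \sum_j gy j a * gx j b].
Proof.
elim=> {u g} [l||k u g v h rg IHg rh IHh|u g v h rg IHg rh IHh].
- pose t := in_tuple (DU l).
  exists 'I_(size (DU l)), (fun j => gU (tnth t j).1),
    (fun j => gU (tnth t j).2), (fun j => phi (tnth t j).1),
    (fun j => phi (tnth t j).2).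
  split=> [|j|j|a b]; try exact: RelUgen.
    by rewrite comulU big_tnth.
  by rewrite phi_M big_tnth.
- exists unit, (fun=> 1), (fun=> 1), (fun=> counit HA), (fun=> counit HA).
  split=> [|j|j|a b]; try exact: RelU1.
    by rewrite comul_1 big_const card_unit /= addr0.
  by rewrite counit_mul big_const card_unit /= addr0.
- case: IHg => J [x [y [gx [gy [cu rx ry gM]]]]].
  case: IHh => J' [x' [y' [gx' [gy' [cv rx' ry' hM]]]]].
  (* [relU] is closed under [k *: u + v] only, so [k *: x j] is reached as [k *: x j + 0], where 0
     is the combination (-1) *: 1 + 1 and [z] represents it. *)
  pose z (a : A) : K^o := (-1) *: (counit HA a : K^o) + counit HA a.
  have r0 : relU 0 z.
    by rewrite -[0](addNr 1) -scaleN1r; apply: RelUlin; exact: RelU1.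
  exists (J + J')%type,
    (fun j => match j with inl j => k *: x j + 0 | inr j => x' j end),
    (fun j => match j with inl j => y j | inr j => y' j end),
    (fun j => match j with
      | inl j => fun a => k *: gx j a + z a
      | inr j => gx' j end),
    (fun j => match j with inl j => gy j | inr j => gy' j end).
  split=> [|[]j|[]j|a b] //; try exact: RelUlin.
    rewrite comul_linear cu cv big_sumType scaler_sumr /=; congr (_ + _).
    apply: eq_bigr => j _.
    by rewrite addr0 (linear_scale ((tens_bilin _ _).1 _)).
  rewrite gM hM big_sumType scaler_sumr /=; congr (_ + _).
  apply: eq_bigr => j _.
  by rewrite /z scaleN1r addNr addr0 -scalerAr.
- case: IHg => J [x [y [gx [gy [cu rx ry gM]]]]].
  case: IHh => J' [x' [y' [gx' [gy' [cv rx' ry' hM]]]]].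
  exists (J * J')%type, (fun j => x j.1 * x' j.2), (fun j => y j.1 * y' j.2),
    (fun j a => \sum_(z <- sw HA a) gx j.1 z.1 * gx' j.2 z.2),
    (fun j a => \sum_(z <- sw HA a) gy j.1 z.1 * gy' j.2 z.2).
  split=> [|j|j|a b]; try exact: RelUmul.
    have tB c d : bilin (fun a b : U => tens (a * c) (b * d)).
      split=> [b k a a'|a k b b']; rewrite mulrDl -scalerAl.
        exact: (tens_bilin _ _).1.
      exact: (tens_bilin _ _).2.
    have tB' a b : bilin (fun c d : U => tens (a * c) (b * d)).
      split=> [d k c c'|c k d d']; rewrite mulrDr -scalerAr.
        exact: (tens_bilin _ _).1.
      exact: (tens_bilin _ _).2.
    rewrite swP (sw_mul HU u v (tens_bilin U U)) exchange_big /=.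
    under eq_bigr => w _ do rewrite (sw_eq (tB w.1 w.2) cu).
    rewrite exchange_big /=.
    under eq_bigr => j _ do rewrite (sw_eq (tB' (x j) (y j)) cv).
    by rewrite pair_bigA.
  have gB := mulf_bilin (relU_linear rg) (relU_linear rh).
  rewrite (sw_mul HA a b gB).
  under [RHS]eq_bigr => j _ do rewrite mulr_suml; rewrite [RHS]exchange_big.
  apply: eq_bigr => z _.
  under [RHS]eq_bigr => j _ do rewrite mulr_sumr; rewrite [RHS]exchange_big.
  apply: eq_bigr => w _ /=.
  rewrite gM hM mulr_suml -(pair_bigA _ (fun j j' => gy j z.1 * gy' j' z.2 *
    (gx j w.1 * gx' j' w.2))) /=.
  apply: eq_bigr => j _; rewrite mulr_sumr; apply: eq_bigr => j' _.
  by rewrite mulrACA.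
Qed.

(** Induction on the construction of [h], the product case splitting [g] by [relU_split]. Since [u]
    and [a] are independent and both relations are total, neither functional depends on the
    expression that produced it. *)
Lemma relA_relU a h u g : relA a h -> relU u g -> h u = g a.
Proof.
move=> ah; elim: ah u g
  => {a h} [k||k a h b h' _ IH _ IH'|a h b h' ra IH rb IH'] u g ug.
- by rewrite (relU_gen k ug).
- by rewrite (relU_1 ug).
- by rewrite (IH _ _ ug) (IH' _ _ ug) (relU_linear ug).
- have [J [x [y [gx [gy [cu rx ry ->]]]]]] := relU_split ug.
  have [B1 B2] := mulf_bilin (relA_linear ra) (relA_linear rb).
  rewrite (@sw_eq _ _ HU _ (fun x y => h y * h' x) u _ _ x y _ cu).
    by apply: eq_bigr => j _; rewrite (IH _ _ (ry j)) (IH' _ _ (rx j)).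
  by split.
Qed.

Lemma relU_total u : exists g, relU u g.
Proof.
elim/genU: u => [|k u v [g ug] [h vh]|u v [g ug] [h vh]|l].
- by exists (counit HA); exact: RelU1.
- by eexists; apply: RelUlin; eassumption.
- by eexists; apply: RelUmul; eassumption.
- by exists (phi l); exact: RelUgen.
Qed.

Lemma relA_total a : exists g, relA a g.
Proof.
elim/genA: a => [|k u v [g ug] [h vh]|u v [g ug] [h vh]|l].
- by exists (counit HU); exact: RelA1.
- by eexists; apply: RelAlin; eassumption.
- by eexists; apply: RelAmul; eassumption.
- by exists (psi l); exact: RelAgen.
Qed.

Definition gen_pairing (u : U) : A -> K^o := sval (cid (relU_total u)).

Lemma gen_pairingP u : relU u (gen_pairing u).
Proof. exact: svalP. Qed.

Lemma relU_pairing u g a : relU u g -> gen_pairing u a = g a.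
Proof.
move=> ug; have [h ah] := relA_total a.
by rewrite -(relA_relU ah ug) (relA_relU ah (gen_pairingP u)).
Qed.

Lemma gen_pairing_gen l a : gen_pairing (gU l) a = phi l a.
Proof. by rewrite (relU_pairing _ (RelUgen l)). Qed.

Lemma gen_pairing_skew : skew_dual_pairing HU HA gen_pairing.
Proof.
have gL u : linear (gen_pairing u) := relU_linear (gen_pairingP u).
have gL' a : linear (gen_pairing^~ a).
  move=> k u v.
  exact: relU_pairing (RelUlin k (gen_pairingP u) (gen_pairingP v)).
split=> //=.
- move=> f; exact: relU_1 (gen_pairingP f).
- move=> a; exact: relU_pairing RelU1.
- move=> f a1 a2.
  have [J [x [y [gx [gy [cu rx ry ->]]]]]] := relU_split (gen_pairingP f).
  have [B1 B2] := mulf_bilin (gL' a1) (gL' a2).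
  have B : bilin (W := K^o) (fun x y => gen_pairing y a1 * gen_pairing x a2).
    by split.
  rewrite (pairing2_mulr HU gL' gL) (sw_eq B cu).
  apply: eq_bigr => j _.
  by rewrite (relU_pairing _ (rx j)) (relU_pairing _ (ry j)).
- move=> f1 f2 a; rewrite (pairing2_mull HA gL' gL).
  exact: relU_pairing (RelUmul (gen_pairingP f1) (gen_pairingP f2)).
Qed.

End AbstractPairing.

(** * Weights of the vector representation *)

(* Deciding the truth values one at a time keeps the certificates of [lia]
   small: a single call overflows the stack. *)
Ltac decide_bools :=
  repeat match goal with |- context [nat_of_bool ?b] =>
    lazymatch b with true => fail | false => fail | _ => idtac end;
    let h := fresh in
    first [ have h : b = true by lia
          | have h : b = false by lia
          | case h : b ]; rewrite ?h end.

Section InnerProduct.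
Variable n : nat.

Lemma innerDl (u v w : 'rV[int]_n) : inner (u + v) w = inner u w + inner v w.
Proof. by rewrite -big_split; apply: eq_bigr => j _; rewrite mxE mulrDl. Qed.

Lemma innerNl (u w : 'rV[int]_n) : inner (- u) w = - inner u w.
Proof. by rewrite -sumrN; apply: eq_bigr => j _; rewrite mxE mulNr. Qed.

Lemma innerC (u v : 'rV[int]_n) : inner u v = inner v u.
Proof. by apply: eq_bigr => j _; rewrite mulrC. Qed.

Lemma innerDr (u v w : 'rV[int]_n) : inner w (u + v) = inner w u + inner w v.
Proof. by rewrite innerC innerDl !(innerC w). Qed.

Lemma innerNr (u w : 'rV[int]_n) : inner w (- u) = - inner w u.
Proof. by rewrite innerC innerNl (innerC w). Qed.

Lemma inner0r (w : 'rV[int]_n) : inner w 0 = 0.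
Proof. by rewrite -(subrr w) innerDr innerNr subrr. Qed.

Lemma inner_eps k l : (0 < k <= n)%N ->
  inner (eps n k) (eps n l) = (k == l)%N%:Z.
Proof.
case: k => // k /= kn; rewrite /inner (bigD1 (Ordinal kn)) //= big1.
  by rewrite !mxE eqxx mul1r addr0; case: (_ == _).
move=> j; rewrite !mxE eqSS -val_eqE /= => /negPf->.
by rewrite mul0r.
Qed.

End InnerProduct.

Lemma rank_leq T n : (rank T n <= n)%N.
Proof. by rewrite /rank; case: T; rewrite ?leq_pred. Qed.

Section RootCombinatorics.
Variables (T : lie_family) (n : nat).
Hypothesis hn : valid_size T n.

Lemma valid_size_ge2 : (1 < n)%N.
Proof. by move: hn; case: T => //= /ltnW/ltnW. Qed.
Let n_gt1 := valid_size_ge2.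

Definition dz (b : bool) : int := (b : nat)%:Z.

Definition eps_alpha (i k : nat) : int :=
  if (i < n)%N then dz (k == i) - dz (k == i.+1) else
  match T with
  | Sl => 0
  | SoOdd => dz (k == n)
  | Sp => dz (k == n) + dz (k == n)
  | SoEven => dz (k == n.-1) + dz (k == n)
  end.

Lemma inner_eps_alpha i k : (0 < k <= n)%N ->
  inner (eps n k) (alpha T n i) = eps_alpha i k.
Proof.
move=> kn; rewrite /alpha /eps_alpha; case: ifP => _.
  by rewrite innerDr innerNr !inner_eps.
by case: T; rewrite ?mulr2n ?innerDr ?inner0r ?inner_eps.
Qed.

Lemma inner_alpha_alpha i j : (0 < i <= n)%N ->
  inner (alpha T n i) (alpha T n j) =
  if (i < n)%N then eps_alpha j i - eps_alpha j i.+1 else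
  match T with
  | Sl => 0
  | SoOdd => eps_alpha j n
  | Sp => eps_alpha j n + eps_alpha j n
  | SoEven => eps_alpha j n.-1 + eps_alpha j n
  end.
Proof.
move=> /andP[i0 i_le]; rewrite {1}/alpha; case: ifP => [i_lt|_].
  by rewrite innerDl innerNl !inner_eps_alpha ?i0 ?i_le.
have n0 : (0 < n <= n)%N by rewrite leqnn (ltnW n_gt1).
have n1 : (0 < n.-1 <= n)%N by have := n_gt1; lia.
rewrite -(inner_eps_alpha j n0) -(inner_eps_alpha j n1).
by case: T; rewrite ?mulr2n ?innerDl ?(innerC 0) ?inner0r.
Qed.

End RootCombinatorics.

(** * Arrows of the vector representation and their combinatorics *)

Section WeightCombinatorics.
Variables (T : lie_family) (n : nat).
Hypothesis hn : valid_size T n.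
Let n_gt1 := valid_size_ge2 hn.

Local Notation eps_alpha := (eps_alpha T n).

(** The exponent with r_i = r ^ [par i] and s_i = s ^ [par i]. *)
Definition par (i : nat) : int :=
  if (i < n)%N then (if T is SoOdd then 2 else 1)
  else if T is Sp then 2 else 1.

(** The exponents of r and of s in p_ij. *)
Definition pexp (i j : nat) : int * int :=
  let c := eps_alpha i in
  match T with
  | Sl => (c j, c j.+1)
  | SoOdd =>
      if (j < n)%N then (2 * c j, 2 * c j.+1)
      else if (i < n)%N then (2 * c n, 0)
      else (c n, - c n)
  | Sp =>
      if (j < n)%N then (c j, c j.+1)
      else if (i < n)%N then (2 * c n, 0)
      else (c n, - c n)
  | SoEven =>
      if (j < n)%N then (c j, c j.+1)
      else if (i != n.-1)%N then (c n.-1, - c n)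
      else (c n, - c n.-1)
  end.

(* The module has basis v_0, ..., v_2n; its weights are eps_1, ..., eps_n, 0,
   - eps_n, ..., - eps_1 in this order, and [mu t k] is the coordinate of the
   weight of v_t along eps_k. *)
Definition mu (t k : nat) : int := dz (t.+1 == k) - dz (t + k == n.*2.+1)%N.

(* e_i sends v_b to a nonzero multiple of v_a. *)
Definition arrow (i b a : nat) : bool :=
  if (i < n)%N then
    (b == i) && (a.+1 == i) || (b + i == n.*2.+1)%N && (a + i == n.*2)%N
  else match T with
  | Sl => false
  | SoOdd => (b == n) && (a.+1 == n) || (b == n.+1) && (a == n)
  | Sp => (b == n.+1) && (a.+1 == n)
  | SoEven => (b == n.+1) && (a.+2 == n) || (b == n.+2) && (a.+1 == n)
  end.

(** For t <= 2n this is the sum of [mu t k] over 1 <= k <= m. It corrects the eigenvalues of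
    omega_n: in types B and C, for instance, e_{n-1} must shift their exponents by (-2, 0), whereas
    [(mu t n, - mu t n)] alone moves by (-1, 1). *)
Definition musum (m t : nat) : int := dz (t < m)%N - dz (n.*2 < t + m)%N.

(* Exponents of r and s in the eigenvalues of omega_j and omega'_j on v_t. *)
Definition wexp (j t : nat) : int * int :=
  if (j < n)%N then (par j * mu t j, par j * mu t j.+1) else
  match T with
  | Sl => (0, 0)
  | SoOdd | Sp =>
      (mu t n - musum n.-1 t, - mu t n - musum n.-1 t)
  | SoEven => (mu t n - musum n.-2 t, - mu t n.-1 - musum n.-2 t)
  end.

Definition wexp' (j t : nat) : int * int :=
  if (j < n)%N then (par j * mu t j.+1, par j * mu t j) else
  match T with
  | Sl => (0, 0)
  | SoOdd | Sp =>
      (- mu t n - musum n.-1 t, mu t n - musum n.-1 t)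
  | SoEven => (- mu t n.-1 - musum n.-2 t, mu t n - musum n.-2 t)
  end.

(** The relation omega_j e_i = p_ij e_i omega_j on v_b: the exponents are linear in the weight, and
    an arrow of label i adds alpha_i to the weight. *)
Lemma wexp_arr i j a b : (0 < i <= rank T n)%N -> (0 < j <= rank T n)%N ->
  arrow i b a ->
  wexp j a = ((wexp j b).1 + (pexp i j).1, (wexp j b).2 + (pexp i j).2).
Proof.
move: hn; rewrite /arrow /wexp /pexp /par /rank /eps_alpha /musum /mu /dz.
case: T => /= hn' ir jr; case: (ltnP i n) => i_n; case: (ltnP j n) => j_n;
  try (by move=> *; exfalso; lia);
  move=> A; try (case: ifP => ?); congr pair; cbn [fst snd];
  try (by clear -A; lia);
  repeat match type of A with
  | is_true (_ || _) => case/orP: A => A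
  end; case/andP: A => /eqP A1 /eqP A2;
  decide_bools; lia.
Qed.

Lemma wexp'_arr i j a b : (0 < i <= rank T n)%N -> (0 < j <= rank T n)%N ->
  arrow i b a ->
  wexp' j a = ((wexp' j b).1 - (pexp j i).1, (wexp' j b).2 - (pexp j i).2).
Proof.
move: hn; rewrite /arrow /wexp' /pexp /par /rank /eps_alpha /musum /mu /dz.
case: T => /= hn' ir jr; case: (ltnP i n) => i_n; case: (ltnP j n) => j_n;
  try (by move=> *; exfalso; lia);
  move=> A; try (case: ifP => ?); congr pair; cbn [fst snd];
  try (by clear -A; lia);
  repeat match type of A with
  | is_true (_ || _) => case/orP: A => A
  end; case/andP: A => /eqP A1 /eqP A2;
  decide_bools; lia.
Qed.

(** The only possible source of an arrow of label i into v_t, and a junk value when there is none;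
    likewise [atgt] for the target of an arrow out of v_t. *)
Definition asrc (i t : nat) : nat :=
  if (i < n)%N then (if (t < n)%N then i else n.*2.+1 - i)%N else
  match T with
  | Sl => 0
  | SoOdd => t.+1
  | Sp => n.+1
  | SoEven => if t.+2 == n then n.+1 else n.+2
  end.

Definition atgt (i t : nat) : nat :=
  if (i < n)%N then t.-1 else
  match T with
  | Sl => 0
  | SoOdd => t.-1
  | Sp => n.-1
  | SoEven => if t == n.+1 then n.-2 else n.-1
  end.

Lemma arr_src i k t : (0 < i <= rank T n)%N -> arrow i k t -> k = asrc i t.
Proof.
rewrite /rank /arrow /asrc; move: hn.
by case: T => /=; case: (ltnP i n) => ? ? ?; try (case: (ltnP t n) => ?);
   try (case: ifP => ?); lia.
Qed.

Lemma arr_tgt i k t : (0 < i <= rank T n)%N -> arrow i t k -> k = atgt i t.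
Proof.
rewrite /rank /arrow /atgt; move: hn.
by case: T => /=; case: (ltnP i n) => ? ? ?; try (case: (ltnP t n) => ?);
   try (case: ifP => ?); lia.
Qed.

Lemma arr_bound i k t : (0 < i <= rank T n)%N -> arrow i k t ->
  (k < n.*2.+1)%N /\ (t < n.*2.+1)%N.
Proof.
rewrite /rank /arrow; move: hn.
by case: T => /=; case: (ltnP i n) => ? ? ?; lia.
Qed.

(** Two labels leave the same vector only in type D, where v_{n+2} is the source of arrows of labels
    n-1 and n. Together with [fork_tgt] this isolates the one place where [e_i, f_j] = 0 for i != j
    is a cancellation of nonzero terms. *)
Lemma fork_src i j k a b : (0 < i <= rank T n)%N -> (0 < j <= rank T n)%N ->
  i != j -> arrow i k a && arrow j k b -> k = n.+2.
Proof.
rewrite /rank /arrow; move: hn.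
by case: T => /=; case: (ltnP i n) => ?; case: (ltnP j n) => ? *; lia.
Qed.

Lemma fork_tgt i j k a b : (0 < i <= rank T n)%N -> (0 < j <= rank T n)%N ->
  i != j -> arrow i a k && arrow j b k -> k = n.-2.
Proof.
rewrite /rank /arrow; move: hn.
by case: T => /=; case: (ltnP i n) => ?; case: (ltnP j n) => ? *; lia.
Qed.

(** In type D the arrows of labels n-1 and n form a square from v_{n+2} through v_{n-1} and v_{n+1}
    to v_{n-2}, opposite sides having equal labels. Elsewhere both sides are false. *)
Lemma fork_square i j a b : (0 < i <= rank T n)%N -> (0 < j <= rank T n)%N ->
  i != j -> arrow i n.+2 a && arrow j n.+2 b = arrow j a n.-2 && arrow i b n.-2.
Proof.
rewrite /rank /arrow; move: hn.
by case: T => /=; case: (ltnP i n) => ?; case: (ltnP j n) => ? *; lia.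
Qed.

(** In the representation this is e_i^2 = 0; the excluded case is the string v_{n+1} -> v_n ->
    v_{n-1} of e_n in type B. *)
Lemma arr_sq i k a b : T <> SoOdd \/ (i < n)%N ->
  arrow i k a -> arrow i b k -> False.
Proof.
move: hn; rewrite /arrow; case: T => /=; case: (ltnP i n) => ? hn' [] //; lia.
Qed.

Lemma arr_cube i k l a b : arrow i k a -> arrow i l k -> arrow i b l -> False.
Proof.
move: hn; rewrite /arrow; case: T => /=; case: (ltnP i n) => ? hn'; lia.
Qed.

(** In the representation this is e_i e_j e_i = 0; the excluded case contains the path v_{n+2} ->
    v_{n+1} -> v_{n-1} -> v_{n-2} of e_{n-1} e_n e_{n-1} in type C. *)
Lemma arr_sandwich i j k l a b : T <> Sp \/ (j < n)%N ->
  (0 < i)%N -> (0 < j)%N -> i != j ->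
  arrow i k a -> arrow j l k -> arrow i b l -> False.
Proof.
move: hn; rewrite /arrow; case: T => /=;
  case: (ltnP i n) => ?; case: (ltnP j n) => ? hn' [] //; lia.
Qed.

Lemma arr_far i j k a b : T <> SoEven -> (i.+1 < j)%N || (j.+1 < i)%N ->
  (0 < i <= rank T n)%N -> (0 < j <= rank T n)%N ->
  arrow i k a -> arrow j b k -> False.
Proof.
move: hn; rewrite /arrow /rank; case: T => //=;
  case: (ltnP i n) => ?; case: (ltnP j n) => ? hn' //; lia.
Qed.

Lemma arr_farD i j k a b : T = SoEven -> i != j -> cartan T n i j = 0 ->
  ~~ ((i == n.-1) && (j == n) || (i == n) && (j == n.-1)) ->
  (0 < i <= rank T n)%N -> (0 < j <= rank T n)%N ->
  (arrow i k a -> arrow j b k -> False) /\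
  (arrow j k a -> arrow i b k -> False).
Proof.
rewrite /cartan => TD ij + nf ir jr.
have ir' : (0 < i <= n)%N by move: ir; rewrite TD.
have jr' : (0 < j <= n)%N by move: jr; rewrite TD.
have -> : inner (alpha T n i) (alpha T n i) = 2.
  rewrite !inner_alpha_alpha // /eps_alpha /dz; move: hn; rewrite TD /=.
  by case: (ltnP i n) => i_n hn'; lia.
rewrite mulKz // !inner_alpha_alpha // /eps_alpha /arrow /dz.
move: hn nf ij {ir jr}; rewrite TD /=.
by case: (ltnP i n) => i_n; case: (ltnP j n) => j_n hn' nf ij a0; split; lia.
Qed.

(** Both e_{n-1} e_n and e_n e_{n-1} only send v_{n+2} to v_{n-2}, the first through v_{n-1} and the
    second through v_{n+1}. *)
Lemma fork_path i j k a b : T = SoEven -> i = n.-1 -> j = n ->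
  [/\ arrow i k a && arrow j b k -> k = n.-1,
    arrow j k a && arrow i b k -> k = n.+1,
    arrow i n.-1 a && arrow j b n.-1 = (b == n.+2) && (a == n.-2)
  & arrow j n.+1 a && arrow i b n.+1 = (b == n.+2) && (a == n.-2)].
Proof.
rewrite /arrow => TD -> ->; move: hn; rewrite TD /= ltnn => hn'.
have -> : (n.-1 < n)%N by lia.
by split; lia.
Qed.

(* Every arrow lowers the height by one. *)
Definition arrow_height (t : nat) : int :=
  match T with
  | Sl | SoOdd => t%:Z
  | Sp => t%:Z - (n < t)%N%:Z
  | SoEven => t%:Z - (n < t)%N%:Z - (n < t)%N%:Z
  end.

Lemma arr_height i b a : (0 < i <= rank T n)%N -> arrow i b a ->
  arrow_height b = arrow_height a + 1.
Proof.
move: hn; rewrite /arrow /arrow_height /rank; case: T => /=;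
  case: (ltnP i n) => ? ? ? ?; lia.
Qed.

(** Ensures that the matrix coefficient at an arrow of label i vanishes on e_j and f_j for j !=
    i. *)
Lemma arr_inj i j b a : (0 < i <= rank T n)%N -> (0 < j <= rank T n)%N ->
  arrow i b a -> arrow j b a -> i = j.
Proof.
move: hn; rewrite /arrow /rank; case: T => /=;
  case: (ltnP i n) => ?; case: (ltnP j n) => ? ? ? ? ?; lia.
Qed.

Lemma arr_exists i : (0 < i <= rank T n)%N ->
  exists a b : 'I_n.*2.+1, arrow i b a.
Proof.
move=> ir; pose a := if (i < n)%N then i.-1 else n.-1.
pose b := if (i < n)%N then i else
  match T with SoOdd => n | Sp => n.+1 | _ => n.+2 end.
have A : arrow i b a.
  move: hn ir; rewrite /arrow /a /b /rank; case: T => /=;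
  case: (ltnP i n) => ? ? ?; lia.
have [bN aN] := arr_bound ir A.
by exists (Ordinal aN), (Ordinal bN).
Qed.

End WeightCombinatorics.

Section FieldWeights.
Variables (T : lie_family) (n : nat).
Hypothesis hn : valid_size T n.
Let n_gt1 := valid_size_ge2 hn.

Variables (K : fieldType) (r s : K).
Definition rsmon (u : int * int) : K := r ^ u.1 * s ^ u.2.

Lemma qparE (q : K) i : (0 < i <= rank T n)%N -> qpar T n q i = q ^ par T n i.
Proof.
move=> /andP[i0 ir].
have i_le : (0 < i <= n)%N.
  by rewrite i0 (leq_trans ir (rank_leq T n)).
rewrite /qpar inner_alpha_alpha // /par /eps_alpha.
move: ir; rewrite /rank /dz; case: T hn => /= hn' ir; case: (ltnP i n) => i_n;
  try lia; congr (q ^ _); lia.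
Qed.

Lemma pmatE i j : (0 < j <= rank T n)%N ->
  pmat T n r s i j = rsmon (pexp T n i j).
Proof.
move=> /andP[j0 jr].
have n0 : (0 < n <= n)%N by rewrite leqnn (ltnW n_gt1).
have n1 : (0 < n.-1 <= n)%N by have := n_gt1; lia.
rewrite /pmat /pexp; move: jr; rewrite /rank; case: T hn => /= hn' jr.
- rewrite !inner_eps_alpha //; lia.
- case: ifP => jn; first by rewrite !inner_eps_alpha //; lia.
  by case: ifP => i_n; rewrite !inner_eps_alpha // /rsmon ?expr0z ?mulr1.
- case: ifP => jn; first by rewrite !inner_eps_alpha //; lia.
  by case: ifP => i_n; rewrite !inner_eps_alpha // /rsmon ?expr0z ?mulr1.
- case: ifP => jn; first by rewrite !inner_eps_alpha //; lia.
  by case: ifP => i_n; rewrite !inner_eps_alpha.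
Qed.

Hypotheses (r0 : r != 0) (s0 : s != 0).

Lemma monD u v : rsmon (u.1 + v.1, u.2 + v.2) = rsmon u * rsmon v.
Proof. by rewrite /rsmon /= !expfzDr // mulrACA. Qed.

Lemma mon_neq0 u : rsmon u != 0.
Proof. by rewrite mulf_neq0 ?expfz_neq0. Qed.

Lemma monV u : (rsmon u)^-1 = rsmon (- u.1, - u.2).
Proof. by rewrite /rsmon invfM !invr_expz. Qed.

End FieldWeights.

(** * Coefficients along the arrows and the commutators of e_i and f_j *)

Section Representation.
Variables (K : fieldType) (r s : K) (T : lie_family) (n : nat).
Hypotheses (hn : valid_size T n) (r0 : r != 0) (s0 : s != 0).
Hypothesis rs : r ^+ 2 != s ^+ 2.

Local Notation I := 'I_(rank T n).
Local Notation nm i := (nat_of_ord i).+1.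
Local Notation N := n.*2.
Local Notation arr := (arrow T n).
Local Notation mon := (rsmon r s).

(* Coefficients of e_i and f_i on the arrow from v_t. *)
Definition ecoef (i t : nat) : K :=
  if T is SoEven then if (i == n) && (t == n.+1) then (r * s)^-1 else 1 else 1.

Definition fcoef (i t : nat) : K :=
  if (i < n)%N then
    if t == i then 1 else (r ^ par T n i * s ^ par T n i)^-1
  else match T with
  | SoOdd => (r + s) / (r * s)
  | Sp => (r * s)^-1
  | Sl | SoEven => 1
  end.

Lemma ecoef_neq0 i t : ecoef i t != 0.
Proof.
rewrite /ecoef; case: T => //; rewrite ?oner_eq0 //.
by case: ifP; rewrite ?oner_eq0 // invr_eq0 mulf_neq0.
Qed.

Lemma rDs_neq0 : r + s != 0.
Proof. by apply: contraNneq rs => e; rewrite -subr_eq0 subr_sqr e mulr0. Qed.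

Lemma rBs_neq0 : r - s != 0.
Proof. by apply: contraNneq rs => e; rewrite -subr_eq0 subr_sqr e mul0r. Qed.

Lemma fcoef_neq0 i t : fcoef i t != 0.
Proof.
rewrite /fcoef; case: ifP => _.
  by case: ifP; rewrite ?oner_eq0 // invr_eq0 mulf_neq0 // expfz_neq0.
have rs0 : (r * s)^-1 != 0 by rewrite invr_eq0 mulf_neq0.
by case: T; rewrite ?oner_eq0 // mulf_neq0 ?rDs_neq0.
Qed.

Lemma par_neq i : r ^ par T n i - s ^ par T n i != 0.
Proof.
have e1 : r ^ 1 - s ^ 1 != 0 by rewrite !expr1z rBs_neq0.
have e2 : r ^ 2 - s ^ 2 != 0 by rewrite subr_eq0.
by rewrite /par; case: ifP => _; case: T.
Qed.

Lemma sum_unique m (P : pred nat) (h : nat -> K) k0 :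
  (forall k, P k -> k = k0) -> (P k0 -> (k0 < m)%N) ->
  \sum_(k < m) (P k)%:R * h k = (P k0)%:R * h k0.
Proof.
move=> Pk0 k0m; case Pk : (P k0); last first.
  rewrite mul0r big1 // => k _; case Pk' : (P k); last by rewrite mul0r.
  by rewrite -(Pk0 _ Pk') Pk' in Pk.
rewrite (bigD1 (Ordinal (k0m Pk))) //= Pk big1 ?addr0 // => k kk0.
case Pk' : (P k); last by rewrite mul0r.
by move: kk0; rewrite -val_eqE /= (Pk0 _ Pk') eqxx.
Qed.

Lemma EF_weights_lt i t : (0 < i < n)%N -> (t < N.+1)%N ->
  (arr i (asrc T n i t) t)%:R
    * (ecoef i (asrc T n i t) * fcoef i (asrc T n i t))
  - (arr i t (atgt T n i t))%:R * (ecoef i t * fcoef i t)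
  = (mon (wexp T n i t) - mon (wexp' T n i t))
    / (r ^ par T n i - s ^ par T n i).
Proof.
move=> /andP[i0 i_n] tN.
(* [b1] and [b2] mark v_t as target and source of the arrow v_i -> v_{i-1}; [b3] and [b4] do so for
   the dual arrow v_{2n+1-i} -> v_{2n-i}. At most one holds, which leaves five rational
   identities. *)
pose b1 := (t.+1 == i); pose b2 := (t == i).
pose b3 := (t + i == N)%N; pose b4 := (t + i == N.+1)%N.
have excl : (b1 + b2 + b3 + b4 <= 1)%N by rewrite /b1 /b2 /b3 /b4; lia.
have lt_case : (t < n)%N -> b3 = false /\ (i + i == N.+1)%N = false.
  by rewrite /b3; lia.
have ge_case : (n <= t)%N ->
    [/\ b1 = false, (N.+1 - i == i)%N = false & (i <= N.+1)%N].
  by rewrite /b1; split; lia.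
have b2_case : b2 -> b4 = false /\ (t.-1.+1 == i) = true.
  by rewrite /b2 /b4; lia.
have b4_case : b4 -> (t.-1 + i == N)%N by rewrite /b4; lia.
have e1 u : ecoef i u = 1 by rewrite /ecoef (ltn_eqF i_n); case: T.
have := par_neq i; rewrite !e1 !mul1r /fcoef /wexp /wexp' /rsmon i_n /=.
set p := par T n i => p0; set V := (r ^ p * s ^ p)^-1; rewrite -/b2.
have R0 : r ^ p != 0 by rewrite expfz_neq0.
have S0 : s ^ p != 0 by rewrite expfz_neq0.
have -> : mu n t i = dz b1 - dz b4 by [].
have -> : mu n t i.+1 = dz b2 - dz b3 by rewrite /mu addnS !eqSS.
have -> : (arr i (asrc T n i t) t)%:R * (if asrc T n i t == i then 1 else V)
  = b1%:R + b3%:R * V.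
  rewrite /arrow /asrc i_n -/b1 -/b3; case: ltnP => tn.
    have [-> ->] := lt_case tn.
    by rewrite eqxx orbF mulr1 mul0r addr0.
  have [-> -> iN] := ge_case tn.
  by rewrite subnK // eqxx add0r.
have -> : (arr i t (atgt T n i t))%:R * (if b2 then 1 else V)
  = b2%:R + b4%:R * V.
  rewrite /arrow /atgt i_n -/b2 -/b4; case: (b2) b2_case => [[]// -> ->|_].
    by rewrite mul0r addr0 mulr1.
  rewrite /= add0r; case: (b4) b4_case => [->//|//].
have d0 : dz false = 0 by []; have d1 : dz true = 1 by [].
by move: excl; rewrite /V;
  case: (b1); case: (b2); case: (b3); case: (b4) => //= _;
  rewrite !(d0, d1) !(subr0, sub0r, subrr, mulr1, mulr0, mulrN1, expr0z)
    -?invr_expz; field; rewrite ?R0 ?S0 ?p0.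
Qed.

(** The arrow into v_t contributes to e_i f_i and the arrow out of v_t to f_i e_i. At a target with
    no outgoing arrow this forces the product of the two coefficients, whence 1, (r_i s_i)^-1, (r +
    s)/(r s) and (r s)^-1. On v_n in type B both arrows are present and cancel, as omega_n =
    omega'_n there. *)
Lemma EF_weights i t : (0 < i <= rank T n)%N -> (t < N.+1)%N ->
  (arr i (asrc T n i t) t)%:R
    * (ecoef i (asrc T n i t) * fcoef i (asrc T n i t))
  - (arr i t (atgt T n i t))%:R * (ecoef i t * fcoef i t)
  = (mon (wexp T n i t) - mon (wexp' T n i t))
    / (r ^ par T n i - s ^ par T n i).
Proof.
move=> ir tN; case: (ltnP i n) => [i_n|n_i].
  by apply: EF_weights_lt => //; move: ir => /andP[-> _].
have {ir n_i} [iE TA] : i = n /\ T <> Sl.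
  by move: ir; rewrite /rank; move: hn; case: T => /= ? ?; split=> //; lia.
rewrite {i}iE.
pose b1 := (t.+1 == n); pose b2 := (t == n); pose b3 := (t == n.+1).
have mE : mu n t n = dz b1 - dz b3.
  by congr (_ - dz _); rewrite /b3; lia.
have d0 : dz false = 0 by []; have d1 : dz true = 1 by [].
have := par_neq n; have := rDs_neq0.
rewrite /arrow /asrc /atgt /ecoef /fcoef /wexp /wexp' /rsmon /par ltnn.
have n2 := valid_size_ge2 hn.
case: T hn TA => // hn' _ p1 p0.
- have -> : (t.+1 == n) && (t.+1 == n) || (t.+1 == n.+1) && (t == n) = b1 || b2.
    by rewrite andbb eqSS andbb.
  have -> : (t == n) && (t.-1.+1 == n) || (t == n.+1) && (t.-1 == n) = b2 || b3.
    by rewrite /b2 /b3; clear -n2; lia.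
  have excl : (b1 + b2 + b3 <= 1)%N by rewrite /b1 /b2 /b3; clear; lia.
  have s0' : b1 || b3 -> musum n n.-1 t = 0.
    by rewrite /musum /b1 /b3 /dz; clear -n2; lia.
  rewrite mE /=; move: excl s0'; case: (b1); case: (b2); case: (b3) => // _ H;
    try rewrite (H isT); rewrite !(d0, d1, subr0, sub0r, subrr, oppr0, opprK);
    rewrite /= ?expr1z ?exprN1; field; rewrite ?r0 ?s0 ?p0 ?p1 //.
- rewrite eqxx andTb -/b1.
  have -> : (t == n.+1) && (n.-1.+1 == n) = b3.
    by rewrite prednK ?eqxx ?andbT // ltnW.
  have excl : (b1 + b3 <= 1)%N by rewrite /b1 /b3; clear; lia.
  have s0' : b1 || b3 -> musum n n.-1 t = 0.
    by rewrite /musum /b1 /b3 /dz; clear -n2; lia.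
  rewrite mE /=; move: excl s0'; case: (b1); case: (b3) => // _ H;
    try rewrite (H isT); rewrite !(d0, d1, subr0, sub0r, subrr, oppr0, opprK);
    rewrite /= ?expr1z ?exprN1 -?exprnP; field; rewrite ?r0 ?s0 ?p0 ?p1 //.
- pose b4 := (t == n.+2); pose c2 := (t.+2 == n).
  have -> : mu n t n.-1 = dz c2 - dz b4.
    by congr (dz _ - dz _); rewrite ?/b4 ?/c2; clear -n2; lia.
  have -> : (((if t.+2 == n then n.+1 else n.+2) == n.+1) && (t.+2 == n)
    || ((if t.+2 == n then n.+1 else n.+2) == n.+2) && (t.+1 == n)) = c2 || b1.
    rewrite /c2 /b1; case: ifP => e; rewrite ?eqxx //=.
    by rewrite eqSS (gtn_eqF (ltnSn _)).
  have -> : (t == n.+1) && ((if t == n.+1 then n.-2 else n.-1).+2 == n)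
    || (t == n.+2) && ((if t == n.+1 then n.-2 else n.-1).+1 == n) = b3 || b4.
    by rewrite /b3 /b4; case: ifP; clear -n2; lia.
  have -> : ((n == n) && ((if t.+2 == n then n.+1 else n.+2) == n.+1)) = c2.
    rewrite eqxx /c2; case: ifP => _ //=; first by rewrite eqxx.
    by rewrite eqSS (gtn_eqF (ltnSn _)).
  have -> : (n == n) && (t == n.+1) = b3 by rewrite eqxx.
  have excl : (c2 + b1 + b3 + b4 <= 1)%N.
    by rewrite /c2 /b1 /b3 /b4; clear; lia.
  have s0' : c2 || b1 || b3 || b4 -> musum n n.-2 t = 0.
    by rewrite /musum /c2 /b1 /b3 /b4 /dz; clear -n2; lia.
  rewrite mE /=; move: excl s0';
    case: (c2); case: (b1); case: (b3); case: (b4) => // _ H;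
    try rewrite (H isT); rewrite !(d0, d1, subr0, sub0r, subrr, oppr0, opprK);
    rewrite /= ?expr1z ?exprN1; field; rewrite ?r0 ?s0 ?p0 ?p1 //.
Qed.

(** The two ways from v_b to v_a in the type D square: f_j then e_i through v_{n+2}, or e_i then f_j
    through v_{n-2}. The factor (r s)^-1 of e_n on v_{n+1} balances that of f_{n-1} on the arrow
    with source v_{n+2}. *)
Lemma fork_coef i j a b : (0 < i <= rank T n)%N -> (0 < j <= rank T n)%N ->
  i != j -> arr i n.+2 a && arr j n.+2 b ->
  ecoef i n.+2 * fcoef j n.+2 = ecoef i b * fcoef j a.
Proof.
rewrite /rank /arrow /ecoef /fcoef; move: hn.
case: T => /= n2; case: (ltnP i n) => i_n; case: (ltnP j n) => j_n ir jr ij H;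
  try by exfalso; lia.
  by rewrite (ltn_eqF i_n).
have [-> -> -> ->] : [/\ j = n.-1, a = n.-1, b = n.+1 & i = n] by split; lia.
rewrite !eqxx /= (gtn_eqF (ltnSn _)) /par.
have -> : (n.-1 < n)%N by lia.
have -> : (n.+2 == n.-1) = false by lia.
by rewrite mulr1 mul1r !expr1z.
Qed.

End Representation.

(** * The twisted vector representation *)

Section MatrixRepresentation.
Variables (K : fieldType) (r s : K) (T : lie_family) (n : nat).
Hypotheses (hn : valid_size T n) (r0 : r != 0) (s0 : s != 0).
Hypothesis rs : r ^+ 2 != s ^+ 2.
Variable c : 'I_(rank T n) -> K.
Hypothesis c0 : forall i, c i != 0.

Local Notation I := 'I_(rank T n).
Local Notation nm i := (nat_of_ord i).+1.
Local Notation N := n.*2.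
Local Notation arr := (arrow T n).
Local Notation mon := (rsmon r s).

(** Scaling e_j, omega_j and omega'_j by a common [c j] respects the relations: both sides of the
    commutator of e_j and f_j are scaled by it, conjugation does not see it, and the Serre relations
    are homogeneous in each e_j. *)
Definition wval (j : I) (t : nat) : K := c j * mon (wexp T n (nm j) t).
Definition wval' (j : I) (t : nat) : K := c j * mon (wexp' T n (nm j) t).

Definition dmx (f : nat -> K) : 'M[K]_N.+1 := diag_mx (\row_(t < N.+1) f t).

Definition mE (i : I) : 'M[K]_N.+1 :=
  \matrix_(a, b) ((arr (nm i) b a)%:R * (c i * ecoef r s T n (nm i) b)).
(** f_i runs along the arrows backwards; [fcoef] is indexed by the source of the arrow, that is, by
    the vector where f_i lands. *)
Definition mF (i : I) : 'M[K]_N.+1 :=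
  \matrix_(a, b) ((arr (nm i) a b)%:R * fcoef r s T n (nm i) a).

Definition gmx (x : gen T n) : 'M[K]_N.+1 :=
  match x with
  | GE i => mE i
  | GF i => mF i
  | GW i => dmx (wval i)
  | GWV i => dmx (fun t => (wval i t)^-1)
  | GW' i => dmx (wval' i)
  | GWV' i => dmx (fun t => (wval' i t)^-1)
  end.

Let nm_bound (i : I) : (0 < nm i <= rank T n)%N.
Proof. by rewrite /= ltn_ord. Qed.

Lemma wval_neq0 j t : wval j t != 0.
Proof. by rewrite mulf_neq0 // mon_neq0. Qed.

Lemma wval'_neq0 j t : wval' j t != 0.
Proof. by rewrite mulf_neq0 // mon_neq0. Qed.

Lemma wval_arr (i j : I) a b : arr (nm i) b a ->
  wval j a = pmat T n r s (nm i) (nm j) * wval j b.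
Proof.
move=> A; rewrite /wval (wexp_arr hn (nm_bound i) (nm_bound j) A).
by rewrite (monD r0 s0) (pmatE hn r s _ (nm_bound j)) mulrA mulrC.
Qed.

Lemma wval'_arr (i j : I) a b : arr (nm i) b a ->
  wval' j a = (pmat T n r s (nm j) (nm i))^-1 * wval' j b.
Proof.
move=> A; rewrite /wval' (wexp'_arr hn (nm_bound i) (nm_bound j) A).
rewrite (pmatE hn r s _ (nm_bound i)) monV.
rewrite (monD r0 s0 _ (- (pexp T n (nm j) (nm i)).1,
  - (pexp T n (nm j) (nm i)).2)).
by rewrite mulrA mulrC.
Qed.

Lemma pmat_neq0 (i j : I) : pmat T n r s (nm i) (nm j) != 0.
Proof. by rewrite (pmatE hn r s _ (nm_bound j)) mon_neq0. Qed.

Lemma dmxM f g : dmx f * dmx g = dmx (fun t => f t * g t).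
Proof.
rewrite -mulmxE mulmx_diag; congr diag_mx.
by apply/rowP => t; rewrite !mxE.
Qed.

Lemma dmx_mulE f A a b : (dmx f * A) a b = f a * A a b.
Proof. by rewrite -mulmxE mul_diag_mx !mxE. Qed.

Lemma mul_dmxE f A a b : (A * dmx f) a b = A a b * f b.
Proof. by rewrite -mulmxE mul_mx_diag !mxE. Qed.

Lemma torus_gmx x : is_torus x -> exists f, gmx x = dmx f.
Proof. by case: x => // i _; eexists. Qed.

Lemma rep_EF i j :
  mE i * mF j - mF j * mE i
  = ((i == j)%:R / (qpar T n r (nm i) - qpar T n s (nm i)))
      *: (dmx (wval i) - dmx (wval' i)).
Proof.
apply/matrixP => a b.
have -> : (mE i * mF j - mF j * mE i) a b = c i *
    (\sum_(k < N.+1) (arr (nm i) k a && arr (nm j) k b)%:R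
       * (ecoef r s T n (nm i) k * fcoef r s T n (nm j) k)
     - \sum_(k < N.+1) (arr (nm j) a k && arr (nm i) b k)%:R
       * (ecoef r s T n (nm i) b * fcoef r s T n (nm j) a)).
  rewrite -!mulmxE !mxE mulrBr !mulr_sumr; congr (_ - _);
    by apply: eq_bigr => k _; rewrite !mxE -mulnb natrM; ring.
have nmi := nm_bound i; have nmj := nm_bound j.
have [<-{j nmj}|ij] := eqVneq i j; last first.
  have nij : nm i != nm j by [].
  (* For i != j the middle vector can only be v_{n+2} when f_j acts first, and v_{n-2} when e_i
     does. *)
  rewrite (sum_unique (P := fun k => arr (nm i) k a && arr (nm j) k b)
    (k0 := n.+2)
    (fun k => ecoef r s T n (nm i) k * fcoef r s T n (nm j) k)); first last.
  - by case/andP=> /(arr_bound hn nmi)[].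
  - by move=> k; apply: (fork_src hn nmi nmj nij).
  rewrite (sum_unique (P := fun k => arr (nm j) a k && arr (nm i) b k)
    (k0 := n.-2)
    (fun=> ecoef r s T n (nm i) b * fcoef r s T n (nm j) a)); first last.
  - by case/andP=> /(arr_bound hn nmj)[].
  - by move=> k; apply: (fork_tgt hn nmj nmi); rewrite eq_sym.
  rewrite mul0r scale0r mxE -(fork_square hn a b nmi nmj nij).
  case P : (_ && _); last by rewrite !mul0r subrr mulr0.
  by rewrite (fork_coef hn r0 s0 rs nmi nmj nij P) subrr mulr0.
rewrite (sum_unique (P := fun k => arr (nm i) k a && arr (nm i) k b)
  (k0 := asrc T n (nm i) a)
    (fun k => ecoef r s T n (nm i) k * fcoef r s T n (nm i) k)); first last.
- by case/andP=> /(arr_bound hn nmi)[].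
- by move=> k /andP[/(arr_src hn nmi)].
rewrite (sum_unique (P := fun k => arr (nm i) a k && arr (nm i) b k)
  (k0 := atgt T n (nm i) a)
    (fun=> ecoef r s T n (nm i) b * fcoef r s T n (nm i) a)); first last.
- by case/andP=> /(arr_bound hn nmi)[].
- by move=> k /andP[/(arr_tgt hn nmi)].
rewrite !mxE; have [<-{b}|ab] := eqVneq a b.
  rewrite !andbb (EF_weights hn r0 s0 rs nmi (ltn_ord a)).
  rewrite !(qparE hn _ nmi) /wval /wval' !mulr1n.
  set D := (r ^ _ - s ^ _)^-1; ring.
(* For i = j off the diagonal: arrows of one label determine source and target from each other, so a
   shared endpoint would give a = b. *)
have -> : arr (nm i) (asrc T n (nm i) a) a
    && arr (nm i) (asrc T n (nm i) a) b = false.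
  apply/negP => /andP[/(arr_tgt hn nmi) aE /(arr_tgt hn nmi) bE].
  by case/eqP: ab; apply: val_inj; rewrite /= aE bE.
have -> : arr (nm i) a (atgt T n (nm i) a)
    && arr (nm i) b (atgt T n (nm i) a) = false.
  apply/negP => /andP[/(arr_src hn nmi) aE /(arr_src hn nmi) bE].
  by case/eqP: ab; apply: val_inj; rewrite /= aE bE.
by rewrite !mulr0n subrr !mul0r subrr !mulr0.
Qed.

(* [walk w a b] is necessary for the matrix coefficient (a, b) of the word w in
   the e_i to be nonzero. *)
Fixpoint walk (w : seq I) (a b : nat) : Prop :=
  if w is i :: w' then exists2 k, arr (nm i) k a & walk w' k b else a = b.

Lemma sum_neq0 (J : finType) (F : J -> K) :
  \sum_j F j != 0 -> exists j, F j != 0.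
Proof.
move=> sF; apply/existsP; apply: contraNT sF => /existsPn F0.
by rewrite big1 // => j _; apply/eqP; rewrite -[_ == _]negbK.
Qed.

Lemma walk_mE w (a b : 'I_N.+1) : (\prod_(i <- w) mE i) a b != 0 -> walk w a b.
Proof.
elim: w a => [|i w IH] a.
  by rewrite big_nil !mxE; case: (eqVneq a b) => [->//|_]; rewrite eqxx.
rewrite big_cons -mulmxE mxE => /sum_neq0[k].
rewrite mulf_eq0 negb_or mxE => /andP[iE wE]; exists k; last exact: IH.
by move: iE; case: (arr _ _ _) => //; rewrite mul0r eqxx.
Qed.

(** The f-matrices have the transposed pattern and the f-words are reversed, so the same walks
    control both families of Serre relations. *)
Lemma walk_mF w (a b : 'I_N.+1) :
  (\prod_(i <- rev w) mF i) a b != 0 -> walk w b a.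
Proof.
elim: w b => [|i w IH] b.
  by rewrite big_nil !mxE; case: (eqVneq a b) => [->//|_]; rewrite eqxx.
rewrite rev_cons -cats1 big_cat big_seq1 /= -mulmxE mxE => /sum_neq0[k].
rewrite mulf_eq0 negb_or mxE => /andP[wE iE]; exists k; last exact: IH.
by move: iE; case: (arr _ _ _) => //; rewrite mul0r eqxx.
Qed.

Definition no_walks (f : seq (K * seq I)) : Prop :=
  forall m, m \in f -> forall a b, ~ walk m.2 a b.

Lemma poly_eval_mE f : no_walks f -> poly_eval mE f = 0.
Proof.
move=> fW; rewrite /poly_eval big_seq big1 // => m /fW mW.
apply/matrixP => a b; rewrite !mxE.
have [->|/walk_mE/mW//] := eqVneq ((\prod_(i <- m.2) mE i) a b) 0.
by rewrite mulr0.
Qed.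

Lemma poly_eval_mF f : no_walks f ->
  poly_eval mF [seq (m.1, rev m.2) | m <- f] = 0.
Proof.
move=> fW; rewrite /poly_eval big_map big_seq big1 // => m /fW mW.
apply/matrixP => a b; rewrite !mxE /=.
have [->|/walk_mF/mW//] := eqVneq ((\prod_(i <- rev m.2) mF i) a b) 0.
by rewrite mulr0.
Qed.

Lemma walks2 (i j : I) (x y : K) :
  (forall a k b, arr (nm i) k a -> arr (nm j) b k -> False) ->
  (forall a k b, arr (nm j) k a -> arr (nm i) b k -> False) ->
  no_walks [:: (x, [:: i; j]); (y, [:: j; i])].
Proof.
move=> ij ji m; rewrite !inE => /orP[]/eqP-> a b /= [k h [k' h' _]].
  exact: ij h h'.
exact: ji h h'.
Qed.

Lemma walks3 (i j : I) (x y z : K) :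
  T <> SoOdd \/ (nm i < n)%N -> T <> Sp \/ (nm j < n)%N -> nm i != nm j ->
  no_walks [:: (x, [:: i; i; j]); (y, [:: i; j; i]); (z, [:: j; i; i])].
Proof.
move=> iB jC ij m.
have sq := arr_sq hn iB; have sw := arr_sandwich hn jC (ltn0Sn _) (ltn0Sn _) ij.
rewrite !inE => /or3P[]/eqP-> a b /= [k h [k' h' [k'' h'' _]]].
- exact: sq h h'.
- exact: sw h h' h''.
- exact: sq h' h''.
Qed.

Lemma serre_walks f : serre r s T n f ->
  no_walks f \/ exists i j : I, [/\ T = SoEven, nm i = n.-1, nm j = n
    & f = [:: (1, [:: i; j]); (- (r * s), [:: j; i])]].
Proof.
have n2 := valid_size_ge2 hn.
case=> {f}.
- move=> i j TD ij; left; apply: walks2 => a k b.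
    by apply: (arr_far hn).
  by apply: (arr_far hn) => //; rewrite orbC.
- move=> i j TD ij aij nf; left; have nij : nm i != nm j by [].
  have far k a b :=
    arr_farD hn k a b TD nij aij nf (nm_bound i) (nm_bound j).
  by apply: walks2 => a k b; case: (far k a b).
- by move=> i j TD iE jE; right; exists i, j.
- move=> i j TAD ij _; left; apply: walks3; try by left; case: TAD => ->.
  by lia.
- move=> i j TAD ij _; left; apply: walks3; try by left; case: TAD => ->.
  by lia.
- move=> i j TB jE; left; apply: walks3; last by lia.
    by right; rewrite -jE; apply: leq_trans (ltn_ord j) (rank_leq T n).
  by left; rewrite TB.
- move=> i j TB jE i_n; left; apply: walks3.
  + by right; rewrite jE; lia.
  + by left; rewrite TB.
  + by lia.
- move=> i j TB iE jE c'; left=> m.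
  (* Here e_n^2 is nonzero, but each word contains e_n^3 or e_n e_{n-1} e_n. *)
  have cube := arr_cube hn; have sw : forall k l a b, arr (nm j) k a ->
      arr (nm i) l k -> arr (nm j) b l -> False.
    move=> k l a b; apply: (arr_sandwich hn) => //; first by left; rewrite TB.
    by lia.
  rewrite !inE => /or4P[]/eqP-> a b /=
    [k1 h1 [k2 h2 [k3 h3 [k4 h4 _]]]].
  + exact: cube h1 h2 h3.
  + exact: sw h2 h3 h4.
  + exact: sw h1 h2 h3.
  + exact: cube h2 h3 h4.
- move=> i j TC jE i_n; left; apply: walks3; last by lia.
    by left; rewrite TC.
  by right; rewrite jE; lia.
- move=> i j TC jE i_n; left; apply: walks3; last by lia.
    by left; rewrite TC.
  by right; lia.
- move=> i j TC iE jE c'; left=> m.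
  (* Here e_{n-1} e_n e_{n-1} is nonzero, but each word contains e_{n-1}^2. *)
  have sq k a b : arr (nm i) k a -> arr (nm i) b k -> False.
    by apply: (arr_sq hn); left; rewrite TC.
  rewrite !inE => /or4P[]/eqP-> a b /=
    [k1 h1 [k2 h2 [k3 h3 [k4 h4 _]]]].
  + exact: sq h1 h2.
  + exact: sq h1 h2.
  + exact: sq h3 h4.
  + exact: sq h3 h4.
- move=> i j TC iE jE; left; apply: walks3; first by left; rewrite TC.
    by right; rewrite iE; lia.
  by lia.
Qed.

(** Each product has one nonzero entry, between v_{n+2} and v_{n-2}. The path through v_{n+1}
    carries a factor (r s)^-1, for e as well as for f, which the path through v_{n-1} lacks. *)
Lemma fork_serre (i j : I) : T = SoEven -> nm i = n.-1 -> nm j = n ->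
  mE i * mE j = (r * s) *: (mE j * mE i) /\
  mF j * mF i = (r * s) *: (mF i * mF j).
Proof.
move=> TD iE jE; have path k a b := fork_path hn k a b TD iE jE.
have n4 : (3 < n)%N by move: hn; rewrite TD.
have i_n : (nm i < n)%N by lia.
have j_n : (nm j < n)%N = false by lia.
have eE m t : ecoef r s T n m t
    = if (m == n) && (t == n.+1) then (r * s)^-1 else 1.
  by rewrite /ecoef TD.
have fE m t : fcoef r s T n m t
    = if (m < n)%N then if t == m then 1 else (r * s)^-1 else 1.
  by rewrite /fcoef /par TD; case: ifP => mn //; rewrite mn !expr1z.
have eiE t : ecoef r s T n (nm i) t = 1 by rewrite eE (ltn_eqF i_n).
have fjE t : fcoef r s T n (nm j) t = 1 by rewrite fE j_n.
have rs0 : r * s != 0 by rewrite mulf_neq0.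
split; apply/matrixP => a b; rewrite -!mulmxE !mxE.
  have -> : \sum_k mE i a k * mE j k b = c i * c j * \sum_(k < N.+1)
      (arr (nm i) k a && arr (nm j) b k)%:R * ecoef r s T n (nm j) b.
    rewrite mulr_sumr; apply: eq_bigr => k _.
    by rewrite !mxE eiE -mulnb natrM; ring.
  have -> : \sum_k mE j a k * mE i k b = c i * c j * \sum_(k < N.+1)
      (arr (nm j) k a && arr (nm i) b k)%:R * ecoef r s T n (nm j) k.
    rewrite mulr_sumr; apply: eq_bigr => k _.
    by rewrite !mxE eiE -mulnb natrM; ring.
  rewrite (sum_unique (P := fun k => arr (nm i) k a && arr (nm j) b k)
    (k0 := n.-1) (fun=> ecoef r s T n (nm j) b)); first last.
  - by move=> _; lia.
  - by move=> k; case: (path k a b).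
  rewrite (sum_unique (P := fun k => arr (nm j) k a && arr (nm i) b k)
    (k0 := n.+1) (fun k => ecoef r s T n (nm j) k)); first last.
  - by move=> _; lia.
  - by move=> k; case: (path k a b).
  (* The parts of [fork_path] used here do not mention [k]; 0 is a dummy. *)
  have [_ _ -> ->] := path 0%N a b.
  have [bE|] := boolP (b == n.+2 :> nat); last by rewrite !mul0r !mulr0.
  rewrite !eE jE eqxx (eqP bE) eqxx /= (gtn_eqF (ltnSn _)).
  by field; rewrite r0 s0.
have -> : \sum_k mF j a k * mF i k b = \sum_(k < N.+1)
    (arr (nm i) k b && arr (nm j) a k)%:R * fcoef r s T n (nm i) k.
  by apply: eq_bigr => k _; rewrite !mxE fjE -mulnb natrM; ring.
have -> : \sum_k mF i a k * mF j k b = \sum_(k < N.+1)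
    (arr (nm j) k b && arr (nm i) a k)%:R * fcoef r s T n (nm i) a.
  by apply: eq_bigr => k _; rewrite !mxE fjE -mulnb natrM; ring.
rewrite (sum_unique (P := fun k => arr (nm i) k b && arr (nm j) a k)
  (k0 := n.-1) (fun k => fcoef r s T n (nm i) k)); first last.
- by move=> _; lia.
- by move=> k; case: (path k b a).
rewrite (sum_unique (P := fun k => arr (nm j) k b && arr (nm i) a k)
  (k0 := n.+1) (fun=> fcoef r s T n (nm i) a)); first last.
- by move=> _; lia.
- by move=> k; case: (path k b a).
have [_ _ -> ->] := path 0%N b a.
have [aE|] := boolP (a == n.+2 :> nat); last by rewrite !mul0r !mulr0.
rewrite !fE i_n -iE eqxx (eqP aE).
have -> : (n.+2 == nm i) = false by lia.
by field; rewrite r0 s0.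
Qed.

Lemma gmx_rel x : relator r s x -> free_lift gmx x = 0.
Proof.
have LM u v : free_lift gmx (u * v) = free_lift gmx u * free_lift gmx v.
  exact: (free_lift_multiplicative gmx).2.
have L1 : free_lift gmx 1 = 1 by exact: (free_lift_multiplicative gmx).1.
have LB := free_lift_additive gmx.
have LL := free_lift_linear gmx.
have LZ k u : free_lift gmx (k *: u) = k *: free_lift gmx u.
  exact: (linear_scale LL).
have LV := free_lift_var gmx.
have LVV a b : free_lift gmx (fvar K a * fvar K b) = gmx a * gmx b.
  by rewrite LM 2!LV.
have LVB a b a' b' :
    free_lift gmx (fvar K a * fvar K b - fvar K a' * fvar K b')
    = gmx a * gmx b - gmx a' * gmx b'.
  exact: etrans (LB _ _) (congr2 (fun u v => u - v) (LVV a b) (LVV a' b')).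
have Lpoly (g : I -> gen T n) f :
    free_lift gmx (poly_eval (fun i => fvar K (g i)) f)
    = poly_eval (fun i => gmx (g i)) f.
  rewrite /poly_eval (linear_sum LL); apply: eq_bigr => m _.
  rewrite LZ (big_morph _ LM L1); congr (_ *: _).
  by apply: eq_bigr => i _; rewrite LV.
case=> {x}.
- move=> x y /torus_gmx[f fx] /torus_gmx[g gy].
  rewrite LVB fx gy 2!dmxM; apply/eqP; rewrite subr_eq0; apply/eqP.
  by congr dmx; apply: funext => t; rewrite mulrC.
- move=> i; rewrite LB LM L1 !LV /= dmxM.
  apply/eqP; rewrite subr_eq0; apply/eqP/matrixP => a b.
  by rewrite !mxE mulfV ?wval_neq0.
- move=> i; rewrite LB LM L1 !LV /= dmxM.
  apply/eqP; rewrite subr_eq0; apply/eqP/matrixP => a b.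
  by rewrite !mxE mulfV ?wval'_neq0.
- move=> i j; rewrite LB LZ !LM !LV /=.
  apply/eqP; rewrite subr_eq0; apply/eqP/matrixP => a b.
  rewrite mul_dmxE dmx_mulE !mxE.
  case A : (arrow _ _ _ _ _); last by rewrite !(mul0r, mulr0).
  rewrite (wval_arr j A); field; rewrite ?wval_neq0 ?pmat_neq0 //.
- move=> i j; rewrite LB LZ !LM !LV /=.
  apply/eqP; rewrite subr_eq0; apply/eqP/matrixP => a b.
  rewrite mul_dmxE dmx_mulE !mxE.
  case A : (arrow _ _ _ _ _); last by rewrite !(mul0r, mulr0).
  rewrite (wval_arr j A); field; rewrite ?wval_neq0 ?pmat_neq0 //.
- move=> i j; rewrite LB LZ !LM !LV /=.
  apply/eqP; rewrite subr_eq0; apply/eqP/matrixP => a b.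
  rewrite mul_dmxE dmx_mulE !mxE.
  case A : (arrow _ _ _ _ _); last by rewrite !(mul0r, mulr0).
  rewrite (wval'_arr j A); field; rewrite ?wval'_neq0 ?pmat_neq0 //.
- move=> i j; rewrite LB LZ !LM !LV /=.
  apply/eqP; rewrite subr_eq0; apply/eqP/matrixP => a b.
  rewrite mul_dmxE dmx_mulE !mxE.
  case A : (arrow _ _ _ _ _); last by rewrite !(mul0r, mulr0).
  rewrite (wval'_arr j A); field; rewrite ?wval'_neq0 ?pmat_neq0 //.
- move=> i j; rewrite LB LVB LZ LB 2!LV /=.
  by apply/eqP; rewrite subr_eq0; apply/eqP/rep_EF.
- move=> f sf; rewrite Lpoly.
  have [|[i [j [TD iE jE ->]]]] := serre_walks sf; first exact: poly_eval_mE.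
  have [e _] := fork_serre TD iE jE.
  rewrite /poly_eval !(big_cons, big_nil) /= !mulr1 addr0 scale1r e.
  by rewrite scaleNr subrr.
- move=> f sf; rewrite Lpoly.
  have [|[i [j [TD iE jE ->]]]] := serre_walks sf; first exact: poly_eval_mF.
  have [_ e] := fork_serre TD iE jE.
  rewrite /poly_eval !(big_cons, big_nil) /= !mulr1 addr0 scale1r e.
  by rewrite scaleNr subrr.
Qed.

End MatrixRepresentation.

(** * Hopf subalgebras *)

Section LinearRetraction.
Variables (K : fieldType) (B V : lmodType K) (i : B -> V).
Hypotheses (iL : linear i) (i_inj : injective i).

Definition meets_image_trivially (C : classical_sets.set V) : Prop :=
  (forall k u v, C u -> C v -> C (k *: u + v)) /\
  (forall b, C (i b) -> b = 0).

(* The comultiplication of a Hopf subalgebra is only known in the tensor square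
   of the ambient algebra; a retraction of the inclusion recovers it. *)
Lemma linear_retraction : exists2 p : V -> B, linear p & cancel i p.
Proof.
have i0 : i 0 = 0 by rewrite -(scale0r 0) (linear_scale iL) scale0r.
(* A maximal [C] is a complement of the image of [i], since any vector outside their sum could be
   adjoined to it; [p] is the projection along [C]. *)
have [F FP totF|C [[CL CB] Cmax]] :=
    @classical_sets.Zorn_bigcup V meets_image_trivially.
  split=> [k u v [X FX Xu] [Y FY Yv]|b [X FX]]; last exact: (FP _ FX).2.
  have [XY|YX] := totF _ _ FX FY.
    by exists Y => //; apply: (FP _ FY).1 => //; apply: XY.
  by exists X => //; apply: (FP _ FX).1 => //; apply: YX.
have C0 : C 0.
  apply: contrapT => nC0; apply: (Cmax (fun v => C v \/ v = 0)).
    split=> [v|sub]; first by left.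
    by apply: nC0; apply: sub; right.
  split=> [k u v [Cu|->] [Cv|->]|b [/CB//|]].
  - by left; apply: CL.
  - by case: nC0; rewrite -(addNr u) -scaleN1r; apply: CL.
  - by left; rewrite scaler0 add0r.
  - by right; rewrite scaler0 addr0.
  - by rewrite -i0 => /i_inj.
have CD u v : C u -> C v -> C (u - v).
  by move=> Cu Cv; rewrite addrC -scaleN1r; apply: CL.
have total u : exists b, C (u - i b).
  apply: contrapT => nu.
  apply: (Cmax (fun v => exists k c, C c /\ v = k *: u + c)).
    split=> [v Cv|sub]; first by exists 0, v; rewrite scale0r add0r.
    apply: nu; exists 0; rewrite i0 subr0; apply: sub.
    by exists 1, 0; rewrite scale1r addr0.
  split=> [k _ _ [k1 [c1 [Cc1 ->]]] [k2 [c2 [Cc2 ->]]]|b [k [c [Cc e]]]].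
    exists (k * k1 + k2), (k *: c1 + c2); split; first exact: CL.
    by rewrite scalerDr scalerA scalerDl addrACA.
  have [k0|k0] := eqVneq k 0.
    by apply: CB; rewrite e k0 scale0r add0r.
  case: nu; exists (k^-1 *: b); rewrite (linear_scale iL) e scalerDr scalerA.
  rewrite mulVf // scale1r opprD addNKr -scaleNr -[_ *: c]addr0.
  exact: CL.
have uniq u b b' : C (u - i b) -> C (u - i b') -> b = b'.
  move=> Cb Cb'; apply/eqP; rewrite -subr_eq0; apply/eqP/CB.
  have -> : i (b - b') = (u - i b') - (u - i b).
    rewrite [X in i X]addrC -scaleN1r iL scaleN1r [LHS]addrC.
    by rewrite opprB [RHS]addrC addrA subrK.
  exact: CD.
pose p u := sval (cid (total u)).
have pP u : C (u - i (p u)) by exact: (svalP (cid (total u))).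
exists p => [k u v|b]; last by apply: (uniq (i b) _ _ (pP _)); rewrite subrr.
apply: (uniq (k *: u + v) _ _ (pP _)); rewrite iL.
have -> : k *: u + v - (k *: i (p u) + i (p v))
  = k *: (u - i (p u)) + (v - i (p v)).
  by rewrite scalerBr opprD addrACA.
exact: CL.
Qed.

End LinearRetraction.

Section HopfSub.
Variables (K : fieldType) (A : algType K) (H : hopf A) (X : A -> Prop).
Variables (HX : hopf (subalg X)) (HXH : hopf_sub HX H).

(** If [p] retracts the inclusion linearly, the tensor square of [p] retracts the tensor square of
    the inclusion. *)
Lemma tmap_val_inj (t t' : tensor (subalg X) (subalg X)) :
  tmap val val t = tmap val val t' -> t = t'.
Proof.
have vL : linear (val : subalg X -> A) by exact: linearP.
have [p pL pK] := linear_retraction vL val_inj.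
have valB : bilin (fun a b : subalg X => tens (val a) (val b)).
  split=> [b k a a'|a k b b']; rewrite linearP.
    exact: (tens_bilin _ _).1.
  exact: (tens_bilin _ _).2.
have pB : bilin (fun a b : A => tens (p a) (p b)).
  split=> [b k a a'|a k b b']; rewrite pL.
    exact: (tens_bilin _ _).1.
  exact: (tens_bilin _ _).2.
suff K' : cancel (tmap (val : subalg X -> A) val) (tmap p p) by apply: can_inj.
move=> u; have [s /eqP->] := tensor_sum u.
rewrite /tmap (tlift_sum s valB) (linear_sum (tlift_linear pB.1 pB.2)).
by apply: eq_bigr => z _; rewrite (tlift_tens pB.1 pB.2) !pK.
Qed.

Lemma comul_sub (J : Type) (r : seq J) (x y : J -> subalg X) b :
  comul H (val b) = \sum_(j <- r) tens (val (x j)) (val (y j)) ->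
  comul HX b = \sum_(j <- r) tens (x j) (y j).
Proof.
have valB : bilin (fun a b : subalg X => tens (val a) (val b)).
  split=> [c k a a'|a k c c']; rewrite linearP.
    exact: (tens_bilin _ _).1.
  exact: (tens_bilin _ _).2.
case: HXH => cX _ _ e; apply: tmap_val_inj.
rewrite cX e /tmap (linear_sum (tlift_linear valB.1 valB.2)).
by apply: eq_bigr => j _; rewrite (tlift_tens valB.1 valB.2).
Qed.

(** Generation is tested by predicates on the ambient algebra, so [P] is carried there by
    quantifying over membership proofs. *)
Lemma subalg_ind (P : subalg X -> Prop) : P 1 ->
  (forall k a b, P a -> P b -> P (k *: a + b)) ->
  (forall a b, P a -> P b -> P (a * b)) ->
  (forall x (Xx : X x), P (Subalg (mem_gen Xx))) ->
  forall a, P a.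
Proof.
move=> P1 PL PM PX [a aG].
have /gen_predP : a \in gen_pred X by [].
move=> /(_ (fun u => `[< exists uG : u \in gen_pred X, P (Subalg uG) >])).
case/(_ _ _)/asboolP.
- split.
  + apply/asboolP; exists (rpred1 _).
    by rewrite (_ : Subalg _ = 1) //; apply: val_inj.
  + move=> k u v /asboolP[uG Pu] /asboolP[vG Pv]; apply/asboolP.
    exists (valP (k *: Subalg uG + Subalg vG)).
    rewrite (_ : Subalg _ = k *: Subalg uG + Subalg vG); first exact: PL.
    exact: val_inj.
  + move=> u v /asboolP[uG Pu] /asboolP[vG Pv]; apply/asboolP.
    exists (valP (Subalg uG * Subalg vG)).
    rewrite (_ : Subalg _ = Subalg uG * Subalg vG); first exact: PM.
    exact: val_inj.
- by move=> x Xx; apply/asboolP; exists (mem_gen Xx).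
- by move=> aG' Pa; rewrite (_ : Subalg aG = Subalg aG') //; apply: val_inj.
Qed.

End HopfSub.

(** * Functionals on the Borel subalgebras *)

Section Triangular.
Variables (K : fieldType) (m : nat) (h : 'I_m.+1 -> int).
Implicit Types M N : 'M[K]_m.+1.

(** Distinct indices of equal height give zero entries too. This matters in types C and D, where two
    basis vectors share a height. *)
Definition tri M : Prop := forall a b, M a b != 0 -> a = b \/ (h a < h b)%R.

Lemma tri1 : tri 1.
Proof.
by move=> a b; rewrite !mxE; case: (eqVneq a b) => [|_]; [left|rewrite eqxx].
Qed.

Lemma tri_lin k M N : tri M -> tri N -> tri (k *: M + N).
Proof.
move=> tM tN a b; rewrite !mxE.
have [-> |/tM//] := eqVneq (M a b) 0.
by rewrite mulr0 add0r => /tN.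
Qed.

Lemma triM M N : tri M -> tri N -> tri (M * N).
Proof.
move=> tM tN a b; rewrite -mulmxE mxE => /sum_neq0[k].
rewrite mulf_eq0 negb_or => /andP[/tM[->/tN//|ak] /tN[<-|kb]]; right=> //.
lia.
Qed.

Lemma tri_diagM M N a : tri M -> tri N -> (M * N) a a = M a a * N a a.
Proof.
move=> tM tN; rewrite -mulmxE mxE (bigD1 a) //= big1 ?addr0 // => k ka.
apply/eqP; rewrite mulf_eq0; apply: contraNT ka; rewrite negb_or.
move=> /andP[/tM[->//|ak] /tN[->//|ka]].
by exfalso; lia.
Qed.

(** No integer lies strictly between [h a] and [h a + 1], so only the indices a and b contribute to
    the product. *)
Lemma tri_stepM M N a b : h b = h a + 1 -> tri M -> tri N ->
  (M * N) a b = M a b * N b b + M a a * N a b.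
Proof.
move=> hb tM tN; have ab : a != b.
  by apply/eqP => ab; move: hb; rewrite ab; lia.
rewrite -mulmxE mxE (bigD1 b) //= (bigD1 a) //=; congr (_ + _).
rewrite big1 ?addr0 // => k /andP[kb ka].
apply/eqP; rewrite mulf_eq0; apply: contraNT ka; rewrite negb_or.
move=> /andP[/tM[->//|ak] /tN[kb'|kb']]; first by rewrite kb' eqxx in kb.
by exfalso; lia.
Qed.

End Triangular.

Section Characters.
Variables (K : fieldType) (A : algType K).

Definition character (chi : A -> K^o) : Prop :=
  [/\ linear chi, chi 1 = 1 & forall x y, chi (x * y) = chi x * chi y].

(** The shape imposed on < f_i, - > by the comultiplication of f_i with its factors crossed, and on
    < -, e_i > by that of e_i; [eps] stands for the counit and [chi] for the character of the
    matching torus element. *)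
Definition skew_derivation (chi eps phi : A -> K^o) : Prop :=
  [/\ linear phi, phi 1 = 0
    & forall x y, phi (x * y) = phi x * eps y + chi x * phi y].

End Characters.

Section TriangularFunctionals.
Variables (K : fieldType) (A : algType K) (X : A -> Prop) (m : nat).
Variables (h : 'I_m.+1 -> int) (rho : A -> 'M[K]_m.+1).
Hypotheses (rhoL : linear rho) (rho1 : rho 1 = 1).
Hypothesis rhoM : forall x y, rho (x * y) = rho x * rho y.
Hypothesis rhoX : forall x, X x -> tri h (rho x).

Lemma tri_subalg (x : subalg X) : tri h (rho (val x)).
Proof.
elim/subalg_ind: x => [|k a b ta tb|a b ta tb|x Xx].
- by rewrite rmorph1 rho1; exact: tri1.
- by rewrite linearP rhoL; exact: tri_lin.
- by rewrite rmorphM rhoM; exact: triM.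
- exact: rhoX.
Qed.

Definition coef (a b : 'I_m.+1) (x : subalg X) : K^o := rho (val x) a b.

Lemma coef_linear a b : linear (coef a b).
Proof. by move=> k x y; rewrite /coef linearP rhoL !mxE. Qed.

Lemma coef_character a : character (coef a a).
Proof.
split=> [||x y]; first exact: coef_linear.
  by rewrite /coef rmorph1 rho1 mxE eqxx.
by rewrite /coef rmorphM rhoM (tri_diagM _ (@tri_subalg x) (@tri_subalg y)).
Qed.

Lemma coef_skew k a b : h b = h a + 1 ->
  skew_derivation (coef a a) (coef b b) (fun x => k * coef a b x).
Proof.
move=> hb; split=> [l x y||x y].
- by rewrite coef_linear mulrDr -scalerAr.
- rewrite /coef rmorph1 rho1 !mxE.
  case: eqVneq => [ab|_]; last by rewrite mulr0.
  by exfalso; move: hb; rewrite ab; lia.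
- rewrite /coef rmorphM rhoM (tri_stepM hb (@tri_subalg x) (@tri_subalg y)).
  by rewrite mulrDr; congr (_ + _); [exact: mulrA | exact: mulrCA].
Qed.

End TriangularFunctionals.

Section BorelFunctionals.
Variables (K : fieldType) (r s : K) (T : lie_family) (n : nat).
Hypotheses (hn : valid_size T n) (r0 : r != 0) (s0 : s != 0).
Hypothesis rs : r ^+ 2 != s ^+ 2.

Local Notation I := 'I_(rank T n).
Local Notation nm i := (nat_of_ord i).+1.
Local Notation N := n.*2.
Local Notation arr := (arrow T n).
Local Notation mon := (rsmon r s).
Local Notation p i j := (pmat T n r s (nm i) (nm j)).

Local Notation height := (arrow_height T n).

Let nm_bound (i : I) : (0 < nm i <= rank T n)%N.
Proof. by rewrite /= ltn_ord. Qed.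

Section Rho.
Variable c : I -> K.
Hypothesis c0 : forall i, c i != 0.

Definition rho (x : Urs r s T n) : 'M[K]_N.+1 := pres_lift (gmx r s c) x.

Let rel0 := gmx_rel hn r0 s0 rs c0.

Lemma rho_linear : linear rho.
Proof. exact: pres_lift_linear rel0. Qed.

Lemma rho_1 : rho 1 = 1.
Proof. exact: pres_lift_1 rel0. Qed.

Lemma rhoM x y : rho (x * y) = rho x * rho y.
Proof. exact: pres_liftM rel0 x y. Qed.

Lemma rho_gen x : rho (pcls _ (fvar K x)) = gmx r s c x.
Proof. by rewrite /rho (pres_lift_pcls rel0) free_lift_var. Qed.

Lemma rho_borel x : borel_gen x -> tri (fun t : 'I_N.+1 => height t) (rho x).
Proof.
have dtri f : tri (fun t : 'I_N.+1 => height t) (dmx n f).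
  move=> a b; rewrite !mxE.
  by case: (eqVneq a b) => [|_]; [left|rewrite mulr0n eqxx].
case=> j; rewrite rho_gen //= => a b; rewrite mxE.
case A : (arrow _ _ _ _ _); rewrite ?mul0r ?eqxx // => _; right.
by rewrite (arr_height hn (nm_bound j) A); lia.
Qed.

Lemma rho_borel' x : borel'_gen x ->
  tri (fun t : 'I_N.+1 => - height t) (rho x).
Proof.
have dtri f : tri (fun t : 'I_N.+1 => - height t) (dmx n f).
  move=> a b; rewrite !mxE.
  by case: (eqVneq a b) => [|_]; [left|rewrite mulr0n eqxx].
case=> j; rewrite rho_gen //= => a b; rewrite mxE.
case A : (arrow _ _ _ _ _); rewrite ?mul0r ?eqxx // => _; right.
by rewrite (arr_height hn (nm_bound j) A); lia.
Qed.

End Rho.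

(** The diagonal coefficient at v_0, with the twist dividing out the untwisted eigenvalue there. It
    kills e_j because no arrow is a loop. *)
Lemma borel_char (d : I -> K) : (forall j, d j != 0) ->
  exists2 chi : borel r s T n -> K^o, character chi & forall j,
    [/\ chi (bE r s j) = 0, chi (bW r s j) = d j & chi (bWV r s j) = (d j)^-1].
Proof.
move=> d0; pose c (j : I) := d j / mon (wexp T n (nm j) 0).
have c0 j : c j != 0 by rewrite mulf_neq0 ?invr_eq0 ?mon_neq0.
have wE j : wval r s c j 0 = d j by rewrite /wval divfK ?mon_neq0.
exists (coef (rho c) (X := @borel_gen _ _ _ _ _) 0 0).
  exact: coef_character (rho_linear c0) (rho_1 c0) (rhoM c0) (rho_borel c0) _.
move=> j; rewrite /coef /= !rho_gen //= !mxE !wE eqxx; split=> //.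
case A : (arrow _ _ _ _ _); last by rewrite mul0r.
by have := arr_height hn (nm_bound j) A; lia.
Qed.

Lemma borel'_char (d : I -> K) : (forall j, d j != 0) ->
  exists2 chi : borel' r s T n -> K^o, character chi & forall j,
    [/\ chi (bF r s j) = 0, chi (bW' r s j) = d j
      & chi (bWV' r s j) = (d j)^-1].
Proof.
move=> d0; pose c (j : I) := d j / mon (wexp' T n (nm j) 0).
have c0 j : c j != 0 by rewrite mulf_neq0 ?invr_eq0 ?mon_neq0.
have wE j : wval' r s c j 0 = d j by rewrite /wval' divfK ?mon_neq0.
exists (coef (rho c) (X := @borel'_gen _ _ _ _ _) 0 0).
  exact: coef_character (rho_linear c0) (rho_1 c0) (rhoM c0) (rho_borel' c0) _.
move=> j; rewrite /coef /= !rho_gen //= !mxE !wE eqxx; split=> //.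
case A : (arrow _ _ _ _ _); last by rewrite mul0r.
by have := arr_height hn (nm_bound j) A; lia.
Qed.

(** Take an arrow v_b -> v_a of label i and the twist for which every omega_j fixes v_b: [eps] is
    the diagonal coefficient at b, [chi] the one at a, and [phi] the coefficient (a, b), scaled to
    be 1 on e_i. *)
Lemma borel_skew (i : I) :
  exists phi chi eps : borel r s T n -> K^o,
  [/\ character chi /\ character eps, skew_derivation chi eps phi
    & forall j, [/\
      [/\ phi (bE r s j) = (i == j)%:R, phi (bW r s j) = 0
        & phi (bWV r s j) = 0],
      [/\ chi (bE r s j) = 0, chi (bW r s j) = p i j
        & chi (bWV r s j) = (p i j)^-1]
    & [/\ eps (bE r s j) = 0, eps (bW r s j) = 1 & eps (bWV r s j) = 1]]].
Proof.
have [a [b A]] := arr_exists hn (nm_bound i).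
pose c (j : I) := (mon (wexp T n (nm j) b))^-1.
have c0 j : c j != 0 by rewrite invr_eq0 mon_neq0.
have wb j : wval r s c j b = 1 by rewrite /wval mulVf ?mon_neq0.
have wa j : wval r s c j a = p i j.
  by rewrite (wval_arr hn r0 s0 c j A) wb mulr1.
have hb : height b = height a + 1 by exact: (arr_height hn (nm_bound i) A).
have ab : (a == b) = false by apply/eqP => ab; move: hb; rewrite ab; lia.
have ar0 (j : I) (t : 'I_N.+1) : arr (nm j) t t = false.
  by apply/negP => /(arr_height hn (nm_bound j)); lia.
have X := rho_borel c0.
pose k := (c i * ecoef r s T n (nm i) b)^-1.
pose cf := coef (rho c) (X := @borel_gen _ _ _ _ _).
exists (fun x => k * cf a b x), (cf a a), (cf b b); split.
- by split; exact: coef_character (rho_linear c0) (rho_1 c0) (rhoM c0) X _.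
- exact: (coef_skew (rho_linear c0) (rho_1 c0) (rhoM c0) X k hb).
move=> j; rewrite /cf /coef /= !rho_gen //= !mxE !eqxx ab !wa !wb !ar0.
rewrite !mul0r !mulr0n !mulr1n mulr0 invr1; split; split=> //.
have [<-|ij] := eqVneq i j.
  by rewrite A mul1r mulVf // mulf_neq0 ?ecoef_neq0.
case A' : (arrow _ _ _ _ _); last by rewrite mul0r mulr0.
case/eqP: ij; apply: val_inj.
by case: (arr_inj hn (nm_bound i) (nm_bound j) A A').
Qed.

Lemma borel'_skew (i : I) :
  exists phi chi eps : borel' r s T n -> K^o,
  [/\ character chi /\ character eps, skew_derivation chi eps phi
    & forall j, [/\
      [/\ phi (bF r s j) = (i == j)%:R, phi (bW' r s j) = 0
        & phi (bWV' r s j) = 0],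
      [/\ chi (bF r s j) = 0, chi (bW' r s j) = p j i
        & chi (bWV' r s j) = (p j i)^-1]
    & [/\ eps (bF r s j) = 0, eps (bW' r s j) = 1 & eps (bWV' r s j) = 1]]].
Proof.
have [a [b A]] := arr_exists hn (nm_bound i).
(* f_i leads from v_a to v_b, so the normalisation is now at v_a and the heights change sign. *)
pose c (j : I) := (mon (wexp' T n (nm j) a))^-1.
have c0 j : c j != 0 by rewrite invr_eq0 mon_neq0.
have wa j : wval' r s c j a = 1 by rewrite /wval' mulVf ?mon_neq0.
have wb j : wval' r s c j b = p j i.
  have := wval'_arr hn r0 s0 c j A; rewrite wa => /esym/(canRL (mulKf _)).
  by rewrite invrK mulr1; apply; rewrite invr_eq0 (pmat_neq0 hn r0 s0).
have hb : - height a = - height b + 1.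
  by have := arr_height hn (nm_bound i) A; lia.
have ab : (b == a) = false by apply/eqP => ab; move: hb; rewrite ab; lia.
have ar0 (j : I) (t : 'I_N.+1) : arr (nm j) t t = false.
  by apply/negP => /(arr_height hn (nm_bound j)); lia.
have X := rho_borel' c0.
pose k := (fcoef r s T n (nm i) b)^-1.
pose cf := coef (rho c) (X := @borel'_gen _ _ _ _ _).
exists (fun x => k * cf b a x), (cf b b), (cf a a); split.
- by split; exact: coef_character (rho_linear c0) (rho_1 c0) (rhoM c0) X _.
- exact: (coef_skew (rho_linear c0) (rho_1 c0) (rhoM c0) X k hb).
move=> j; rewrite /cf /coef /= !rho_gen //= !mxE !eqxx ab !wa !wb !ar0.
rewrite !mul0r !mulr0n !mulr1n mulr0 invr1; split; split=> //.
have [<-|ij] := eqVneq i j.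
  by rewrite A mul1r mulVf // fcoef_neq0.
case A' : (arrow _ _ _ _ _); last by rewrite mul0r mulr0.
case/eqP: ij; apply: val_inj.
by case: (arr_inj hn (nm_bound i) (nm_bound j) A A').
Qed.

End BorelFunctionals.

(** * The antipode *)

Section Antipode.
Variables (K : fieldType) (A : algType K) (H : hopf A).
Local Notation S := (antipode H).
Local Notation eps := (counit H).

Let SL : linear S := antipode_linear H.

(* In the convolution algebra, f = f * id * S. *)
Lemma conv_id_eq0 (f : A -> A) : linear f ->
  (forall b, \sum_(z <- sw H b) f z.1 * z.2 = 0) -> forall b, f b = 0.
Proof.
move=> fL f0 b; rewrite -[b](sw_counitr H) (linear_sum fL).
transitivity (\sum_(z <- sw H b) \sum_(w <- sw H z.2) f z.1 * (w.1 * S w.2)).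
  apply: eq_bigr => z _; rewrite (linear_scale fL) -mulr_sumr sw_antipoder.
  by rewrite -scalerAr mulr1.
rewrite -(sw_coassoc H (F := fun x y z => f x * (y * S z))).
- rewrite big1 // => z _; under eq_bigr => w _ do rewrite mulrA.
  by rewrite -mulr_suml f0 mul0r.
- by move=> y z k x x'; rewrite fL mulrDl -scalerAl.
- by move=> x z k y y'; rewrite mulrDl mulrDr -scalerAl -scalerAr.
- by move=> x y k z z'; rewrite SL !mulrDr -!scalerAr.
Qed.

Lemma antipode_1 : S 1 = 1.
Proof.
have := sw_antipodel H 1; rewrite (sw_1 H (f := fun x y => S x * y)).
  by rewrite mulr1 counit_1 scale1r.
split=> [y k x x'|x k y y'].
  by rewrite SL mulrDl -scalerAl.
by rewrite mulrDr -scalerAr.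
Qed.

Lemma counit_antipode a : eps (S a) = eps a.
Proof.
have eL : linear (eps : A -> K^o) := counit_linear H.
have := congr1 (eps : A -> K^o) (sw_antipodel H a).
rewrite (linear_sum eL) (linear_scale eL) counit_1 [RHS]mulr1 => <-.
rewrite -[X in S X](sw_counitr H) (linear_sum SL) (linear_sum eL).
apply: eq_bigr => z _; rewrite (linear_scale SL) (linear_scale eL).
by rewrite counit_mul mulrC.
Qed.

(** The inverse is carried along because cancelling g yields both the counit and the antipode of
    g. *)
Definition grouplike_pair (g g' : A) : Prop :=
  [/\ comul H g = tens g g, comul H g' = tens g' g', g * g' = 1 & g' * g = 1].

Lemma grouplike_pair_sym g g' : grouplike_pair g g' -> grouplike_pair g' g.
Proof. by case. Qed.

Lemma grouplike_pair_1 : grouplike_pair 1 1.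
Proof. by split; rewrite ?mulr1 ?comul_1. Qed.

Let SmulB : bilin (fun x y : A => S x * y).
Proof.
split=> [y k x x'|x k y y'].
  by rewrite SL mulrDl -scalerAl.
by rewrite mulrDr -scalerAr.
Qed.

Lemma sw_tens (W : lmodType K) (f : A -> A -> W) a x y : bilin f ->
  comul H a = tens x y -> \sum_(z <- sw H a) f z.1 z.2 = f x y.
Proof.
move=> fB e; rewrite (sw_eq (r := [:: tt]) (x := fun=> x) (y := fun=> y) fB).
  by rewrite big_seq1.
by rewrite big_seq1.
Qed.

Lemma sw_tens2 (W : lmodType K) (f : A -> A -> W) a x y x' y' : bilin f ->
  comul H a = tens x y + tens x' y' ->
  \sum_(z <- sw H a) f z.1 z.2 = f x y + f x' y'.
Proof.
move=> fB e; pose c (b : bool) u v : A := if b then u else v.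
rewrite (sw_eq (r := [:: true; false]) (x := fun b => c b x x')
  (y := fun b => c b y y') fB); first by rewrite big_cons big_seq1.
by rewrite big_cons big_seq1.
Qed.

Lemma grouplike_counit g g' : grouplike_pair g g' -> eps g = 1.
Proof.
case=> cg _ gg' _; have := sw_counitl H g.
rewrite (sw_tens (f := fun x y => eps x *: y) _ cg); last first.
  split=> [y k x x'|x k y y'].
    by rewrite counit_linear scalerDl scalerA.
  by rewrite scalerDr !scalerA mulrC.
move/(congr1 ( *%R^~ g')); rewrite -scalerAl gg' => /(congr1 eps).
have eL : linear (eps : A -> K^o) := counit_linear H.
by rewrite (linear_scale eL) counit_1 [X in X = _ -> _]mulr1.
Qed.

Lemma grouplike_antipode g g' : grouplike_pair g g' -> S g = g'.
Proof.
move=> gg; have eg := grouplike_counit gg; case: gg => cg _ gg' _.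
have := sw_antipodel H g; rewrite (sw_tens SmulB cg) eg scale1r.
by move/(congr1 ( *%R^~ g')); rewrite -mulrA gg' mulr1 mul1r.
Qed.

(** As functions of b, S(g b) g and S(b) are both left convolution inverses of the identity, hence
    equal. *)
Lemma grouplike_antimul g g' b : grouplike_pair g g' -> S (g * b) = S b * S g.
Proof.
move=> gg; have eg := grouplike_counit gg; have Sg := grouplike_antipode gg.
case: gg => cg _ gg' _.
have gL : linear (fun b => S (g * b) * g - S b).
  move=> k x y; rewrite mulrDr -scalerAr !SL mulrDl -scalerAl.
  by rewrite scalerBr opprD addrACA.
suff /eqP : S (g * b) * g - S b = 0.
  rewrite subr_eq0 => /eqP/(congr1 ( *%R^~ g')).
  by rewrite -mulrA gg' mulr1 Sg.
apply: (conv_id_eq0 gL) => {}b; under eq_bigr => z _ do rewrite mulrBl.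
rewrite sumrB sw_antipodel -[X in _ - X]mul1r.
have := sw_antipodel H (g * b); rewrite (sw_mul H g b SmulB).
rewrite (sw_tens (f := fun x y => \sum_(w <- sw H b) S (x * w.1) * (y * w.2))
  _ cg); last first.
  split=> [y k x x'|x k y y']; rewrite scaler_sumr -big_split;
    apply: eq_bigr => w _.
    by rewrite mulrDl -scalerAl SL mulrDl -scalerAl.
  by rewrite mulrDl -scalerAl mulrDr -scalerAr.
under eq_bigr => z _ do rewrite mulrA.
by move=> ->; rewrite counit_mul eg !mul1r subrr.
Qed.

Definition skew_primitive (g f : A) : Prop :=
  comul H f = tens 1 f + tens f g.

Lemma skew_primitive_counit g g' f : grouplike_pair g g' ->
  skew_primitive g f -> eps f = 0.
Proof.
move=> gg cf; have eg := grouplike_counit gg.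
have := sw_counitr H f; rewrite (sw_tens2 (f := fun x y => eps y *: x) _ cf).
  rewrite eg scale1r => /(canRL (addrK _)); rewrite subrr.
  have eL : linear (eps : A -> K^o) := counit_linear H.
  have e0 : eps 0 = 0 by rewrite -(scale0r (1 : A)) (linear_scale eL) scale0r.
  by move/(congr1 eps); rewrite (linear_scale eL) counit_1 e0 [LHS]mulr1.
split=> [y k x x'|x k y y'].
  by rewrite scalerDr !scalerA mulrC.
by rewrite counit_linear scalerDl scalerA.
Qed.

Lemma skew_primitive_antipode g g' f : grouplike_pair g g' ->
  skew_primitive g f -> S f = - (f * g').
Proof.
move=> gg cf; have ef := skew_primitive_counit gg cf; case: gg => _ _ gg' _.
have := sw_antipodel H f; rewrite (sw_tens2 SmulB cf) ef scale0r antipode_1.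
rewrite mul1r => /(canRL (addKr _)); rewrite addr0.
by move/(congr1 ( *%R^~ g')); rewrite -mulrA gg' mulr1 mulNr.
Qed.

(** The antipode axiom at f b says that b -> S(b) f + S(f b) g is annihilated by convolution with
    the identity, hence zero; multiplying by g^-1 gives the claim. *)
Lemma skew_primitive_antimul g g' f b : grouplike_pair g g' ->
  skew_primitive g f -> S (f * b) = S b * S f.
Proof.
move=> gg cf; have ef := skew_primitive_counit gg cf.
rewrite (skew_primitive_antipode gg cf); case: gg => _ _ gg' _.
have gL : linear (fun b => S b * f + S (f * b) * g).
  move=> k x y; rewrite mulrDr -scalerAr !SL !mulrDl -!scalerAl scalerDr.
  by rewrite addrACA.
suff /(canRL (addKr _)) : S b * f + S (f * b) * g = 0.
  move/(congr1 ( *%R^~ g')); rewrite addr0 -mulrA gg' mulr1 => ->.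
  by rewrite mulrN mulrA mulNr.
apply: (conv_id_eq0 gL) => {}b; under eq_bigr => z _ do rewrite mulrDl.
rewrite big_split /=.
have := sw_antipodel H (f * b); rewrite (sw_mul H f b SmulB).
rewrite (sw_tens2 (f := fun x y => \sum_(w <- sw H b) S (x * w.1) * (y * w.2))
  _ cf); last first.
  split=> [y k x x'|x k y y']; rewrite scaler_sumr -big_split;
    apply: eq_bigr => w _.
    by rewrite mulrDl -scalerAl SL mulrDl -scalerAl.
  by rewrite mulrDl -scalerAl mulrDr -scalerAr.
rewrite counit_mul ef mul0r scale0r => e; rewrite -[RHS]e; congr (_ + _).
  by apply: eq_bigr => z _; rewrite mul1r mulrA.
by apply: eq_bigr => z _; rewrite mulrA.
Qed.

Variables (Y : Type) (gen : Y -> A).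
Hypothesis gen_ind : forall P : A -> Prop, P 1 ->
  (forall k u v, P u -> P v -> P (k *: u + v)) ->
  (forall u v, P u -> P v -> P (u * v)) -> (forall l, P (gen l)) ->
  forall u, P u.
Hypothesis gen_type : forall l, exists g g', grouplike_pair g g' /\
  (gen l = g \/ skew_primitive g (gen l)).

(** Induction over the generators in the left factor; this replaces the usual uniqueness argument in
    the convolution algebra of maps from A (x) A to A. *)
Lemma antipode_antimul a b : S (a * b) = S b * S a.
Proof.
elim/gen_ind: a b => [|k u v IHu IHv|u v IHu IHv|l] b.
- by rewrite antipode_1 mulr1 mul1r.
- by rewrite mulrDl -scalerAl !SL IHu IHv mulrDr -scalerAr.
- by rewrite -mulrA IHu IHv IHu mulrA.
- have [g [g' [gg [->|gf]]]] := gen_type l; first exact: grouplike_antimul gg.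
  exact: skew_primitive_antimul gg gf.
Qed.

Let SSB : bilin (fun x y : A => tens (S y) (S x)).
Proof.
split=> [y k x x'|x k y y']; rewrite SL.
  exact: (tens_bilin _ _).2.
exact: (tens_bilin _ _).1.
Qed.

Lemma antipode_anticomul a :
  comul H (S a) = \sum_(z <- sw H a) tens (S z.2) (S z.1).
Proof.
have cL := comul_linear H.
elim/gen_ind: a => [|k u v IHu IHv|u v IHu IHv|l].
- by rewrite (sw_1 H SSB) antipode_1 comul_1.
- by rewrite SL cL IHu IHv (sw_linear H SSB).
- rewrite antipode_antimul swP (sw_mul H _ _ (tens_bilin A A)).
  rewrite (sw_mul H u v SSB).
  have tB c d : bilin (fun a b : A => tens (a * c) (b * d)).
    split=> [b k x x'|x k y y']; rewrite mulrDl -scalerAl.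
      exact: (tens_bilin _ _).1.
    exact: (tens_bilin _ _).2.
  have tB' c d : bilin (fun a b : A => tens (c * a) (d * b)).
    split=> [b k x x'|x k y y']; rewrite mulrDr -scalerAr.
      exact: (tens_bilin _ _).1.
    exact: (tens_bilin _ _).2.
  rewrite exchange_big /=.
  under eq_bigr => w _ do rewrite (sw_eq (tB w.1 w.2) IHv).
  rewrite exchange_big [RHS]exchange_big /=; apply: eq_bigr => z _.
  rewrite (sw_eq (tB' (S z.2) (S z.1)) IHu).
  by apply: eq_bigr => w _; rewrite !antipode_antimul.
- have [g [g' [gg [->|gf]]]] := gen_type l.
    rewrite (grouplike_antipode gg); case: (gg) => cg cg' _ _.
    by rewrite (sw_tens SSB cg) (grouplike_antipode gg).
  rewrite (sw_tens2 SSB gf) antipode_1 (grouplike_antipode gg).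
  rewrite (skew_primitive_antipode gg gf) -[X in comul H X]scaleN1r.
  rewrite (linear_scale cL).
  rewrite swP (sw_mul H _ _ (tens_bilin A A)).
  have gB x : bilin (fun a b : A => tens (a * x) (b * x)).
    split=> [b k y y'|y k b b']; rewrite mulrDl -scalerAl.
      exact: (tens_bilin _ _).1.
    exact: (tens_bilin _ _).2.
  have gB' x y : bilin (fun a b : A => tens (x * a) (y * b)).
    split=> [b k z z'|z k b b']; rewrite mulrDr -scalerAr.
      exact: (tens_bilin _ _).1.
    exact: (tens_bilin _ _).2.
  case: (gg) => _ cg' ggV _.
  under eq_bigr => z _ do rewrite (sw_tens (gB' z.1 z.2) cg').
  rewrite (sw_tens2 (gB g') gf) mul1r ggV scalerDr addrC.
  rewrite -[- (gen l * g')]scaleN1r.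
  by rewrite (linear_scale ((tens_bilin A A).1 1))
    (linear_scale ((tens_bilin A A).2 g')).
Qed.

End Antipode.

(** * Invariance of a skew pairing under the antipodes *)

Section PairingAntipode.
Variables (K : fieldType) (A U : algType K) (HA : hopf A) (HU : hopf U).
Variable p : U -> A -> K^o.
Hypothesis pP : skew_dual_pairing HU HA p.
Hypothesis HUanti : forall u, comul HU (antipode HU u)
  = \sum_(z <- sw HU u) tens (antipode HU z.2) (antipode HU z.1).

Lemma skew_pairing_antipode u a : p (antipode HU u) (antipode HA a) = p u a.
Proof.
case: pP => pl0 pr0 p1r p1l pmr pml.
have pl b : linear (p^~ b : U -> K^o) := pl0 b.
have pr v : linear (p v : A -> K^o) := pr0 v.
pose S := antipode HU; pose S' := antipode HA.
have SL : linear S := antipode_linear HU.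
have SL' : linear S' := antipode_linear HA.
have e1 v b : \sum_(z <- sw HU v) \sum_(w <- sw HA b) p z.1 w.1 * p (S z.2) w.2
    = counit HU v * counit HA b :> K^o.
  under eq_bigr => z _ do rewrite -(pairing2_mull HA pl pr) -pml.
  rewrite -(linear_sum (pl b)) sw_antipoder (linear_scale (pl b)).
  by rewrite p1l.
have e2 v b : \sum_(z <- sw HU v) \sum_(w <- sw HA b)
    p (S z.1) w.1 * p (S z.2) (S' w.2) = counit HU v * counit HA b :> K^o.
  (* S reverses the comultiplication of U, which undoes the crossing in the skew axiom. *)
  rewrite exchange_big /=.
  transitivity (\sum_(w <- sw HA b) p (S v) (w.1 * S' w.2)).
    apply: eq_bigr => w _; rewrite pmr (pairing2_mulr HU pl pr).
    have [B1 B2] := mulf_bilin (pl w.1) (pl (S' w.2)).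
    have B : bilin (W := K^o) (fun x y => p y w.1 * p x (S' w.2)) by split.
    by rewrite (sw_eq B (HUanti v)).
  rewrite -(linear_sum (pr (S v))) sw_antipoder (linear_scale (pr (S v))).
  by rewrite p1r [counit _ (S v)]counit_antipode mulrC.
pose q v b : K^o := p (S v) (S' b).
have qL b : linear (q^~ b) by move=> k x y; rewrite /q SL pl.
have qR v : linear (q v) by move=> k x y; rewrite /q SL' pr.
(* [pE] and [qE] multiply by the convolution unit, on the right of [p] and on the left of [q], to
   make room for [e2] and [e1]. *)
have pE v b : p v b = \sum_(z <- sw HU v) \sum_(w <- sw HA b)
    p z.1 w.1 * (counit HU z.2 * counit HA w.2) :> K^o.
  rewrite -{1}[v](sw_counitr HU) (linear_sum (pl b)); apply: eq_bigr => z _.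
  rewrite (linear_scale (pl b)) -{1}[b](sw_counitr HA) (linear_sum (pr _)).
  rewrite scaler_sumr; apply: eq_bigr => w _; rewrite (linear_scale (pr _)).
  by rewrite scalerA; exact: mulrC.
have qE v b : q v b = \sum_(z <- sw HU v) \sum_(w <- sw HA b)
    (counit HU z.1 * counit HA w.1) * q z.2 w.2 :> K^o.
  rewrite -{1}[v](sw_counitl HU) (linear_sum (qL b)); apply: eq_bigr => z _.
  rewrite (linear_scale (qL b)) -{1}[b](sw_counitl HA) (linear_sum (qR _)).
  rewrite scaler_sumr; apply: eq_bigr => w _; rewrite (linear_scale (qR _)).
  by rewrite scalerA.
rewrite -[LHS]/(q u a) qE pE.
(* The summand of the triple convolution of < -, - >, < S -, - > and < S -, S - >, to be
   reassociated in both arguments. *)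
pose F u1 u2 u3 a1 a2 a3 : K^o := p u1 a1 * p (S u2) a2 * q u3 a3.
have mulL (V : lmodType K) (f : V -> K^o) (y : K^o) :
    linear f -> linear (fun x => f x * y : K^o).
  by move=> fL k x x'; rewrite fL mulrDl -scalerAl.
have mulR (V : lmodType K) (f : V -> K^o) (y : K^o) :
    linear f -> linear (fun x => y * f x : K^o).
  by move=> fL k x x'; rewrite fL mulrDr -scalerAr.
have pSL b : linear (fun v => p (S v) b) by move=> k x x'; rewrite SL pl.
have F1 u2 u3 a1 a2 a3 : linear (fun x => F x u2 u3 a1 a2 a3).
  exact: mulL (mulL _ _ _ (pl a1)).
have F2 u1 u3 a1 a2 a3 : linear (fun x => F u1 x u3 a1 a2 a3).
  exact: mulL (mulR _ _ _ (pSL a2)).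
have F3 u1 u2 a1 a2 a3 : linear (fun x => F u1 u2 x a1 a2 a3).
  exact: mulR (qL a3).
have F4 u1 u2 u3 a2 a3 : linear (fun x => F u1 u2 u3 x a2 a3).
  exact: mulL (mulL _ _ _ (pr u1)).
have F5 u1 u2 u3 a1 a3 : linear (fun x => F u1 u2 u3 a1 x a3).
  exact: mulL (mulR _ _ _ (pr (S u2))).
have F6 u1 u2 u3 a1 a2 : linear (fun x => F u1 u2 u3 a1 a2 x).
  exact: mulR (qR u3).
pose G u1 u2 u3 : K^o :=
  \sum_(w <- sw HA a) \sum_(b <- sw HA w.2) F u1 u2 u3 w.1 b.1 b.2.
have sum_lin (V : lmodType K) (J : Type) (l : seq J) (f : J -> V -> K^o) :
    (forall j, linear (f j)) -> linear (fun x => \sum_(j <- l) f j x).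
  move=> fL k x x'; rewrite scaler_sumr -big_split; apply: eq_bigr => j _.
  exact: fL.
have G1 u2 u3 : linear (fun x => G x u2 u3).
  by apply: (sum_lin) => w; apply: (sum_lin) => b; exact: F1.
have G2 u1 u3 : linear (fun x => G u1 x u3).
  by apply: (sum_lin) => w; apply: (sum_lin) => b; exact: F2.
have G3 u1 u2 : linear (fun x => G u1 u2 x).
  by apply: (sum_lin) => w; apply: (sum_lin) => b; exact: F3.
transitivity (\sum_(z <- sw HU u) \sum_(v <- sw HU z.1) G v.1 v.2 z.2).
  apply: eq_bigr => z _.
  transitivity (\sum_(v <- sw HU z.1) \sum_(w <- sw HA a)
      \sum_(b <- sw HA w.1) F v.1 v.2 z.2 b.1 b.2 w.2).
    rewrite [RHS]exchange_big; apply: eq_bigr => w _.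
    rewrite -e1 mulr_suml; apply: eq_bigr => v _.
    by rewrite mulr_suml.
  by apply: eq_bigr => v _; exact: (sw_coassoc HA).
rewrite (sw_coassoc HU) //; apply: eq_bigr => z _.
rewrite exchange_big; apply: eq_bigr => w _.
rewrite -e2 mulr_sumr; apply: eq_bigr => v _.
by rewrite mulr_sumr; apply: eq_bigr => b _; rewrite /F /q mulrA.
Qed.

End PairingAntipode.

(** * The pairing *)

Lemma parameters_neq (R : realType) (K : fieldType) (r s : K) :
  generic_parameters r s \/ complex_parameters R r s ->
  [/\ r != 0, s != 0 & r ^+ 2 != s ^+ 2].
Proof.
case=> [[f [_ fr fs]]|[_ _ [r0 s0 rs _]]]; last by split.
have f_neq0 x : f x != 0 -> x != 0 by rewrite fmorph_eq0.
split.
- by apply: f_neq0; rewrite fr tofrac_eq0 polyX_eq0.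
- by apply: f_neq0; rewrite fs tofrac_eq0 polyC_eq0 polyX_eq0.
- rewrite -subr_eq0; apply: f_neq0; rewrite rmorphB !rmorphXn /= fr fs.
  (* The coefficient of X^2 in X^2 - Y^2 is 1, Y being a constant of the outer polynomial ring. *)
  rewrite -!rmorphXn -rmorphB tofrac_eq0 /=; apply/eqP => /polyP/(_ 2).
  rewrite coefB coefXn -?polyC_exp coefC /= subr0 coef0 => /eqP.
  by rewrite oner_eq0.
Qed.

(* [LG j] stands for e_j in B and for f_j in B', [LW j] for omega_j and omega'_j,
   [LWV j] for their inverses and [L1] for 1; [DB] and [DB'] below list the terms
   of the comultiplication. *)
Inductive letter (I : Type) := LG of I | LW of I | LWV of I | L1.
Arguments L1 {I}.

(** * Uniqueness of a skew pairing with given values on generators *)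

Section SkewPairingUnique.
Variables (K : fieldType) (A U : algType K) (HA : hopf A) (HU : hopf U).
Variables (X Y : Type) (gA : X -> A) (gU : Y -> U) (DA : X -> seq (X * X)).
Hypothesis comulA : forall k,
  comul HA (gA k) = \sum_(z <- DA k) tens (gA z.1) (gA z.2).
Hypothesis genA : forall P : A -> Prop, P 1 ->
  (forall k a b, P a -> P b -> P (k *: a + b)) ->
  (forall a b, P a -> P b -> P (a * b)) -> (forall k, P (gA k)) ->
  forall a, P a.
Hypothesis genU : forall P : U -> Prop, P 1 ->
  (forall k u v, P u -> P v -> P (k *: u + v)) ->
  (forall u v, P u -> P v -> P (u * v)) -> (forall l, P (gU l)) ->
  forall u, P u.

(** Induction on u goes first, against the generators of A, which [comulA] makes stable; induction
    on a then covers all u at once. *)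
Lemma skew_pairing_unique (p q : U -> A -> K^o) :
  skew_dual_pairing HU HA p -> skew_dual_pairing HU HA q ->
  (forall l k, p (gU l) (gA k) = q (gU l) (gA k)) -> p = q.
Proof.
case=> pl pr p1r p1l pmr pml; case=> ql qr q1r q1l qmr qml pq.
have pl' a : linear (p^~ a : U -> K^o) := pl a.
have pr' u : linear (p u : A -> K^o) := pr u.
have ql' a : linear (q^~ a : U -> K^o) := ql a.
have qr' u : linear (q u : A -> K^o) := qr u.
have pqA u k : p u (gA k) = q u (gA k).
  elim/genU: u k => [|c u v IHu IHv|u v IHu IHv|l] k.
  - by rewrite p1l q1l.
  - by rewrite pl' ql' IHu IHv.
  - rewrite pml qml (pairing2_mull HA pl' pr') (pairing2_mull HA ql' qr').
    rewrite (sw_eq (mulf_bilin (pr' u) (pr' v)) (comulA k)).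
    rewrite (sw_eq (mulf_bilin (qr' u) (qr' v)) (comulA k)).
    by apply: eq_bigr => z _; rewrite IHu IHv.
  - exact: pq.
apply: funext => u; apply: funext => a.
elim/genA: a u => [|c a b IHa IHb|a b IHa IHb|k] u.
- by rewrite p1r q1r.
- by rewrite pr' qr' IHa IHb.
- rewrite pmr qmr (pairing2_mulr HU pl' pr') (pairing2_mulr HU ql' qr').
  by apply: eq_bigr => z _; rewrite IHa IHb.
- exact: pqA.
Qed.

End SkewPairingUnique.

(** * The generator functionals and the pairing of the two Borel algebras *)

Section Borel.
Variables (K : fieldType) (r s : K) (T : lie_family) (n : nat).
Hypotheses (r0 : r != 0) (s0 : s != 0) (rs : r ^+ 2 != s ^+ 2).
Hypothesis hn : valid_size T n.
Variables (H : hopf (Urs r s T n)) (hH : standard_hopf H).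
Variables (HB : hopf (borel r s T n)) (hHB : hopf_sub HB H).
Variables (HB' : hopf (borel' r s T n)) (hHB' : hopf_sub HB' H).

Local Notation I := 'I_(rank T n).
Local Notation nm i := (nat_of_ord i).+1.
Local Notation p i j := (pmat T n r s (nm i) (nm j)).
Local Notation B := (borel r s T n).
Local Notation B' := (borel' r s T n).

Definition gB (k : letter I) : B :=
  match k with LG j => bE r s j | LW j => bW r s j | LWV j => bWV r s j
  | L1 => 1 end.

Definition gB' (k : letter I) : B' :=
  match k with LG j => bF r s j | LW j => bW' r s j | LWV j => bWV' r s j
  | L1 => 1 end.

Definition DB (k : letter I) : seq (letter I * letter I) :=
  match k with
  | LG j => [:: (LG j, L1); (LW j, LG j)]
  | _ => [:: (k, k)]
  end.

Definition DB' (k : letter I) : seq (letter I * letter I) :=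
  match k with
  | LG j => [:: (L1, LG j); (LG j, LW j)]
  | _ => [:: (k, k)]
  end.

Lemma comul_gB k : comul HB (gB k) = \sum_(z <- DB k) tens (gB z.1) (gB z.2).
Proof.
apply: (comul_sub hHB (x := fun z => gB z.1) (y := fun z => gB z.2)).
case: k => [j|j|j|].
- by rewrite big_cons big_seq1; exact: (std_comulE hH j).
- by rewrite big_seq1; exact: (std_comulW hH j).
- by rewrite big_seq1; exact: (std_comulWV hH j).
- by rewrite big_seq1; exact: (comul_1 H).
Qed.

Lemma comul_gB' k :
  comul HB' (gB' k) = \sum_(z <- DB' k) tens (gB' z.1) (gB' z.2).
Proof.
apply: (comul_sub hHB' (x := fun z => gB' z.1) (y := fun z => gB' z.2)).
case: k => [j|j|j|].
- by rewrite big_cons big_seq1; exact: (std_comulF hH j).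
- by rewrite big_seq1; exact: (std_comulW' hH j).
- by rewrite big_seq1; exact: (std_comulWV' hH j).
- by rewrite big_seq1; exact: (comul_1 H).
Qed.

Definition counit_letter (k : letter I) : K := if k is LG _ then 0 else 1.

Lemma counit_gB k : counit HB (gB k) = counit_letter k.
Proof.
case: hHB => _ cE _; case: k => [j|j|j|] /=; last exact: counit_1.
- by rewrite cE std_counitE.
- by rewrite cE std_counitW.
- by rewrite cE std_counitWV.
Qed.

Lemma counit_gB' k : counit HB' (gB' k) = counit_letter k.
Proof.
case: hHB' => _ cE _; case: k => [j|j|j|] /=; last exact: counit_1.
- by rewrite cE std_counitF.
- by rewrite cE std_counitW'.
- by rewrite cE std_counitWV'.
Qed.

Lemma gB_ind (P : B -> Prop) : P 1 ->
  (forall k a b, P a -> P b -> P (k *: a + b)) ->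
  (forall a b, P a -> P b -> P (a * b)) -> (forall k, P (gB k)) ->
  forall a, P a.
Proof.
move=> P1 PL PM Pg; apply: subalg_ind => // x Xx; case: Xx => j.
- exact: (Pg (LG j)).
- exact: (Pg (LW j)).
- exact: (Pg (LWV j)).
Qed.

Lemma gB'_ind (P : B' -> Prop) : P 1 ->
  (forall k a b, P a -> P b -> P (k *: a + b)) ->
  (forall a b, P a -> P b -> P (a * b)) -> (forall k, P (gB' k)) ->
  forall a, P a.
Proof.
move=> P1 PL PM Pg; apply: subalg_ind => // x Xx; case: Xx => j.
- exact: (Pg (LG j)).
- exact: (Pg (LW j)).
- exact: (Pg (LWV j)).
Qed.

Lemma character_gB_ext (chi chi' : B -> K^o) :
  character chi -> character chi' -> (forall k, chi (gB k) = chi' (gB k)) ->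
  chi = chi'.
Proof.
move=> [L c1 M] [L' c1' M'] e; apply: funext; apply: gB_ind => //.
- by rewrite c1 c1'.
- by move=> k a b ea eb; rewrite L L' ea eb.
- by move=> a b ea eb; rewrite M M' ea eb.
Qed.

Lemma character_gB'_ext (chi chi' : B' -> K^o) :
  character chi -> character chi' -> (forall k, chi (gB' k) = chi' (gB' k)) ->
  chi = chi'.
Proof.
move=> [L c1 M] [L' c1' M'] e; apply: funext; apply: gB'_ind => //.
- by rewrite c1 c1'.
- by move=> k a b ea eb; rewrite L L' ea eb.
- by move=> a b ea eb; rewrite M M' ea eb.
Qed.

Lemma counit_character (A : algType K) (HA : hopf A) :
  character (counit HA : A -> K^o).
Proof.
split; [exact: (counit_linear HA)|exact: (counit_1 HA)|].
exact: (counit_mul HA).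
Qed.

Let coefv (i : I) : K := (qpar T n s (nm i) - qpar T n r (nm i))^-1.

Definition letter_value (i k : letter I) : K :=
  match i, k with
  | LG i, LG j => (i == j)%:R * coefv i
  | LG _, _ | _, LG _ => 0
  | L1, _ | _, L1 => 1
  | LW i, LW j | LWV i, LWV j => p i j
  | LW i, LWV j | LWV i, LW j => (p i j)^-1
  end.

Lemma functionals_gB : exists phi : letter I -> B -> K^o,
  [/\ forall l, linear (phi l), forall l, phi l 1 = counit_letter l,
    forall l a b, phi l (a * b) = \sum_(z <- DB' l) phi z.2 a * phi z.1 b
  & forall l k, phi l (gB k) = letter_value l k].
Proof.
have p0 (i j : I) : p i j != 0 by exact: pmat_neq0.
have pV0 (i j : I) : (p i j)^-1 != 0 by rewrite invr_eq0.
have chiX (i : I) : exists f : B -> K^o, character f /\ forall j,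
    [/\ f (bE r s j) = 0, f (bW r s j) = p i j & f (bWV r s j) = (p i j)^-1].
  by have [f fc fv] := borel_char hn r0 s0 rs (p0 i); exists f.
have [chi chiP] := choice chiX.
have chiVX (i : I) : exists f : B -> K^o, character f /\ forall j,
    [/\ f (bE r s j) = 0, f (bW r s j) = (p i j)^-1
      & f (bWV r s j) = (p i j)^-1^-1].
  by have [f fc fv] := borel_char hn r0 s0 rs (pV0 i); exists f.
have [chiV chiVP] := choice chiVX.
have eC := counit_character HB.
have skew (i : I) : exists phi : B -> K^o,
    skew_derivation (chi i) (counit HB : B -> K^o) phi /\ forall j,
    [/\ phi (bE r s j) = (i == j)%:R, phi (bW r s j) = 0
      & phi (bWV r s j) = 0].
  have [phi [f [e [[fC e'C] phiS v]]]] := borel_skew hn r0 s0 rs i.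
  exists phi; split; last by move=> j; case: (v j).
  (* [borel_skew] brings its own two characters. Characters are determined by their values on
     generators, so these are the chosen [chi i] and the counit. *)
  have <- : f = chi i.
    have [cC cv] := chiP i; apply: character_gB_ext => // -[j|j|j|] /=.
    - by case: (v j) => _ [-> _ _] _; case: (cv j).
    - by case: (v j) => _ [_ -> _] _; case: (cv j).
    - by case: (v j) => _ [_ _ ->] _; case: (cv j).
    - by case: fC => _ -> _; case: cC.
  have <- // : e = counit HB.
  apply: character_gB_ext => // k; rewrite counit_gB; case: k => [j|j|j|] /=.
  - by case: (v j) => _ _ [].
  - by case: (v j) => _ _ [].
  - by case: (v j) => _ _ [].
  - by case: e'C.
have [phi phiP] := choice skew.
(* A multiple of a skew derivation is again one; the factor [coefv i] produces the value 1/(s_i -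
   r_i). *)
exists (fun l => match l with
  | LG i => fun a => coefv i *: phi i a
  | LW i => chi i
  | LWV i => chiV i
  | L1 => counit HB : B -> K^o
  end); split.
- case=> [i|i|i|].
  + have [[L _ _] _] := phiP i => k a b.
    by rewrite L scalerDr !scalerA [coefv i * k]mulrC.
  + by have [[]] := chiP i.
  + by have [[]] := chiVP i.
  + exact: (counit_linear HB).
- case=> [i|i|i|] /=.
  + by have [[_ -> _] _] := phiP i; rewrite scaler0.
  + by have [[]] := chiP i.
  + by have [[]] := chiVP i.
  + exact: (counit_1 HB).
- case=> [i|i|i|] a b; rewrite !big_cons big_nil /= addr0.
  + have [[_ _ ->] _] := phiP i; rewrite scalerDr; congr (_ + _).
      exact: mulrA.
    exact: mulrCA.
  + by have [[_ _ M] _] := chiP i; exact: M.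
  + by have [[_ _ M] _] := chiVP i; exact: M.
  + exact: (counit_mul HB).
- case=> [i|i|i|] k.
  + have [[_ phi1 _] v] := phiP i; case: k => [j|j|j|] /=.
    * by case: (v j) => -> _ _; exact: mulrC.
    * by case: (v j) => _ -> _; rewrite scaler0.
    * by case: (v j) => _ _ ->; rewrite scaler0.
    * by rewrite phi1 scaler0.
  + have [[_ c1 _] v] := chiP i.
    by case: k => [j|j|j|] //=; case: (v j).
  + have [[_ c1 _] v] := chiVP i.
    by case: k => [j|j|j|] //=; case: (v j) => // _ _; rewrite invrK.
  + by rewrite /= counit_gB; case: k.
Qed.

Lemma functionals_gB' : exists psi : letter I -> B' -> K^o,
  [/\ forall k, linear (psi k), forall k, psi k 1 = counit_letter k,
    forall k a b, psi k (a * b) = \sum_(z <- DB k) psi z.1 a * psi z.2 b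
  & forall k l, psi k (gB' l) = letter_value l k].
Proof.
have p0 (i j : I) : p j i != 0 by exact: pmat_neq0.
have pV0 (i j : I) : (p j i)^-1 != 0 by rewrite invr_eq0.
have chiX (i : I) : exists f : B' -> K^o, character f /\ forall j,
    [/\ f (bF r s j) = 0, f (bW' r s j) = p j i & f (bWV' r s j) = (p j i)^-1].
  by have [f fc fv] := borel'_char hn r0 s0 rs (p0 i); exists f.
have [chi chiP] := choice chiX.
have chiVX (i : I) : exists f : B' -> K^o, character f /\ forall j,
    [/\ f (bF r s j) = 0, f (bW' r s j) = (p j i)^-1
      & f (bWV' r s j) = (p j i)^-1^-1].
  by have [f fc fv] := borel'_char hn r0 s0 rs (pV0 i); exists f.
have [chiV chiVP] := choice chiVX.
have eC := counit_character HB'.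
have skew (i : I) : exists psi : B' -> K^o,
    skew_derivation (chi i) (counit HB' : B' -> K^o) psi /\ forall j,
    [/\ psi (bF r s j) = (i == j)%:R, psi (bW' r s j) = 0
      & psi (bWV' r s j) = 0].
  have [phi [f [e [[fC e'C] phiS v]]]] := borel'_skew hn r0 s0 rs i.
  exists phi; split; last by move=> j; case: (v j).
  have <- : f = chi i.
    have [cC cv] := chiP i; apply: character_gB'_ext => // -[j|j|j|] /=.
    - by case: (v j) => _ [-> _ _] _; case: (cv j).
    - by case: (v j) => _ [_ -> _] _; case: (cv j).
    - by case: (v j) => _ [_ _ ->] _; case: (cv j).
    - by case: fC => _ -> _; case: cC.
  have <- // : e = counit HB'.
  apply: character_gB'_ext => // k; rewrite counit_gB'; case: k => [j|j|j|] /=.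
  - by case: (v j) => _ _ [].
  - by case: (v j) => _ _ [].
  - by case: (v j) => _ _ [].
  - by case: e'C.
have [psi psiP] := choice skew.
exists (fun l => match l with
  | LG i => fun a => coefv i *: psi i a
  | LW i => chi i
  | LWV i => chiV i
  | L1 => counit HB' : B' -> K^o
  end); split.
- case=> [i|i|i|].
  + have [[L _ _] _] := psiP i => k a b.
    by rewrite L scalerDr !scalerA [coefv i * k]mulrC.
  + by have [[]] := chiP i.
  + by have [[]] := chiVP i.
  + exact: (counit_linear HB').
- case=> [i|i|i|] /=.
  + by have [[_ -> _] _] := psiP i; rewrite scaler0.
  + by have [[]] := chiP i.
  + by have [[]] := chiVP i.
  + exact: (counit_1 HB').
- case=> [i|i|i|] a b; rewrite !big_cons big_nil /= addr0.
  + have [[_ _ ->] _] := psiP i; rewrite scalerDr; congr (_ + _).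
      exact: mulrA.
    exact: mulrCA.
  + by have [[_ _ M] _] := chiP i; exact: M.
  + by have [[_ _ M] _] := chiVP i; exact: M.
  + exact: (counit_mul HB').
- case=> [i|i|i|] k.
  + have [[_ psi1 _] v] := psiP i; case: k => [j|j|j|] /=.
    * case: (v j) => -> _ _; rewrite eq_sym; have [->|] := eqVneq j i.
        exact: mulrC.
      by rewrite scaler0 mul0r.
    * by case: (v j) => _ -> _; rewrite scaler0.
    * by case: (v j) => _ _ ->; rewrite scaler0.
    * by rewrite psi1 scaler0.
  + have [[_ c1 _] v] := chiP i.
    by case: k => [j|j|j|] //=; case: (v j).
  + have [[_ c1 _] v] := chiVP i.
    by case: k => [j|j|j|] //=; case: (v j) => // _ _; rewrite invrK.
  + by rewrite /= counit_gB'; case: k.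
Qed.

Lemma grouplike_bW' j : grouplike_pair HB' (bW' r s j) (bWV' r s j).
Proof.
have c := comul_gB' (LW j); have c' := comul_gB' (LWV j).
rewrite big_seq1 in c; rewrite big_seq1 in c'.
have e : uW' r s j * uWV' r s j = 1 :> Urs r s T n.
  apply/eqP; rewrite -subr_eq0 -[1]/(pcls _ 1) -rmorphM -rmorphB.
  by apply/eqP/pcls_rel; exact: RelWV'.
have e' : uW' r s j * uWV' r s j = uWV' r s j * uW' r s j.
  apply/eqP; rewrite -subr_eq0 -!rmorphM -rmorphB.
  by apply/eqP/pcls_rel; exact: RelTorusC.
split; [exact: c | exact: c' | |]; apply: val_inj; first exact: e.
exact: etrans (esym e') e.
Qed.

Lemma borel'_anticomul u : comul HB' (antipode HB' u)
  = \sum_(z <- sw HB' u) tens (antipode HB' z.2) (antipode HB' z.1).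
Proof.
apply: (antipode_anticomul (gen := gB')); first exact: gB'_ind.
case=> [j|j|j|] /=.
- exists (bW' r s j), (bWV' r s j); split; first exact: grouplike_bW'.
  right; rewrite /skew_primitive.
  have := comul_gB' (LG j); rewrite big_cons big_seq1; exact.
- by exists (bW' r s j), (bWV' r s j); split; [exact: grouplike_bW'|left].
- exists (bWV' r s j), (bW' r s j); split; last by left.
  exact/grouplike_pair_sym/grouplike_bW'.
- by exists 1, 1; split; [exact: grouplike_pair_1|left].
Qed.

(** The value on omega'_i^-1 and omega_j is prescribed only through its inverse, and the values
    involving 1 follow from the pairing axioms. *)
Lemma pairing_values_letter (q : B' -> B -> K^o) :
  skew_dual_pairing HB' HB q ->
  pairing_values q <-> forall i k, q (gB' i) (gB k) = letter_value i k.
Proof.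
move=> [ql qr q1r q1l qmr qml]; split=> [[FE WW WWV WVWV WVW FW FWV WE WVE]|v].
  have WVWE i j : q (bWV' r s i) (bW r s j) = (p i j)^-1.
    by rewrite -WW -WVW invrK.
  case=> [i|i|i|] k; last by rewrite q1l /= counit_gB; case: k.
  - case: k => [j|j|j|] /=; rewrite ?FE ?FW ?FWV //.
    by rewrite q1r; exact: (counit_gB' (LG i)).
  - case: k => [j|j|j|] /=; rewrite ?WE ?WWV ?WW //.
    by rewrite q1r; exact: (counit_gB' (LW i)).
  - case: k => [j|j|j|] /=; rewrite ?WVE ?WVWV ?WVWE ?invrK //.
    by rewrite q1r; exact: (counit_gB' (LWV i)).
have vWW i j := v (LW i) (LW j); have vWWV i j := v (LW i) (LWV j).
have vWVW i j := v (LWV i) (LW j); have vWVWV i j := v (LWV i) (LWV j).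
split=> i j.
- exact: (v (LG i) (LG j)).
- exact: vWW.
- by move: (vWW i j) (vWWV i j) => /= -> ->.
- by move: (vWVW i j) (vWVWV i j) => /= -> ->; rewrite invrK.
- by move: (vWVW i j) (vWW i j) => /= -> ->; rewrite invrK.
- exact: (v (LG i) (LW j)).
- exact: (v (LG i) (LWV j)).
- exact: (v (LW i) (LG j)).
- exact: (v (LWV i) (LG j)).
Qed.

Lemma borel_pairing : exists2 q : B' -> B -> K^o,
  skew_dual_pairing HB' HB q & pairing_values q.
Proof.
have [phi [phiL phi1 phiM phiv]] := functionals_gB.
have [psi [psiL psi1 psiM psiv]] := functionals_gB'.
have psi1' k : psi k 1 = counit HB (gB k) by rewrite psi1 counit_gB.
have phi1' k : phi k 1 = counit HB' (gB' k) by rewrite phi1 counit_gB'.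
have psi_phi k l : psi k (gB' l) = phi l (gB k) by rewrite phiv psiv.
have qS := gen_pairing_skew comul_gB comul_gB' psiL phiL psi1' phi1' psiM phiM
  psi_phi gB_ind gB'_ind.
have qv := gen_pairing_gen comul_gB comul_gB' psiL phiL psi1' phi1' psiM phiM
  psi_phi gB_ind gB'_ind.
exists (gen_pairing HB phi gB'_ind); first exact: qS.
by apply/(pairing_values_letter qS) => i k; rewrite qv phiv.
Qed.

End Borel.

Theorem proposition2p3 (R : realType) (K : fieldType) (r s : K)
    (hK : generic_parameters r s \/ complex_parameters R r s)
    (T : lie_family) (n : nat) (hn : valid_size T n)
    (H : hopf (Urs r s T n)) (hH : standard_hopf H)
    (HB : hopf (borel r s T n)) (hHB : hopf_sub HB H)
    (HB' : hopf (borel' r s T n)) (hHB' : hopf_sub HB' H) :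
  exists2 p : borel' r s T n -> borel r s T n -> K,
    unique (fun q => skew_dual_pairing HB' HB q /\ pairing_values q) p &
    forall a b, p (antipode HB' a) (antipode HB b) = p a b.
Proof.
have [r0 s0 rs] := parameters_neq hK.
have [p pS pv] := borel_pairing r0 s0 rs hn hH hHB hHB'.
exists p; last first.
  by apply: skew_pairing_antipode => //; exact: borel'_anticomul hHB'.
split=> // q [qS qv].
apply: (skew_pairing_unique (comul_gB hH hHB) (@gB_ind _ _ _ _ _)
  (@gB'_ind _ _ _ _ _) pS qS) => l k.
have /(pairing_values_letter hH hHB hHB' pS) -> := pv.
by have /(pairing_values_letter hH hHB hHB' qS) -> := qv.
Qed.
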